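(* Let $Q$ be a simply laced quiver, let $\Delta$ be a $Q$-set and let $\omega=a_m\cdots a_1\in Q_m$, with $m\geq 2$, be a Tor-vanishing path, that is $$\mathsf{Tor}_n^{A_{s(a_i)}}\left(M_{a_i},M_{a_{i-1}\cdots a_1}\right)=0\quad\text{for } i=2,\dots,m \text{ and all } n>0.$$ For $r\geq0$ the following holds: $$\mathsf{H}^{m+r}_\omega(\Delta)=\mathsf{Ext}^r_{A_{t(\omega)}-A_{s(\omega)}}(M_\omega,\Delta_\omega).$$
   Context: $k$ is a field; algebras are nonzero associative unital $k$-algebras, not necessarily finite dimensional; $\otimes=\otimes_k$. $\mathsf{Ext}_{C-A}$ denotes $\mathsf{Ext}$ of $C$-$A$-bimodules, i.e. of $C\otimes A^{op}$-modules. Equalities of cohomology spaces mean canonical isomorphisms of vector spaces. **$Q$-sets.** A (finite) quiver $Q$ has a finite set $Q_0$ of vertices, a finite set $Q_1$ of arrows and source and target maps $s,t:Q_1\to Q_0$. It is simply laced if it has no loops and at most one arrow from any vertex to any other. A $Q$-set $\Delta$ consists of an algebra $A_x$ for each $x\in Q_0$; a nonzero $A_{t(a)}$-$A_{s(a)}$-bimodule $M_a={}_{t(a)}M_{s(a)}$ for each $a\in Q_1$ (put ${}_yM_x=0$ if $x\ne y$ and there is no arrow from $x$ to $y$, and ${}_xM_x=A_x$); and bimodule maps $\alpha_{z,y,x}:{}_zM_y\otimes_{A_y}{}_yM_x\to{}_zM_x$ for $x\neq y\neq z$ satisfying the associativity constraints. $\Lambda_\Delta=(\times_xA_x)\oplus(\oplus_aM_a)$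 is the algebra whose product is given by the products of the $A_x$, the bimodule structures, and the maps $\alpha$. Let $e_x$ be the unit of $A_x$. **Paths and trajectories.** A path of length $m>0$ is $\omega=a_m\cdots a_1$ with $a_i\in Q_1$, $t(a_i)=s(a_{i+1})$; $s(\omega)=s(a_1)$, $t(\omega)=t(a_m)$. $Q_m$ is the set of paths of length $m$. The bimodule along $\omega$ is $M_\omega=M_{a_m}\otimes_{A_{s(a_m)}}\cdots\otimes_{A_{s(a_2)}}M_{a_1}$. $\Delta_\omega=e_{t(\omega)}\Lambda_\Delta e_{s(\omega)}$: it is $A_{s(\omega)}$ if $s(\omega)=t(\omega)$, $M_a$ if $s(\omega)\ne t(\omega)$ and $a$ is an arrow from $s(\omega)$ to $t(\omega)$, and $0$ otherwise. A trajectory of duration $n$ over $\omega=a_m\cdots a_1$ is a sequence $\tau=t(a_m)^{p_{m+1}},a_m,s(a_m)^{p_m},\dots,s(a_2)^{p_2},a_1,s(a_1)^{p_1}$ with integers $p_i\ge0$ (waiting times) and $n=m+\sum_ip_i$; $x^p$ means $x$ repeated $p$ times. $T_n(\omega)$ is the set of these. Put $\tau_\Delta=A_{t(a_m)}^{\otimes p_{m+1}}\otimes M_{a_m}\otimes A_{s(a_m)}^{\otimes p_m}\otimes\cdots\otimes M_{a_1}\otimes A_{s(a_1)}^{\otimes p_1}$. $\tau_0^+$ is the set of trajectories of duration $n+1$ obtained from $\tau\in T_n(\omega)$ by increasing one waiting time by one. **Cohomology along a path.** For $\omega\in Q_m$ and $n\ge m$, $\mathsf{H}^n_\omega(\Delta)$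 is the degree $n$ cohomology of the complex $(\mathsf K^\bullet_\omega,\mathsf d)$ with $\mathsf K_\omega^n=\bigoplus_{\tau\in T_n(\omega)}\mathsf{Hom}_k(\tau_\Delta,\Delta_\omega)$ (zero for $n<m$) and $\mathsf d f_\tau=\sum_{\sigma\in\tau_0^+}(df_\tau)_\sigma$, where $(df_\tau)_\sigma$ is the restriction to $\sigma_\Delta$ of the Hochschild coboundary $x_1f_\tau(x_2\otimes\cdots\otimes x_{n+1})+\sum_{i=1}^n(-1)^if_\tau(x_1\otimes\cdots\otimes x_ix_{i+1}\otimes\cdots\otimes x_{n+1})+(-1)^{n+1}f_\tau(x_1\otimes\cdots\otimes x_n)x_{n+1}$ (products in $\Lambda_\Delta$; $f_\tau$ is extended by zero to $\tau'_\Delta$ for all trajectories $\tau'\neq\tau$). *)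

(* Defs.v *)
From HB Require Import structures.
From mathcomp.multinomials Require Import freeg.
From mathcomp Require Import all_boot all_algebra boolp zify.

Set Implicit Arguments.
Unset Strict Implicit.
Unset Printing Implicit Defensive.

Import GRing.Theory.
Local Open Scope quotient_scope.
Local Open Scope ring_scope.

Definition mklin (k : fieldType) (U V : lmodType k) (f : U -> V)
  (lin_f : linear f) : {linear U -> V} :=
  HB.pack f (GRing.isLinear.Build k U V *:%R f lin_f).

Section DProd.
Variables (k : fieldType) (I : Type) (V : I -> lmodType k).

Definition dprod : Type := forall i, V i.
Implicit Types x y z : dprod.

HB.instance Definition _ := gen_eqMixin dprod.
HB.instance Definition _ := gen_choiceMixin dprod.

Definition dprod_add x y : dprod := fun i => x i + y i.
Definition dprod_opp x : dprod := fun i => - x i.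
Definition dprod_zero : dprod := fun=> 0.
Definition dprod_scale (c : k) x : dprod := fun i => c *: x i.

Fact dprod_addA : associative dprod_add.
Proof. by move=> x y z; apply: functional_extensionality_dep => i; apply: addrA. Qed.
Fact dprod_addC : commutative dprod_add.
Proof. by move=> x y; apply: functional_extensionality_dep => i; apply: addrC. Qed.
Fact dprod_add0 : left_id dprod_zero dprod_add.
Proof. by move=> x; apply: functional_extensionality_dep => i; apply: add0r. Qed.
Fact dprod_addN : left_inverse dprod_zero dprod_opp dprod_add.
Proof. by move=> x; apply: functional_extensionality_dep => i; apply: addNr. Qed.
HB.instance Definition _ :=
  GRing.isZmodule.Build dprod dprod_addA dprod_addC dprod_add0 dprod_addN.

Fact dprod_scaleA a b x : dprod_scale a (dprod_scale b x) = dprod_scale (a * b) x.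
Proof. by apply: functional_extensionality_dep => i; apply: scalerA. Qed.
Fact dprod_scale1 : left_id 1 dprod_scale.
Proof. by move=> x; apply: functional_extensionality_dep => i; apply: scale1r. Qed.
Fact dprod_scaleDr : right_distributive dprod_scale +%R.
Proof. by move=> a x y; apply: functional_extensionality_dep => i; apply: scalerDr. Qed.
Fact dprod_scaleDl x : {morph dprod_scale^~ x : a b / a + b}.
Proof. by move=> a b; apply: functional_extensionality_dep => i; apply: scalerDl. Qed.
HB.instance Definition _ := GRing.Zmodule_isLmodule.Build k dprod
  dprod_scaleA dprod_scale1 dprod_scaleDr dprod_scaleDl.

Lemma dprodDE x y i : (x + y) i = x i + y i. Proof. by []. Qed.
Lemma dprodZE c x i : (c *: x) i = c *: x i. Proof. by []. Qed.
Lemma dprod_sumE (J : Type) (r : seq J) (P : pred J) (F : J -> dprod) i :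
  (\sum_(j <- r | P j) F j) i = \sum_(j <- r | P j) F j i.
Proof. by elim/big_rec2: _ => // j y1 y2 _ <-. Qed.

End DProd.

Section LHom.
Variables (k : fieldType) (U V : lmodType k).

(* Hom_k(U, V) as a vector space *)
Definition lhom : Type := {linear U -> V}.
Identity Coercion linear_of_lhom : lhom >-> GRing.Linear.type.
Implicit Types f g h : lhom.

HB.instance Definition _ := gen_eqMixin lhom.
HB.instance Definition _ := gen_choiceMixin lhom.

Lemma lhomP f g : (forall x, f x = g x) -> f = g.
Proof.
move=> /funext; case: f g => [f cf] [g cg] /= efg.
by subst g; congr GRing.Linear.Pack; case: cf cg => [[a] [b]] [[c] [d]];
  rewrite (Prop_irrelevance a c) (Prop_irrelevance b d).
Qed.

Lemma lhomD f x y : f (x + y) = f x + f y.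
Proof. exact: (linearD (f : {linear U -> V})). Qed.
Lemma lhomZ f c x : f (c *: x) = c *: f x.
Proof. exact: (linearZ_LR (f : {linear U -> V}) c x). Qed.
Lemma lhomL f : linear f.
Proof. by move=> c x y; rewrite lhomD lhomZ. Qed.

Fact lhom_add_subproof f g : linear (fun x => f x + g x).
Proof. by move=> c x y; rewrite !lhomL scalerDr addrACA. Qed.
Fact lhom_opp_subproof f : linear (fun x => - f x).
Proof. by move=> c x y; rewrite lhomL opprD scalerN. Qed.
Fact lhom_zero_subproof : linear (fun _ : U => 0 : V).
Proof. by move=> c x y; rewrite scaler0 addr0. Qed.
Fact lhom_scale_subproof a f : linear (fun x => a *: f x).
Proof. by move=> c x y; rewrite lhomL scalerDr !scalerA mulrC. Qed.

Definition lhom_add f g : lhom := mklin (lhom_add_subproof f g).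
Definition lhom_opp f : lhom := mklin (lhom_opp_subproof f).
Definition lhom_zero : lhom := mklin lhom_zero_subproof.
Definition lhom_scale a f : lhom := mklin (lhom_scale_subproof a f).

Fact lhom_addA : associative lhom_add.
Proof. by move=> f g h; apply: lhomP => x; apply: addrA. Qed.
Fact lhom_addC : commutative lhom_add.
Proof. by move=> f g; apply: lhomP => x; apply: addrC. Qed.
Fact lhom_add0 : left_id lhom_zero lhom_add.
Proof. by move=> f; apply: lhomP => x; apply: add0r. Qed.
Fact lhom_addN : left_inverse lhom_zero lhom_opp lhom_add.
Proof. by move=> f; apply: lhomP => x; apply: addNr. Qed.
HB.instance Definition _ :=
  GRing.isZmodule.Build lhom lhom_addA lhom_addC lhom_add0 lhom_addN.

Fact lhom_scaleA a b f : lhom_scale a (lhom_scale b f) = lhom_scale (a * b) f.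
Proof. by apply: lhomP => x; apply: scalerA. Qed.
Fact lhom_scale1 : left_id 1 lhom_scale.
Proof. by move=> f; apply: lhomP => x; apply: scale1r. Qed.
Fact lhom_scaleDr : right_distributive lhom_scale +%R.
Proof. by move=> a f g; apply: lhomP => x; apply: scalerDr. Qed.
Fact lhom_scaleDl f : {morph lhom_scale^~ f : a b / a + b}.
Proof. by move=> a b; apply: lhomP => x; apply: scalerDl. Qed.
HB.instance Definition _ := GRing.Zmodule_isLmodule.Build k lhom
  lhom_scaleA lhom_scale1 lhom_scaleDr lhom_scaleDl.

Lemma lhomDE f g x : (f + g) x = f x + g x. Proof. by []. Qed.
Lemma lhomZE c f x : (c *: f) x = c *: f x. Proof. by []. Qed.

End LHom.

Section Quotients.
Variables (k : fieldType) (V : lmodType k).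

Section Lquot.
Variables (W : {pred V}) (subW : submod_closed W).

Definition zmod_of_submod : zmodClosed V :=
  HB.pack (W : V -> bool)
    (GRing.isZmodClosed.Build V W (GRing.submod_closedB subW)).
Definition lquot : Type := Quotient.quot zmod_of_submod.
HB.instance Definition _ := GRing.Zmodule.on lquot.

Definition qpi (v : V) : lquot := \pi_(Quotient.quot zmod_of_submod) v.

Lemma lquot_subZ c v : v \in W -> c *: v \in W.
Proof. by case: subW => W0 WL vW; rewrite -[_ *: _]addr0 WL. Qed.

Lemma qpi_eq u v : (qpi u = qpi v) <-> (u - v \in W).
Proof. by rewrite (Quotient.idealrBE zmod_of_submod); split => [/eqP|/eqP]. Qed.

Lemma qpiD u v : qpi (u + v) = qpi u + qpi v.
Proof. by rewrite /qpi [RHS]piE. Qed.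

Lemma qpi_repr q : qpi (repr (q : Quotient.quot zmod_of_submod)) = q.
Proof. exact: reprK. Qed.

Definition lquot_scale (c : k) (q : lquot) : lquot :=
  qpi (c *: repr (q : Quotient.quot zmod_of_submod)).

Lemma qpiZ_subproof c v : lquot_scale c (qpi v) = qpi (c *: v).
Proof. by apply/qpi_eq; rewrite -scalerBr; apply: lquot_subZ; apply/qpi_eq; rewrite qpi_repr. Qed.

Lemma lquotP (q : lquot) : exists v, q = qpi v.
Proof. by exists (repr (q : Quotient.quot zmod_of_submod)); rewrite qpi_repr. Qed.

Fact lquot_scaleA a b x : lquot_scale a (lquot_scale b x) = lquot_scale (a * b) x.
Proof. by have [v ->] := lquotP x; rewrite !qpiZ_subproof scalerA. Qed.
Fact lquot_scale1 : left_id 1 lquot_scale.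
Proof. by move=> x; have [v ->] := lquotP x; rewrite qpiZ_subproof scale1r. Qed.
Fact lquot_scaleDr : right_distributive lquot_scale +%R.
Proof.
move=> a x y; have [u ->] := lquotP x; have [v ->] := lquotP y.
by rewrite -qpiD !qpiZ_subproof scalerDr qpiD.
Qed.
Fact lquot_scaleDl x : {morph lquot_scale^~ x : a b / a + b}.
Proof. by move=> a b; have [v ->] := lquotP x; rewrite !qpiZ_subproof scalerDl qpiD. Qed.
HB.instance Definition _ := GRing.Zmodule_isLmodule.Build k lquot
  lquot_scaleA lquot_scale1 lquot_scaleDr lquot_scaleDl.

Lemma qpiZ c v : qpi (c *: v) = c *: qpi v.
Proof. exact: esym (qpiZ_subproof c v). Qed.

Lemma qpiL : linear qpi.
Proof. by move=> c u v; rewrite qpiD qpiZ. Qed.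

Lemma qpi_eq0 v : (qpi v = 0) <-> (v \in W).
Proof.
have -> : 0 = qpi 0 by rewrite -[0 in RHS](scale0r (0 : V)) qpiZ scale0r.
by rewrite qpi_eq subr0.
Qed.

(* the map induced on V / W by a linear map vanishing on W *)
Section Lift.
Variables (U : lmodType k) (f : V -> U).
Hypotheses (lin_f : linear f) (fW : forall w, w \in W -> f w = 0).

Definition lquot_lift (q : lquot) : U := f (repr (q : Quotient.quot zmod_of_submod)).

Lemma lquot_liftE v : lquot_lift (qpi v) = f v.
Proof.
pose F : {linear V -> U} := mklin lin_f.
apply/eqP; rewrite -subr_eq0; apply/eqP.
rewrite /lquot_lift -[f _]/(F _) -[f v]/(F v) -linearB; apply: fW.
by apply/qpi_eq; rewrite qpi_repr.
Qed.

Lemma lquot_lift_lin : linear lquot_lift.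
Proof.
move=> c x y; have [u ->] := lquotP x; have [v ->] := lquotP y.
by rewrite -qpiZ -qpiD !lquot_liftE lin_f.
Qed.
End Lift.
End Lquot.

Section Span.
Variable R : V -> Prop.

Definition span : {pred V} := fun v =>
  `[< forall W : {pred V}, submod_closed W -> (forall r, R r -> r \in W) -> v \in W >].

Fact span_submod : submod_closed span.
Proof.
split; first by apply/asboolP => W [].
move=> c u v /asboolP uW /asboolP vW; apply/asboolP => W sW RW.
by have [_] := sW; apply; [apply: uW | apply: vW].
Qed.

Lemma span_gen r : R r -> r \in span.
Proof. by move=> Rr; apply/asboolP => W _; apply. Qed.

Lemma span_ind (U : lmodType k) (f : V -> U) : linear f ->
  (forall r, R r -> f r = 0) -> forall w, w \in span -> f w = 0.
Proof.
move=> lin_f fR w /asboolP /(_ [pred v | f v == 0]) H; apply/eqP; apply: H.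
  pose F : {linear V -> U} := mklin lin_f.
  split=> [|c u v]; rewrite !inE; first by rewrite -[f 0]/(F 0) linear0.
  by move=> /eqP fu /eqP fv; rewrite lin_f fu fv scaler0 addr0.
by move=> r /fR fr; rewrite inE fr.
Qed.
End Span.
End Quotients.

(* the vector space with generators X and relators R *)
Section Presented.
Variables (k : fieldType) (X : choiceType) (R : {freeg X / k} -> Prop).

Definition fgen (x : X) : {freeg X / k} := Freeg [:: (1, x)].

Definition presented : lmodType k := lquot (span_submod R).
Definition pgen (x : X) : presented := qpi (span_submod R) (fgen x).

Section Lift.
Variables (U : lmodType k) (f : X -> U).
Hypothesis fR : forall r, R r -> fglift f r = 0.

Lemma fglift_lin : linear (fglift f : {freeg X / k} -> U).
Proof.
pose L : {freeg X / k} -> U := fglift f.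
have LB : additive L by exact: lift_is_additive.
pose F : {additive {freeg X / k} -> U} :=
  HB.pack L (GRing.isAdditive.Build _ _ L LB).
have FZ c D : F (c *: D) = c *: F D.
  rewrite -[c *: D]/(fgscale c D) /fgscale -[D in RHS]freeg_sumE !raddf_sum.
  apply: eq_bigr => x _; rewrite [LHS]liftU -scalerA; congr (c *: _).
  exact: esym (liftU _ _ _).
by move=> c u v; rewrite -[LHS]/(F _) raddfD FZ.
Qed.

Definition presented_lift : {linear presented -> U} :=
  mklin (@lquot_lift_lin k _ _ (span_submod R) _ _ fglift_lin (span_ind fglift_lin fR)).
Lemma presented_liftE x : presented_lift (pgen x) = f x.
Proof.
have H := span_ind fglift_lin fR.
rewrite -[LHS]/(lquot_lift (fglift f) (qpi (span_submod R) (fgen x))) (lquot_liftE _ fglift_lin H).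
by rewrite [LHS]liftU scale1r.
Qed.
End Lift.

Lemma presentedP (U : lmodType k) (f g : presented -> U) :
  linear f -> linear g -> (forall x, f (pgen x) = g (pgen x)) -> f =1 g.
Proof.
move=> lf lg fg q; have [v ->] := lquotP q.
pose F : {linear presented -> U} := mklin lf.
pose G : {linear presented -> U} := mklin lg.
pose P : {linear {freeg X / k} -> presented} := mklin (@qpiL k _ _ (span_submod R)).
rewrite -[f _]/(F (P v)) -[g _]/(G (P v)) -[v]freeg_sumE !linear_sum.
apply: eq_bigr => x _.
have -> : << coeff x v *g x >> = coeff x v *: fgen x :> {freeg X / k}.
  by apply/eqP/freeg_eqP=> y; rewrite coeffZ !coeffU mul1r.
by rewrite !linearZ; congr (_ *: _); apply: fg.
Qed.
End Presented.

Section Homology.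
Variables (k : fieldType) (U V W : lmodType k).
Variables (f : {linear U -> V}) (g : {linear V -> W}).

Record ker := Ker { ker_val :> V; kerP : g ker_val == 0 }.
HB.instance Definition _ := [isSub for ker_val].
HB.instance Definition _ := [Choice of ker by <:].

Fact ker_submod : submod_closed (fun v => g v == 0).
Proof.
split=> [|c u v]; rewrite !unfold_in ?linear0// => /eqP gu /eqP gv.
by rewrite linearP gu gv scaler0 addr0.
Qed.
HB.instance Definition _ := GRing.SubChoice_isSubLmodule.Build k V _ ker
  (GRing.submod_closed_semi ker_submod).

Definition im_in_ker : {pred ker} := fun z => `[< exists u, f u = val z >].

Fact im_in_ker_submod : submod_closed im_in_ker.
Proof.
split; first by apply/asboolP; exists 0; rewrite linear0.
move=> c u v /asboolP[x fx] /asboolP[y fy]; apply/asboolP.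
by exists (c *: x + y); rewrite linearP fx fy.
Qed.

(* ker g / (im f :&: ker g), i.e. ker g / im f when g \o f = 0 *)
Definition homology : lmodType k := lquot im_in_ker_submod.
Definition hclass (z : ker) : homology := qpi im_in_ker_submod z.
End Homology.

(* d \o d = 0 is not required, as homology does not need it *)
Record cochain_complex (k : fieldType) := CochainComplex {
  cobj :> nat -> lmodType k;
  cdiff : forall n, {linear cobj n -> cobj n.+1} }.

Section Cohomology.
Variables (k : fieldType) (C : cochain_complex k).

Definition cdiff_in n : {linear C n.-1 -> C n} :=
  match n with
  | 0 => mklin (@lhom_zero_subproof k (C 0%N) (C 0%N))
  | n'.+1 => cdiff C n'
  end.

Definition cocycle n := ker (cdiff C n).
Definition cohom n : lmodType k := homology (cdiff_in n) (cdiff C n).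
Definition cohom_class n (z : cocycle n) : cohom n := hclass (cdiff_in n) z.
End Cohomology.

(* C-A-bimodules on which k acts centrally, i.e. C (x) A^op-modules *)
Record bimod (k : fieldType) (C A : algType k) := Bimod {
  bcar :> lmodType k;
  lact : C -> bcar -> bcar;
  ract : bcar -> A -> bcar;
  lact_linl : forall m, linear (fun c => lact c m);
  lact_linr : forall c, linear (lact c);
  ract_linl : forall a, linear (fun m => ract m a);
  ract_linr : forall m, linear (ract m);
  lact1 : forall m, lact 1 m = m;
  lactM : forall c c' m, lact (c * c') m = lact c (lact c' m);
  ract1 : forall m, ract m 1 = m;
  ractM : forall m a a', ract m (a * a') = ract (ract m a) a';
  lract : forall c m a, ract (lact c m) a = lact c (ract m a) }.

Section RegularBimod.
Variables (k : fieldType) (A : algType k).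
Fact reg_linl (m : A) : linear (fun c : A => c * m).
Proof. by move=> c u v; rewrite mulrDl scalerAl. Qed.
Fact reg_linr (m : A) : linear (fun c : A => m * c).
Proof. by move=> c u v; rewrite mulrDr scalerAr. Qed.
Fact reg_1l (m : A) : 1 * m = m. Proof. exact: mul1r. Qed.
Fact reg_1r (m : A) : m * 1 = m. Proof. exact: mulr1. Qed.
Fact reg_Al (c c' m : A) : c * c' * m = c * (c' * m).
Proof. exact: esym (mulrA c c' m). Qed.
Fact reg_Ar (c c' m : A) : c * (c' * m) = c * c' * m.
Proof. exact: mulrA. Qed.
Definition reg_bimod : bimod A A :=
  @Bimod k A A A *%R *%R reg_linl reg_linr reg_linl reg_linr
    reg_1l reg_Al reg_1r reg_Ar reg_Al.
End RegularBimod.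

Section ZeroBimod.
Variables (k : fieldType) (C A : algType k).
Definition zero_lmod : lmodType k := 'rV[k]_0.
Fact zero_lmod_eq (u v : zero_lmod) : u = v.
Proof. by apply/rowP => -[]. Qed.
Definition zero_bimod : bimod C A :=
  @Bimod k C A zero_lmod (fun _ m => m) (fun m _ => m)
    (fun _ _ _ _ => zero_lmod_eq _ _) (fun _ _ _ _ => zero_lmod_eq _ _)
    (fun _ _ _ _ => zero_lmod_eq _ _) (fun _ _ _ _ => zero_lmod_eq _ _)
    (fun _ => zero_lmod_eq _ _) (fun _ _ _ => zero_lmod_eq _ _)
    (fun _ => zero_lmod_eq _ _) (fun _ _ _ => zero_lmod_eq _ _)
    (fun _ _ _ => zero_lmod_eq _ _).
End ZeroBimod.

(* A left C-module is encoded as a C-k-bimodule: k acting centrally, the right *)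
(* action is the scalar multiplication.                                        *)
Section LeftModule.
Variables (k : fieldType) (C A : algType k) (M : bimod C A).
Fact left_ract_linl (a : k^o) : linear (fun m : M => a *: m).
Proof. by move=> c u v; rewrite scalerDr !scalerA mulrC. Qed.
Fact left_ract_linr (m : M) : linear (fun a : k^o => a *: m).
Proof. by move=> c u v; rewrite scalerDl scalerA. Qed.
Fact left_ractM (m : M) (a a' : k^o) : (a * a') *: m = a' *: (a *: m).
Proof. by rewrite scalerA mulrC. Qed.
Fact left_lract (c : C) (m : M) (a : k^o) : a *: lact c m = lact c (a *: m).
Proof. exact: esym (linearZ_LR (mklin (lact_linr c)) a m). Qed.
Definition left_of_bimod : bimod C k^o :=
  @Bimod k C k^o M (@lact _ _ _ M) (fun m a => a *: m)
    (@lact_linl _ _ _ M) (@lact_linr _ _ _ M) left_ract_linl left_ract_linr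
    (@lact1 _ _ _ M) (@lactM _ _ _ M) (@scale1r _ _) left_ractM left_lract.
End LeftModule.

Section BimodHom.
Variables (k : fieldType) (C A : algType k) (M N : bimod C A).

Definition bimod_map (f : lhom M N) : bool :=
  `[< (forall c m, f (lact c m) = lact c (f m)) /\
      (forall m a, f (ract m a) = ract (f m) a) >].

(* Hom_{C-A}(M, N) *)
Record bihom := Bihom { bihom_val :> lhom M N; bihomP : bimod_map bihom_val }.
HB.instance Definition _ := [isSub for bihom_val].
HB.instance Definition _ := [Choice of bihom by <:].

Fact bihom_submod : submod_closed bimod_map.
Proof.
pose L c := mklin (@lact_linr _ _ _ N c); pose R a := mklin (@ract_linl _ _ _ N a).
split.
  apply/asboolP; split=> [c m|m a]; first by rewrite -[RHS]/(L c 0) linear0.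
  by rewrite -[RHS]/(R a 0) linear0.
move=> c f g /asboolP[fl fr] /asboolP[gl gr].
have E x : (c *: f + g : lhom M N) x = c *: f x + g x by [].
apply/asboolP; split=> [d m|m a].
  by rewrite !E fl gl -[RHS]/(L d _) linearP.
by rewrite !E fr gr -[RHS]/(R a _) linearP.
Qed.
HB.instance Definition _ := GRing.SubChoice_isSubLmodule.Build k (lhom M N) _ bihom
  (GRing.submod_closed_semi bihom_submod).

Lemma bihom_l (f : bihom) c m : f (lact c m) = lact c (f m).
Proof. by have /asboolP[] := bihomP f. Qed.
Lemma bihom_r (f : bihom) m a : f (ract m a) = ract (f m) a.
Proof. by have /asboolP[] := bihomP f. Qed.
End BimodHom.

Section Tensor.
Variables (k : fieldType) (C B A : algType k) (M : bimod C B) (N : bimod B A).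

Let gen (m : M) (n : N) : {freeg (M * N)%type / k} := fgen k (m, n).

Inductive tensor_rel : {freeg (M * N)%type / k} -> Prop :=
| TensorLinL c m m' n :
    tensor_rel (gen (c *: m + m') n - (c *: gen m n + gen m' n))
| TensorLinR c m n n' :
    tensor_rel (gen m (c *: n + n') - (c *: gen m n + gen m n'))
| TensorBal m b n : tensor_rel (gen (ract m b) n - gen m (lact b n)).

(* M (x)_B N *)
Definition tensor_lmod : lmodType k := presented tensor_rel.
Definition pure (m : M) (n : N) : tensor_lmod := pgen tensor_rel (m, n).

Section Lift.
Variables (U : lmodType k) (f : M -> N -> U).
Hypotheses (fl : forall n, linear (f^~ n)) (fr : forall m, linear (f m))
  (fb : forall m b n, f (ract m b) n = f m (lact b n)).

Fact tensor_lift_subproof r : tensor_rel r -> fglift (fun p => f p.1 p.2) r = 0.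
Proof.
pose F : {linear {freeg (M * N)%type / k} -> U} :=
  mklin (fglift_lin (fun p : M * N => f p.1 p.2)).
have FE m n : F (gen m n) = f m n by exact: etrans (liftU _ _ _) (scale1r _).
move=> Rr; rewrite -[LHS]/(F r).
case: Rr => [c m m' n|c m n n'|m b n]; apply/eqP; rewrite linearB subr_eq0 ?linearP !FE.
- by apply/eqP; apply: fl.
- by apply/eqP; apply: fr.
- by rewrite fb.
Qed.

Definition tensor_lift : {linear tensor_lmod -> U} :=
  presented_lift tensor_lift_subproof.
Lemma tensor_liftE m n : tensor_lift (pure m n) = f m n.
Proof. exact: presented_liftE. Qed.
End Lift.

Lemma tensorP (U : lmodType k) (f g : tensor_lmod -> U) : linear f -> linear g ->
  (forall m n, f (pure m n) = g (pure m n)) -> f =1 g.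
Proof. by move=> lf lg fg; apply: presentedP => // -[m n]; apply: fg. Qed.

Lemma pure_rel (u v : {freeg (M * N)%type / k}) :
  tensor_rel (u - v) -> qpi (span_submod tensor_rel) u = qpi (span_submod tensor_rel) v.
Proof. by move=> H; apply/qpi_eq; apply: span_gen. Qed.

Lemma pure_linl n : linear (pure^~ n).
Proof. by move=> c m m'; rewrite /pure /pgen (pure_rel (TensorLinL c m m' n)) qpiL. Qed.
Lemma pure_linr m : linear (pure m).
Proof. by move=> c n n'; rewrite /pure /pgen (pure_rel (TensorLinR c m n n')) qpiL. Qed.
Lemma pure_bal m b n : pure (ract m b) n = pure m (lact b n).
Proof. exact: pure_rel (TensorBal m b n). Qed.

Fact tlact_l c n : linear (fun m : M => pure (lact c m) n).
Proof. by move=> a u v; rewrite lact_linr pure_linl. Qed.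
Fact tlact_r c m : linear (fun n : N => pure (lact c m) n).
Proof. exact: pure_linr. Qed.
Fact tlact_b c m b n : pure (lact c (ract m b)) n = pure (lact c m) (lact b n).
Proof. by rewrite -lract pure_bal. Qed.
Definition tlact c := tensor_lift (tlact_l c) (tlact_r c) (tlact_b c).

Fact tract_l a n : linear (fun m : M => pure m (ract n a)).
Proof. exact: pure_linl. Qed.
Fact tract_r a m : linear (fun n : N => pure m (ract n a)).
Proof. by move=> c u v; rewrite ract_linl pure_linr. Qed.
Fact tract_b a m b n : pure (ract m b) (ract n a) = pure m (ract (lact b n) a).
Proof. by rewrite pure_bal lract. Qed.
Definition tract a := tensor_lift (tract_l a) (tract_r a) (tract_b a).

Lemma tlactE c m n : tlact c (pure m n) = pure (lact c m) n.
Proof. exact: tensor_liftE. Qed.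
Lemma tractE a m n : tract a (pure m n) = pure m (ract n a).
Proof. exact: tensor_liftE. Qed.

Fact tlact_linl t : linear (fun c => tlact c t).
Proof.
move=> a c d; move: t; apply: tensorP => [||m n]; first exact: linearP.
  by move=> b u v; rewrite (linearP (tlact c)) (linearP (tlact d)) !scalerDr !scalerA mulrC addrACA.
by rewrite !tlactE lact_linl pure_linl.
Qed.
Fact tract_linr t : linear (fun a => tract a t).
Proof.
move=> a c d; move: t; apply: tensorP => [||m n]; first exact: linearP.
  by move=> b u v; rewrite (linearP (tract c)) (linearP (tract d)) !scalerDr !scalerA mulrC addrACA.
by rewrite !tractE ract_linr pure_linr.
Qed.
Fact tlact1 t : tlact 1 t = t.
Proof.
by move: t; apply: tensorP => [||m n] //; [exact: linearP | rewrite tlactE lact1].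
Qed.
Fact tract1 t : tract 1 t = t.
Proof.
by move: t; apply: tensorP => [||m n] //; [exact: linearP | rewrite tractE ract1].
Qed.
Fact tlactM c c' t : tlact (c * c') t = tlact c (tlact c' t).
Proof.
move: t; apply: tensorP => [||m n]; first exact: linearP.
  by move=> b u v; rewrite !linearP.
by rewrite !tlactE lactM.
Qed.
Fact tractM t a a' : tract (a * a') t = tract a' (tract a t).
Proof.
move: t; apply: tensorP => [||m n]; first exact: linearP.
  by move=> b u v; rewrite !linearP.
by rewrite !tractE ractM.
Qed.
Fact tlract c t a : tract a (tlact c t) = tlact c (tract a t).
Proof.
move: t; apply: tensorP => [||m n]; try by move=> b u v; rewrite !linearP.
by rewrite tlactE !tractE tlactE.
Qed.

Definition tensor : bimod C A :=
  @Bimod k C A tensor_lmod tlact (fun t a => tract a t)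
    tlact_linl (fun c => linearP (tlact c)) (fun a => linearP (tract a)) tract_linr
    tlact1 tlactM tract1 tractM tlract.
End Tensor.

Section TensorMap.
Variables (k : fieldType) (C B A : algType k) (M : bimod C B) (N N' : bimod B A).
Variable f : bihom N N'.

Fact tensor_map_l n : linear (fun m : M => pure m (f n)).
Proof. exact: pure_linl. Qed.
Fact tensor_map_r (m : M) : linear (fun n => pure m (f n)).
Proof. by move=> c u v; rewrite linearP pure_linr. Qed.
Fact tensor_map_b (m : M) b n : pure (ract m b) (f n) = pure m (f (lact b n)).
Proof. by rewrite pure_bal bihom_l. Qed.

(* M (x) f *)
Definition tensor_map : {linear tensor M N -> tensor M N'} :=
  tensor_lift tensor_map_l tensor_map_r tensor_map_b.
End TensorMap.

Definition projective (k : fieldType) (C A : algType k) (P : bimod C A) : Prop :=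
  forall (X Y : bimod C A) (g : bihom X Y) (f : bihom P Y),
    (forall y, exists x, g x = y) -> exists h : bihom P X, forall p, g (h p) = f p.

Record proj_resolution (k : fieldType) (C A : algType k) (N : bimod C A) :=
  ProjResolution {
  pres :> nat -> bimod C A;
  pres_d : forall n, bihom (pres n.+1) (pres n);
  pres_aug : bihom (pres 0%N) N;
  pres_proj : forall n, projective (pres n);
  pres_aug_surj : forall y, exists x, pres_aug x = y;
  pres_exact0 : forall x, pres_aug x = 0 <-> exists z, pres_d 0%N z = x;
  pres_exactS : forall n x, pres_d n x = 0 <-> exists z, pres_d n.+1 z = x }.

Section Ext.
Variables (k : fieldType) (C A : algType k) (M : bimod C A).
Variables (P : proj_resolution M) (N : bimod C A).

Section Pre.
Variables (X Y : bimod C A) (d : bihom X Y).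
Fact comp_lin_subproof (f : bihom Y N) : linear (fun x => f (d x)).
Proof. by move=> c u v; rewrite !linearP. Qed.
Fact comp_bimod_subproof (f : bihom Y N) :
  bimod_map (mklin (comp_lin_subproof f) : lhom X N).
Proof. by apply/asboolP; split=> [c m|m a] /=; rewrite ?bihom_l ?bihom_r. Qed.
Definition precomp (f : bihom Y N) : bihom X N := Bihom (comp_bimod_subproof f).
Fact precomp_lin : linear precomp.
Proof. by move=> c f g; apply: val_inj; apply: lhomP. Qed.
End Pre.

(* Hom_{C-A}(P_n, N), with the differential f |-> f \o d *)
Definition hom_complex : cochain_complex k :=
  @CochainComplex k (fun n => bihom (P n) N) (fun n => mklin (precomp_lin (pres_d P n))).

(* Ext^n_{C-A}(M, N), computed by the projective resolution P of M *)
Definition Ext n : lmodType k := cohom hom_complex n.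
End Ext.

(* h is a morphism of resolutions over the identity of M *)
Definition resolution_map (k : fieldType) (C A : algType k) (M : bimod C A)
    (P P' : proj_resolution M) (h : forall n, bihom (P n) (P' n)) : Prop :=
  (forall p, pres_aug P' (h 0%N p) = pres_aug P p) /\
  (forall n p, h n (pres_d P n p) = pres_d P' n (h n.+1 p)).

(* phi P is compatible with the canonical isomorphisms Ext P' N r -> Ext P N r *)
(* given by composition with the morphisms of resolutions P -> P'              *)
Definition resolution_natural (k : fieldType) (C A : algType k) (M N : bimod C A)
    (r : nat) (V : lmodType k) (phi : forall P : proj_resolution M, V -> Ext P N r) : Prop :=
  forall (P P' : proj_resolution M) (h : forall n, bihom (P n) (P' n)),
    resolution_map h ->
  forall (v : V) (g' : cocycle (hom_complex P' N) r) (g : cocycle (hom_complex P N) r),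
    (forall p, (val g : bihom (P r) N) p = (val g' : bihom (P' r) N) (h r p)) ->
    phi P' v = cohom_class g' -> phi P v = cohom_class g.

Section Tor.
Variables (k : fieldType) (C B A : algType k) (M : bimod C B) (N : bimod B A).
Variable P : proj_resolution (left_of_bimod N).

Definition tor_d n : {linear tensor M (P n.+1) -> tensor M (P n)} :=
  tensor_map M (pres_d P n).
Definition tor_d_out n : {linear tensor M (P n) -> tensor M (P n.-1)} :=
  match n with
  | 0 => mklin (@lhom_zero_subproof k (tensor M (P 0%N)) (tensor M (P 0%N)))
  | n'.+1 => tor_d n'
  end.

(* Tor_n^B(M, N), computed by the projective resolution P of the left B-module N *)
Definition Tor n : lmodType k := homology (tor_d n) (tor_d_out n).
End Tor.

Record quiver := Quiver { Q0 : finType; Q1 : finType; qsrc : Q1 -> Q0; qtgt : Q1 -> Q0 }.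

Definition simply_laced (Q : quiver) : Prop :=
  (forall a : Q1 Q, qsrc a <> qtgt a) /\
  (forall a b : Q1 Q, qsrc a = qsrc b -> qtgt a = qtgt b -> a = b).

(* qpath x y: the paths of positive length from x to y; PathCons a w is a w, *)
(* i.e. w followed by a                                                      *)
Inductive qpath (Q : quiver) : Q0 Q -> Q0 Q -> Type :=
| PathArr (a : Q1 Q) : qpath (qsrc a) (qtgt a)
| PathCons (x : Q0 Q) (a : Q1 Q) of qpath x (qsrc a) : qpath x (qtgt a).

Fixpoint plength (Q : quiver) (x y : Q0 Q) (w : qpath x y) : nat :=
  match w with PathArr _ => 1%N | PathCons _ _ w' => (plength w').+1 end.

(* the algebras A_x and the bimodules M_a *)
Record qset_data (k : fieldType) (Q : quiver) := QsetData {
  qalg : Q0 Q -> algType k;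
  qmod : forall a : Q1 Q, bimod (qalg (qtgt a)) (qalg (qsrc a));
  qmod_neq0 : forall a, exists m : qmod a, m <> 0 }.

Section Block.
Variables (k : fieldType) (Q : quiver) (D : qset_data k Q).

Definition qmod_cast (y x : Q0 Q) (a : Q1 Q) (et : qtgt a = y) (es : qsrc a = x) :
    bimod (qalg D y) (qalg D x) :=
  match et in _ = y', es in _ = x' return bimod (qalg D y') (qalg D x') with
  | erefl, erefl => qmod D a
  end.

(* The bimodule yMx: A_x if y = x, M_a if a is an arrow from x to y and 0      *)
(* otherwise. The arrow a is unique when Q is simply laced, and then           *)
(* qblock (qtgt a) (qsrc a) is M_a.                                            *)
Definition qblock (y x : Q0 Q) : bimod (qalg D y) (qalg D x) :=
  match y =P x with
  | ReflectT e => ecast x' (bimod (qalg D y) (qalg D x')) e (reg_bimod (qalg D y))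
  | ReflectF _ =>
    match [pick a : {a : Q1 Q | (qtgt a == y) && (qsrc a == x)}] with
    | Some (exist a ea) =>
      qmod_cast (eqP (proj1 (andP ea))) (eqP (proj2 (andP ea)))
    | None => zero_bimod _ _
    end
  end.

Lemma qblock_diag x : qblock x x = reg_bimod (qalg D x).
Proof. by rewrite /qblock; case: eqP => // e; rewrite eq_axiomK. Qed.

Lemma qblock_arr (a : Q1 Q) : simply_laced Q -> qblock (qtgt a) (qsrc a) = qmod D a.
Proof.
case=> noloop inj; rewrite /qblock; case: eqP => [/esym/noloop//|_].
have aa : (qtgt a == qtgt a) && (qsrc a == qsrc a) by rewrite !eqxx.
case: pickP => [[b eb] _|/(_ (exist _ a aa))//].
have /andP[/eqP et0 /eqP es0] := eb; have ba := inj b a es0 et0; subst b.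
move: (eqP _) (eqP _) => e1 e2.
by rewrite (Prop_irrelevance e1 erefl) (Prop_irrelevance e2 erefl).
Qed.

Definition bcast (C A : algType k) (M N : bimod C A) (e : M = N) (m : M) : N :=
  ecast X (bcar X) e m.

Definition alg_of_diag x (u : qblock x x) : qalg D x := bcast (qblock_diag x) u.

Definition qalpha := forall z y x : Q0 Q, z <> y -> y <> x ->
  bihom (tensor (qblock z y) (qblock y x)) (qblock z x).

Variable alpha : qalpha.

(* the product zMy x yMx -> zMx of the algebra associated with a Q-set *)
Definition qmul_of (z y x : Q0 Q) : qblock z y -> qblock y x -> qblock z x :=
  match z =P y with
  | ReflectT e =>
    match e in _ = y' return qblock z y' -> qblock y' x -> qblock z x with
    | erefl => fun u v => lact (alg_of_diag u) v
    end
  | ReflectF nzy =>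
    match y =P x with
    | ReflectT e =>
      match e in _ = x' return qblock z y -> qblock y x' -> qblock z x' with
      | erefl => fun u v => ract u (alg_of_diag v)
      end
    | ReflectF nyx => fun u v => alpha nzy nyx (pure u v)
    end
  end.
End Block.

Record qset (k : fieldType) (Q : quiver) := Qset {
  qdata :> qset_data k Q;
  qalph : qalpha qdata;
  qalph_assoc : forall (z y x v : Q0 Q)
      (f : qblock qdata z y) (g : qblock qdata y x) (h : qblock qdata x v),
    z <> y -> y <> x -> x <> v ->
    qmul_of qalph (qmul_of qalph f g) h = qmul_of qalph f (qmul_of qalph g h) }.

Section Lambda.
Variables (k : fieldType) (Q : quiver) (D : qset k Q).

Definition qmul (z y x : Q0 Q) (u : qblock D z y) (v : qblock D y x) : qblock D z x :=
  qmul_of (qalph D) u v.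

Fact bcast_lin (C A : algType k) (M N : bimod C A) (e : M = N) : linear (bcast e).
Proof. by case: _ / e. Qed.

Lemma qmul_linl (z y x : Q0 Q) (v : qblock D y x) : linear (fun u : qblock D z y => qmul u v).
Proof.
rewrite /qmul /qmul_of; case: eqP => [e|nzy]; first subst y.
  move=> c u u'; rewrite /alg_of_diag bcast_lin; exact: lact_linl.
case: eqP => [e|nyx]; first by subst x; exact: ract_linl.
by move=> c u u'; rewrite pure_linl linearP.
Qed.

Lemma qmul_linr (z y x : Q0 Q) (u : qblock D z y) : linear (fun v : qblock D y x => qmul u v).
Proof.
rewrite /qmul /qmul_of; case: eqP => [e|nzy].
  by subst y; exact: lact_linr.
case: eqP => [e|nyx]; first subst x.
  move=> c u' v'; rewrite /alg_of_diag bcast_lin; exact: ract_linr.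
by move=> c u' v'; rewrite pure_linr linearP.
Qed.

(* (x_x A_x) (+) (+_a M_a) written as the matrices with (y, x) entry in yMx:   *)
(* the entries which are neither diagonal nor indexed by an arrow are 0       *)
Definition Lambda : lmodType k := dprod (fun p : Q0 Q * Q0 Q => qblock D p.1 p.2).

Definition Lmul (f g : Lambda) : Lambda :=
  fun p => \sum_y (@qmul p.1 y p.2 (f (p.1, y)) (g (y, p.2)) : qblock D p.1 p.2).

Lemma Lmul_linl g : linear (Lmul^~ g).
Proof.
move=> c f f'; apply: functional_extensionality_dep => p.
rewrite !dprodDE dprodZE /Lmul scaler_sumr -big_split; apply: eq_bigr => y _ /=.
exact: qmul_linl.
Qed.
Lemma Lmul_linr f : linear (Lmul f).
Proof.
move=> c g g'; apply: functional_extensionality_dep => p.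
rewrite !dprodDE dprodZE /Lmul scaler_sumr -big_split; apply: eq_bigr => y _ /=.
exact: qmul_linr.
Qed.

Definition Linj (p : Q0 Q * Q0 Q) (v : qblock D p.1 p.2) : Lambda := dfwith (0 : Lambda) v.
Lemma Linj_lin p : linear (@Linj p).
Proof.
move=> c u v; apply: functional_extensionality_dep => q.
rewrite !dprodDE dprodZE /Linj; have [<-|npq] := eqVneq p q; first by rewrite !dfwith_in.
by rewrite !dfwith_out // scaler0 addr0.
Qed.
End Lambda.

Section Multilinear.
Variables (k : fieldType) (n : nat) (V : 'I_n -> lmodType k).

Definition multilinear (U : lmodType k) (f : dprod V -> U) : Prop :=
  forall (x : dprod V) (i : 'I_n), linear (fun v : V i => f (dfwith x v)).

Let gen (x : dprod V) : {freeg (dprod V) / k} := fgen k x.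

Inductive ktensor_rel : {freeg (dprod V) / k} -> Prop :=
| KTensorLin (x : dprod V) i c (u v : V i) :
    ktensor_rel (gen (dfwith x (c *: u + v)) - (c *: gen (dfwith x u) + gen (dfwith x v))).

(* V_0 (x)_k ... (x)_k V_(n-1) *)
Definition ktensor : lmodType k := presented ktensor_rel.
Definition kpure (x : dprod V) : ktensor := pgen ktensor_rel x.

Lemma kpure_multilin : multilinear kpure.
Proof.
move=> x i c u v; rewrite /kpure /pgen -(qpiL (span_submod _)).
by apply/qpi_eq; apply: span_gen; apply: KTensorLin.
Qed.

Lemma ktensorP (U : lmodType k) (f g : ktensor -> U) : linear f -> linear g ->
  (forall x, f (kpure x) = g (kpure x)) -> f =1 g.
Proof. exact: presentedP. Qed.

Section Lift.
Variables (U : lmodType k) (f : dprod V -> U).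
Hypothesis mf : multilinear f.

Fact ktensor_lift_subproof r : ktensor_rel r -> fglift f r = 0.
Proof.
pose F : {linear {freeg (dprod V) / k} -> U} := mklin (fglift_lin f).
have FE x : F (gen x) = f x by exact: etrans (liftU _ _ _) (scale1r _).
move=> Rr; rewrite -[LHS]/(F r); case: Rr => x i c u v.
by apply/eqP; rewrite linearB subr_eq0 linearP !FE; apply/eqP; apply: mf.
Qed.

Definition ktensor_lift : {linear ktensor -> U} := presented_lift ktensor_lift_subproof.
Lemma ktensor_liftE x : ktensor_lift (kpure x) = f x.
Proof. exact: presented_liftE. Qed.
End Lift.
End Multilinear.

Section Hochschild.
Variables (k : fieldType) (Q : quiver) (D : qset k Q).
Local Notation L := (Lambda D).

Section Cobound.
Variable n : nat.

(* x_0, ..., x_i x_(i+1), ..., x_n *)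
Definition hmerge (i : 'I_n) (x : 'I_n.+1 -> L) : 'I_n -> L := fun j =>
  if (j < i)%N then x (widen_ord (leqnSn n) j)
  else if j == i then Lmul (x (widen_ord (leqnSn n) j)) (x (lift ord0 j))
  else x (lift ord0 j).

(* the coboundary of F, with arguments and signs shifted to x_0, ..., x_n *)
Definition hochschild (F : ('I_n -> L) -> L) (x : 'I_n.+1 -> L) : L :=
  Lmul (x ord0) (F (fun j => x (lift ord0 j)))
  + \sum_(i < n) (-1) ^+ i.+1 *: F (hmerge i x)
  + (-1) ^+ n.+1 *: Lmul (F (fun j => x (widen_ord (leqnSn n) j))) (x ord_max).
Fact ndfwithE (I : eqType) (T : Type) (x : I -> T) (i : I) (v : T) (j : I) :
  dfwith (T := fun=> T) x (i := i) v j = if i == j then v else x j.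
Proof. by rewrite /dfwith; case: eqP => // e; case: _ / e. Qed.

Variable F : ('I_n -> L) -> L.
Hypothesis mF : multilinear (V := fun=> L) F.

Fact hochschild_lift (h i : 'I_n.+1) (x : 'I_n.+1 -> L) : i != h -> linear
  (fun v : L => F (fun j => dfwith (T := fun=> L : Type) x (i := i) v (lift h j))).
Proof.
move=> nih; have [i' ->|/eqP] := unliftP h i; last by rewrite (negbTE nih).
have E v : (fun j => dfwith (T := fun=> L : Type) x (i := lift h i') v (lift h j))
    = dfwith (T := fun=> L : Type) (fun j => x (lift h j)) (i := i') v.
  by apply: funext => j; rewrite !ndfwithE (inj_eq lift_inj).
by move=> c u v; rewrite !E; apply: mF.
Qed.

Fact hochschild_liftC (h : 'I_n.+1) (x : 'I_n.+1 -> L) v :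
  (fun j => dfwith (T := fun=> L : Type) x (i := h) v (lift h j)) = fun j => x (lift h j).
Proof. by apply: funext => j; rewrite ndfwithE (negbTE (neq_lift h j)). Qed.

Lemma widen_lift (j : 'I_n) : widen_ord (leqnSn n) j = lift ord_max j.
Proof. by apply: val_inj; rewrite /= /bump leqNgt ltn_ord. Qed.

Fact hmerge_linear (m : 'I_n) (i : 'I_n.+1) (x : 'I_n.+1 -> L) :
  linear (fun v : L => F (hmerge m (dfwith (T := fun=> L : Type) x (i := i) v))).
Proof.
suff [i' [g [lg E]]] : exists (i' : 'I_n) (g : L -> L), linear g /\
    forall v, hmerge m (dfwith (T := fun=> L : Type) x (i := i) v)
      = dfwith (T := fun=> L : Type) (hmerge m x) (i := i') (g v).
  by move=> c u v; rewrite !E lg; apply: mF.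
have lid : linear (fun v : L => v) by [].
have [im|] := ltnP i m.
  have ltin : (i < n)%N by apply: ltn_trans im _.
  exists (Ordinal ltin), id; split=> // v; apply: funext => j.
  rewrite ndfwithE /hmerge !ndfwithE -!val_eqE /= /bump /= add1n.
  by do !case: ifP => //; lia.
rewrite leq_eqVlt => /orP[/eqP mi|].
  exists m, (fun v => Lmul v (x (lift ord0 m))); split; first exact: Lmul_linl.
  move=> v; apply: funext => j.
  rewrite ndfwithE /hmerge !ndfwithE -!val_eqE /= /bump /= add1n.
  have [/val_inj jm|jm] := eqVneq (j : nat) m.
    by subst j; rewrite ltnn -mi !eqxx (_ : (m == m.+1 :> nat) = false) //; lia.
  by move: mi => /= mi; do !case: ifP => //; lia.
rewrite leq_eqVlt => /orP[/eqP mi|mi].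
  exists m, (Lmul (x (widen_ord (leqnSn n) m))); split; first exact: Lmul_linr.
  move=> v; apply: funext => j.
  rewrite ndfwithE /hmerge !ndfwithE -!val_eqE /= /bump /= add1n.
  have [/val_inj jm|jm] := eqVneq (j : nat) m.
    by subst j; rewrite ltnn -mi !eqxx (_ : (m.+1 == m :> nat) = false) //; lia.
  by do !case: ifP => //; lia.
have [i' ei|ei] := unliftP ord0 i; last by rewrite ei in mi.
rewrite {}ei /= /bump /= add1n in mi *.
exists i', id; split=> // v; apply: funext => j.
rewrite ndfwithE /hmerge !ndfwithE -!val_eqE /= /bump /= !add1n.
by do !case: ifP => //; lia.
Qed.

Lemma hochschild_multilin :
  multilinear (V := fun=> L) (hochschild F : dprod (fun=> L) -> L).
Proof.
move=> x i; rewrite /hochschild.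
have lD (f g : L -> L) : linear f -> linear g -> linear (fun v => f v + g v).
  by move=> lf lg c u v; rewrite lf lg scalerDr addrACA.
have lZ (a : k) (f : L -> L) : linear f -> linear (fun v => a *: f v).
  by move=> lf c u v; rewrite lf scalerDr !scalerA mulrC.
have lS (I : finType) (f : I -> L -> L) : (forall j, linear (f j)) ->
    linear (fun v => \sum_j f j v).
  move=> lf c u v; rewrite scaler_sumr -big_split; apply: eq_bigr => j _; exact: lf.
apply: (lD _ _ _ _); first apply: (lD _ _ _ _).
- have [->|ni0] := eqVneq i ord0.
    by move=> c u v; rewrite !hochschild_liftC !ndfwithE eqxx Lmul_linl.
  move=> c u v; rewrite !ndfwithE (negbTE ni0) -Lmul_linr.
  by rewrite (hochschild_lift _ ni0).
- by apply: (lS) => j; apply: (lZ); apply: hmerge_linear.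
- apply: (lZ); have E v : (fun j => dfwith (T := fun=> L : Type) x (i := i) v
      (widen_ord (leqnSn n) j)) =
      (fun j => dfwith (T := fun=> L : Type) x (i := i) v (lift ord_max j)).
    by apply: funext => j; rewrite widen_lift.
  have [ei|nim] := eqVneq i ord_max.
    subst i; move=> c u v; rewrite !E !hochschild_liftC !ndfwithE eqxx.
    exact: Lmul_linr.
  move=> c u v; rewrite !E !ndfwithE (negbTE nim) -Lmul_linl.
  by rewrite (hochschild_lift _ nim).
Qed.
End Cobound.

Lemma hochschild_linear n (F G H : ('I_n -> L) -> L) (c : k) :
  (forall X, H X = c *: F X + G X) ->
  forall X, hochschild H X = c *: hochschild F X + hochschild G X.
Proof.
move=> E X; rewrite /hochschild !E Lmul_linl Lmul_linr.
rewrite (eq_bigr (fun i : 'I_n => c *: ((-1) ^+ i.+1 *: F (hmerge i X))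
    + (-1) ^+ i.+1 *: G (hmerge i X))); last first.
  by move=> i _; rewrite E scalerDr !scalerA mulrC.
rewrite big_split -scaler_sumr /= (scalerDr ((-1) ^+ n.+1)) !(scalerDr c) !scalerA.
by rewrite (mulrC c) [X in X + _ = _]addrACA [LHS]addrACA.
Qed.
End Hochschild.

Section Trajectories.
Variables (Q : quiver) (x y : Q0 Q) (w : qpath x y).

(* T_n(w): a trajectory is given by its waiting times, t i being the waiting   *)
(* time p_(i+1) at the i-th vertex of w counted from the source of w.          *)
Definition traj (n : nat) : finType :=
  {p : {ffun 'I_(plength w).+1 -> 'I_n.+1} | (plength w + \sum_i p i == n)%N}.

Definition waiting n (t : traj n) (i : 'I_(plength w).+1) : nat := val t i.

(* s is in t_0^+ *)
Definition traj_succ n (t : traj n) (s : traj n.+1) : bool :=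
  [exists j, [forall i, waiting s i == (waiting t i + (i == j))%N]].
End Trajectories.

(* the sequence of vertices and arrows of the trajectory over w with waiting   *)
(* times p                                                                     *)
Fixpoint letters (Q : quiver) (p : nat -> nat) (x y : Q0 Q) (w : qpath x y) :
    seq (Q0 Q + Q1 Q) :=
  match w with
  | PathArr a => nseq (p 1%N) (inl (qtgt a)) ++ inr a :: nseq (p 0%N) (inl (qsrc a))
  | PathCons _ a w' =>
      nseq (p (plength w').+1) (inl (qtgt a)) ++ inr a :: letters p w'
  end.

Section PathCohomology.
Variables (k : fieldType) (Q : quiver) (D : qset k Q).

(* M_w *)
Fixpoint path_bimod (x y : Q0 Q) (w : qpath x y) : bimod (qalg D y) (qalg D x) :=
  match w in qpath x' y' return bimod (qalg D y') (qalg D x') with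
  | PathArr a => qmod D a
  | PathCons _ a w' => tensor (qmod D a) (path_bimod w')
  end.

Fixpoint Tor_vanishing (x y : Q0 Q) (w : qpath x y) : Prop :=
  match w with
  | PathArr _ => True
  | PathCons _ a w' =>
      (forall (n : nat) (P : proj_resolution (left_of_bimod (path_bimod w'))),
         (0 < n)%N -> forall c : Tor (qmod D a) P n, c = 0)
      /\ Tor_vanishing w'
  end.

(* the target and the source of a letter *)
Definition letter_ends (l : Q0 Q + Q1 Q) : Q0 Q * Q0 Q :=
  match l with inl z => (z, z) | inr a => (qtgt a, qsrc a) end.

Variables (x y : Q0 Q) (w : qpath x y).

Definition traj_ends n (t : traj w n) (i : 'I_n) : Q0 Q * Q0 Q :=
  letter_ends (nth (inl y) (letters (fun j => waiting t (inord j)) w) i).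

Definition traj_factor n (t : traj w n) (i : 'I_n) : lmodType k :=
  qblock D (traj_ends t i).1 (traj_ends t i).2.

(* tau_Delta *)
Definition traj_tensor n (t : traj w n) : lmodType k := ktensor (traj_factor t).

(* Delta_w *)
Definition path_coef : bimod (qalg D y) (qalg D x) := qblock D y x.

Definition Kobj n : lmodType k := dprod (fun t : traj w n => lhom (traj_tensor t) path_coef).

(* f, seen as a multilinear map on Lambda which vanishes on the tensors of all *)
(* the other trajectories                                                      *)
Definition extend0 n (t : traj w n) (f : lhom (traj_tensor t) path_coef)
    (X : 'I_n -> Lambda D) : Lambda D :=
  @Linj k Q D (y, x) (f (kpure ((fun i => X i (traj_ends t i)) : dprod (traj_factor t)))).

(* the tuple of elements of Lambda defined by a tuple of elements of the       *)
(* factors of s_Delta                                                          *)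
Definition traj_tuple n (s : traj w n) (z : dprod (traj_factor s)) : 'I_n -> Lambda D :=
  fun i => @Linj k Q D (traj_ends s i) (z i).

Definition Kpart_fun n (t : traj w n) (s : traj w n.+1)
    (f : lhom (traj_tensor t) path_coef) (z : dprod (traj_factor s)) : path_coef :=
  hochschild (extend0 f) (traj_tuple z) (y, x).

Lemma extend0_multilin n (t : traj w n) (f : lhom (traj_tensor t) path_coef) :
  multilinear (V := fun=> Lambda D) (extend0 f).
Proof.
move=> X i c u v; rewrite /extend0.
pose Y : dprod (traj_factor t) := fun j => X j (traj_ends t j).
have E a : ((fun j => dfwith (T := fun=> Lambda D : Type) X (i := i) a j (traj_ends t j))
    : dprod (traj_factor t)) = dfwith Y (a (traj_ends t i)).
  apply: functional_extensionality_dep => j.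
  have [<-|nij] := eqVneq i j; first by rewrite ndfwithE eqxx dfwith_in.
  by rewrite ndfwithE (negbTE nij) dfwith_out.
by rewrite !E dprodDE dprodZE kpure_multilin linearP Linj_lin.
Qed.

Fact Kpart_multilin n (t : traj w n) (s : traj w n.+1)
  (f : lhom (traj_tensor t) path_coef) : multilinear (@Kpart_fun n t s f).
Proof.
move=> z i c u v; rewrite /Kpart_fun.
have E (a : traj_factor s i) : traj_tuple (dfwith z a) =
    dfwith (T := fun=> Lambda D : Type) (traj_tuple z) (i := i) (Linj a).
  apply: functional_extensionality_dep => j; rewrite /traj_tuple ndfwithE.
  have [<-|nij] := eqVneq i j; first by rewrite dfwith_in.
  by rewrite dfwith_out.
by rewrite !E Linj_lin (hochschild_multilin (extend0_multilin f)).
Qed.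

(* (d f_t)_s *)
Definition Kpart n (t : traj w n) (s : traj w n.+1) (f : lhom (traj_tensor t) path_coef) :
    lhom (traj_tensor s) path_coef :=
  ktensor_lift (@Kpart_multilin n t s f).

Fact Kpart_lin n (t : traj w n) (s : traj w n.+1) : linear (@Kpart n t s).
Proof.
move=> c f g; apply: lhomP; apply: ktensorP => [||z]; try exact: linearP.
have E X : extend0 (c *: f + g) X = c *: extend0 f X + extend0 g X.
  by rewrite -Linj_lin.
rewrite [LHS]ktensor_liftE -[RHS]/(c *: Kpart s f (kpure z) + Kpart s g (kpure z)).
by rewrite !ktensor_liftE /Kpart_fun (hochschild_linear E).
Qed.

Definition Kdiff_fun n (f : Kobj n) : Kobj n.+1 :=
  fun s => \sum_(t : traj w n | traj_succ t s) Kpart s (f t).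

Fact Kdiff_lin n : linear (@Kdiff_fun n).
Proof.
move=> c f g; apply: functional_extensionality_dep => s.
rewrite dprodDE dprodZE /Kdiff_fun scaler_sumr -big_split; apply: eq_bigr => t _ /=.
exact: Kpart_lin.
Qed.

Definition Kcomplex : cochain_complex k :=
  @CochainComplex k Kobj (fun n => mklin (@Kdiff_lin n)).

Definition path_cohom n : lmodType k := cohom Kcomplex n.
End PathCohomology.

(* Main.v *)
Require Import Defs.
From HB Require Import structures.
From mathcomp Require Import all_boot all_algebra.
From mathcomp Require Import boolp classical_sets zify.

Set Implicit Arguments.
Unset Strict Implicit.
Unset Printing Implicit Defensive.

Import GRing.Theory.
Local Open Scope ring_scope.

(* The complex along w is, up to the shift by m = plength w, the complex of bimodule maps
   from a projective resolution of M_w to Delta_w.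

   For a complex Y of C-A-bimodules let T(Y) be the total bar complex, with
   T_n = C (x) (Y_n (+) T_(n-1)). The cone of the action map T(Y) -> Y is contractible, so
   T(Y) resolves whatever Y resolves, and its terms are projective bimodules when the Y_n
   are projective right A-modules. Starting from the algebra at the source of w and applying
   alternately T and M_a (x) -, where Tor-vanishing preserves exactness, one obtains the
   resolution. When a tensor over a trajectory is read from left to right, a letter in an
   algebra contributes one bar factor and a letter in M_a one functor M_a (x) -. Hence the
   bimodule maps from the r-th term are the families of multilinear functions indexed by the
   trajectories of duration m + r, and composition with the differential of the resolution
   is the Hochschild coboundary. The comparison theorem then identifies the cohomology with
   the Ext computed by any other projective resolution. *)

(** * Bimodules and projectivity *)

(** T has to be applied at every vertex because M_a (x)_B - spoils bimodule projectivity: M_a (x)_B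
    (B (x) Z) = M_a (x)_k Z is in general projective only as a right A-module. That is just what T
    asks of Y before it returns projective bimodules. Tor-vanishing enters through T(Y) itself: its
    terms are free left B-modules, so tensoring it with M_a computes Tor. At the first arrow the
    left module is the algebra, which is projective.

    The terms are nested tensor products, and they are not compared with the tensors over
    trajectories by explicit isomorphisms. Each list of elements of Lambda gives a generator, and a
    universal property (uniqueness on generators, existence for multilinear data) is carried through
    M_a (x) - and T. A word begins with an arrow or with a vertex, which separates Y_n from T_(n-1).

    The maps alpha occur in the Hochschild coboundary but not in the resolution. They multiply
    elements of two arrows, which lowers the number of arrows, so that no trajectory over w remains.
    The resolution therefore only sees the product of Lambda without alpha. *)

Section LinearSection.
Variables (k : fieldType) (X Y : lmodType k) (g : {linear X -> Y}).
Hypothesis g_surj : forall y, exists x, g x = y.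

(** The empty set qualifies, as the union of the empty chain must. That a maximal set contains 0
    follows from maximality. *)
Definition partial_section (A : set X) : Prop :=
  (forall c u v, A u -> A v -> A (c *: u + v)) /\ (forall v, A v -> g v = 0 -> v = 0).

(* Zorn's lemma gives a maximal complement of the kernel. *)
Lemma linear_section : exists s : {linear Y -> X}, forall y, g (s y) = y.
Proof.
have [|A [[Alin Aker] Amax]] := @Zorn_bigcup X partial_section.
  move=> F FP Ftot; split=> [c u v [B FB Bu] [C FC Cv]|v [B FB Bv]]; last first.
    by have [_] := FP _ FB; apply.
  have [BC|CB] := Ftot _ _ FB FC.
    by exists C => //; have [Cl _] := FP _ FC; apply: Cl => //; apply: BC.
  by exists B => //; have [Bl _] := FP _ FB; apply: Bl => //; apply: CB.
have A0 : A 0.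
  have [[a Aa]|A0] := pselect (exists a, A a).
    by rewrite -[0](addNr a) -scaleN1r; apply: Alin.
  exfalso; apply: (Amax (fun v => v = 0)); last first.
    split=> [c u v -> ->|v -> //]; by rewrite scaler0 addr0.
  by split=> [a Aa|/(_ 0 erefl) A0']; exfalso; apply: A0; [exists a | exists 0].
have AZ c a : A a -> A (c *: a) by move=> Aa; rewrite -[_ *: _]addr0; apply: Alin.
have AN a : A a -> A (- a) by rewrite -scaleN1r; apply: AZ.
have gA y : exists x, A x /\ g x = y.
  have [x gx] := g_surj y; apply: contrapT => nA.
  (* If no preimage of y lies in A, the line of x can be adjoined to A: a kernel element c x + a
     with c nonzero would make - c^-1 a a preimage of y in A. *)
  apply: (Amax (fun v => exists c a, A a /\ v = c *: x + a)).
    split=> [a Aa|sub]; first by exists 0, a; rewrite scale0r add0r.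
    apply: nA; exists x; split => //; apply: sub; exists 1, 0.
    by rewrite scale1r addr0.
  split=> [c _ _ [d [a [Aa ->]]] [e [b [Ab ->]]]|_ [c [a [Aa ->]]]].
    exists (c * d + e), (c *: a + b); split; first exact: Alin.
    by rewrite scalerDr scalerA addrACA -scalerDl.
  rewrite linearP gx => /eqP; have [->|c0] := eqVneq c 0.
    by rewrite !scale0r !add0r => /eqP; apply: Aker.
  rewrite addr_eq0 => /eqP cy; exfalso; apply: nA; exists (c^-1 *: - a).
  by split; [apply/AZ/AN | rewrite linearZ_LR linearN -cy scalerA mulVf// scale1r].
have [s sP] := choice gA.
have s_lin : linear s.
  move=> c u v; apply/eqP; rewrite -subr_eq0; apply/eqP.
  have [[[Auv guv] [Au gu]] [Av gv]] := (sP (c *: u + v), sP u, sP v).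
  apply: Aker; last by rewrite linearB linearP guv gu gv subrr.
  by rewrite -scaleN1r [X in A X]addrC; apply: (Alin); [apply: Alin | ].
by exists (mklin s_lin) => y; have [] := sP y.
Qed.
End LinearSection.

Section BimodTheory.
Variables (k : fieldType) (C A : algType k) (M : bimod C A).
Implicit Types (m n : M) (c : C) (a : A) (z : k).

Lemma lactDr c m n : lact c (m + n) = lact c m + lact c n.
Proof. exact: (linearD (mklin (lact_linr c))). Qed.
Lemma lactZr c z m : lact c (z *: m) = z *: lact c m.
Proof. exact: (linearZ_LR (mklin (lact_linr c))). Qed.
Lemma lactr0 c : lact c (0 : M) = 0.
Proof. exact: (linear0 (mklin (lact_linr c))). Qed.
Lemma lactBr c m n : lact c (m - n) = lact c m - lact c n.
Proof. exact: (linearB (mklin (lact_linr c))). Qed.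
Lemma lactZl z c m : lact (z *: c) m = z *: lact c m.
Proof. exact: (linearZ_LR (mklin (lact_linl m))). Qed.
Lemma ractZl a z m : ract (z *: m) a = z *: ract m a.
Proof. exact: (linearZ_LR (mklin (ract_linl a))). Qed.
Lemma ract0l a : ract (0 : M) a = 0.
Proof. exact: (linear0 (mklin (ract_linl a))). Qed.
Lemma ractr0 m : ract m 0 = 0.
Proof. exact: (linear0 (mklin (ract_linr m))). Qed.
Lemma ractZr z m a : ract m (z *: a) = z *: ract m a.
Proof. exact: (linearZ_LR (mklin (ract_linr m))). Qed.
End BimodTheory.

Lemma lact_scalar (k : fieldType) (A : algType k) (M : bimod k^o A) (c : k^o) (m : M) :
  lact c m = c *: m.
Proof. by rewrite -[X in lact X m]mulr1 -[c * 1]/(c *: (1 : k^o)) lactZl lact1. Qed.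
Lemma ract_scalar (k : fieldType) (C : algType k) (M : bimod C k^o) (c : k^o) (m : M) :
  ract m c = c *: m.
Proof. by rewrite -[X in ract m X]mulr1 -[c * 1]/(c *: (1 : k^o)) ractZr ract1. Qed.

Section BihomTheory.
Variables (k : fieldType) (C A : algType k).

Definition mkbihom (M N : bimod C A) (f : M -> N) (lin_f : linear f)
    (f_l : forall c m, f (lact c m) = lact c (f m))
    (f_r : forall m a, f (ract m a) = ract (f m) a) : bihom M N :=
  @Bihom k C A M N (mklin lin_f) (introT (asboolP _) (conj f_l f_r)).

Lemma bihom_lin (M N : bimod C A) (f : bihom M N) : linear f.
Proof. exact: lhomL. Qed.

Lemma bihomE (M N : bimod C A) (f g : bihom M N) : f =1 g -> f = g.
Proof. by move=> fg; apply: val_inj; apply: lhomP. Qed.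

Lemma bihomDE (M N : bimod C A) (f g : bihom M N) x : (f + g) x = f x + g x.
Proof. by []. Qed.
Lemma bihomZE (M N : bimod C A) c (f : bihom M N) x : (c *: f) x = c *: f x.
Proof. by []. Qed.
Lemma bihomBE (M N : bimod C A) (f g : bihom M N) x : (f - g) x = f x - g x.
Proof. by []. Qed.

Definition bicomp (M N L : bimod C A) (g : bihom N L) (f : bihom M N) : bihom M L :=
  precomp f g.
Lemma bicompE (M N L : bimod C A) (g : bihom N L) (f : bihom M N) x : bicomp g f x = g (f x).
Proof. by []. Qed.

Fact biid_lin (M : bimod C A) : linear (fun x : M => x). Proof. by []. Qed.
Definition biid (M : bimod C A) : bihom M M :=
  mkbihom (@biid_lin M) (fun _ _ => erefl) (fun _ _ => erefl).

End BihomTheory.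

Section KernelBimod.
Variables (k : fieldType) (C A : algType k) (M N : bimod C A) (g : bihom M N).

Let K := ker (g : {linear M -> N}).
Fact ker_lact_subproof c (x : K) : g (lact c (val x)) == 0.
Proof. by rewrite bihom_l (eqP (kerP x)) lactr0. Qed.
Fact ker_ract_subproof (x : K) a : g (ract (val x) a) == 0.
Proof. by rewrite bihom_r (eqP (kerP x)) ract0l. Qed.
Definition ker_lact c (x : K) : K := Ker (ker_lact_subproof c x).
Definition ker_ract (x : K) a : K := Ker (ker_ract_subproof x a).

Lemma ker_valL (x y : K) (c : k) : val (c *: x + y) = c *: val x + val y.
Proof. by []. Qed.

Fact ker_lact_linl x : linear (ker_lact^~ x).
Proof. by move=> z c d; apply: val_inj; rewrite ker_valL /= lact_linl. Qed.
Fact ker_lact_linr c : linear (ker_lact c).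
Proof. by move=> z x y; apply: val_inj; rewrite [in RHS]ker_valL /= lact_linr. Qed.
Fact ker_ract_linl a : linear (ker_ract^~ a).
Proof. by move=> z x y; apply: val_inj; rewrite [in RHS]ker_valL /= ract_linl. Qed.
Fact ker_ract_linr x : linear (ker_ract x).
Proof. by move=> z c d; apply: val_inj; rewrite ker_valL /= ract_linr. Qed.

Definition ker_bimod : bimod C A.
Proof.
apply: (@Bimod k C A K ker_lact ker_ract ker_lact_linl ker_lact_linr ker_ract_linl
  ker_ract_linr).
- by move=> m; apply: val_inj; rewrite /= lact1.
- by move=> c c' m; apply: val_inj; rewrite /= lactM.
- by move=> m; apply: val_inj; rewrite /= ract1.
- by move=> m a a'; apply: val_inj; rewrite /= ractM.
- by move=> c m a; apply: val_inj; rewrite /= lract.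
Defined.
End KernelBimod.

Section DirectSum.
Variables (k : fieldType) (C A : algType k) (M N : bimod C A).

Definition dsum_lact c (x : M * N) : M * N := (lact c x.1, lact c x.2).
Definition dsum_ract (x : M * N) a : M * N := (ract x.1 a, ract x.2 a).

Fact dsum_lact_linl x : linear (dsum_lact^~ x).
Proof. by move=> z c d; rewrite /dsum_lact !lact_linl. Qed.
Fact dsum_lact_linr c : linear (dsum_lact c).
Proof. by move=> z x y; rewrite /dsum_lact !lact_linr. Qed.
Fact dsum_ract_linl a : linear (dsum_ract^~ a).
Proof. by move=> z x y; rewrite /dsum_ract !ract_linl. Qed.
Fact dsum_ract_linr x : linear (dsum_ract x).
Proof. by move=> z c d; rewrite /dsum_ract !ract_linr. Qed.

Definition dsum : bimod C A.
Proof.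
apply: (@Bimod k C A (M * N)%type dsum_lact dsum_ract dsum_lact_linl dsum_lact_linr
  dsum_ract_linl dsum_ract_linr); rewrite /dsum_lact /dsum_ract.
- by case=> m n; rewrite !lact1.
- by move=> c c' [m n]; rewrite !lactM.
- by case=> m n; rewrite !ract1.
- by case=> m n a a'; rewrite !ractM.
- by move=> c [m n] a; rewrite !lract.
Defined.

Fact dsum_fst_lin : linear (fun x : dsum => x.1). Proof. by []. Qed.
Fact dsum_snd_lin : linear (fun x : dsum => x.2). Proof. by []. Qed.
Fact dsum_inl_lin : linear (fun m => (m, 0) : dsum).
Proof. by move=> c m n; rewrite -[RHS]/(c *: m + n, c *: 0 + 0) scaler0 addr0. Qed.
Fact dsum_inr_lin : linear (fun n => (0, n) : dsum).
Proof. by move=> c m n; rewrite -[RHS]/(c *: 0 + 0, c *: m + n) scaler0 addr0. Qed.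
Definition dsum_fst : bihom dsum M :=
  mkbihom dsum_fst_lin (fun _ _ => erefl) (fun _ _ => erefl).
Definition dsum_snd : bihom dsum N :=
  mkbihom dsum_snd_lin (fun _ _ => erefl) (fun _ _ => erefl).
Definition dsum_inl : bihom M dsum.
Proof.
apply: (mkbihom dsum_inl_lin) => [c m|m a]; congr pair; first by rewrite lactr0.
by rewrite ract0l.
Defined.
Definition dsum_inr : bihom N dsum.
Proof.
apply: (mkbihom dsum_inr_lin) => [c m|m a]; congr pair; first by rewrite lactr0.
by rewrite ract0l.
Defined.

Lemma dsum_split (x : dsum) : x = dsum_inl x.1 + dsum_inr x.2.
Proof. by case: x => m n; congr pair; rewrite ?addr0 ?add0r. Qed.

Lemma dsum_projective : projective M -> projective N -> projective dsum.
Proof.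
move=> pM pN X Y g f g_surj.
have [h1 h1P] := pM _ _ g (bicomp f dsum_inl) g_surj.
have [h2 h2P] := pN _ _ g (bicomp f dsum_inr) g_surj.
exists (bicomp h1 dsum_fst + bicomp h2 dsum_snd) => x.
by rewrite bihomDE !bicompE (lhomD g) h1P h2P !bicompE -(lhomD f) -dsum_split.
Qed.
End DirectSum.

(* Lift the identity of P through the pullback of d along f. *)
Lemma projective_lift (k : fieldType) (C A : algType k) (P X Y : bimod C A)
    (d : bihom X Y) (f : bihom P Y) :
  projective P -> (forall p, exists x, d x = f p) ->
  exists h : bihom P X, forall p, d (h p) = f p.
Proof.
move=> projP im_f.
pose e : bihom (dsum X P) Y := bicomp d (dsum_fst X P) - bicomp f (dsum_snd X P).
have val_lin : linear (fun z : ker_bimod e => val z) by [].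
pose v : bihom (ker_bimod e) (dsum X P) :=
  mkbihom val_lin (fun _ _ => erefl) (fun _ _ => erefl).
have [|h hP] := projP _ _ (bicomp (dsum_snd X P) v) (biid P).
  move=> p; have [x dx] := im_f p.
  have z0 : e (x, p) == 0 by rewrite bihomBE !bicompE /= dx subrr.
  by exists (Ker z0).
exists (bicomp (dsum_fst X P) (bicomp v h)) => p; apply/eqP; rewrite -subr_eq0.
by rewrite -[X in f X](hP p) -[X in X == 0]/(e (val (h p))) kerP.
Qed.
(** * Comparison of projective resolutions *)

(** Chain maps and homotopies are chosen degree by degree in types that vary with n. [I] is the
    invariant that makes the next choice possible, [R] the relation between consecutive choices. *)
Lemma dependent_choice_from (T : nat -> Type) (I : forall n, T n -> Prop)
    (R : forall n, T n -> T n.+1 -> Prop) (t0 : T 0%N) :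
  I 0%N t0 -> (forall n t, I n t -> exists t', I n.+1 t' /\ R n t t') ->
  exists s : forall n, T n, s 0%N = t0 /\ forall n, R n (s n) (s n.+1).
Proof.
move=> I0 step.
pose S n := {t : T n | I n t}.
have next n (t : S n) : {t' : S n.+1 | R n (sval t) (sval t')}.
  have /cid[t' [It' Rt']] := step n (sval t) (svalP t).
  by exists (exist _ t' It').
pose F := nat_rect S (exist _ t0 I0) (fun n t => sval (next n t)).
by exists (fun n => sval (F n)); split => // n; apply: svalP (next n (F n)).
Qed.

Lemma inj_surj_bij (T U : Type) (f : T -> U) :
  injective f -> (forall y, exists x, f x = y) -> bijective f.
Proof.
move=> inj_f /choice[g gP]; exists g => // x.
by apply: inj_f; rewrite gP.
Qed.

Section HomologyClass.
Variables (k : fieldType) (U V W : lmodType k).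
Variables (f : {linear U -> V}) (g : {linear V -> W}).

Lemma hclassP (x : homology f g) : exists z, x = hclass f z.
Proof. exact: lquotP. Qed.

Lemma hclass_eq (z z' : ker g) :
  (hclass f z = hclass f z') <-> (exists u, f u = val z - val z').
Proof.
by split=> [/qpi_eq/asboolP //|ex]; apply/qpi_eq/asboolP.
Qed.
End HomologyClass.

Section HomologyMap.
Variables (k : fieldType) (U V W U' V' W' : lmodType k).
Variables (f : {linear U -> V}) (g : {linear V -> W}).
Variables (f' : {linear U' -> V'}) (g' : {linear V' -> W'}).
Variable theta : {linear V -> V'}.

Hypothesis theta_ker : forall v, g v = 0 -> g' (theta v) = 0.
Hypothesis theta_im : forall v, g v = 0 -> (exists u, f u = v) ->
  exists u', f' u' = theta v.

(** As [homology] divides by the boundaries that lie in the kernel, the conditions on theta only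
    concern the kernel of g. *)
Lemma homology_map : exists Theta : {linear homology f g -> homology f' g'},
  forall z z', val z' = theta (val z) -> Theta (hclass f z) = hclass f' z'.
Proof.
have kerT (z : ker g) : g' (theta (val z)) == 0 by apply/eqP/theta_ker/eqP/kerP.
have lin_t : linear (fun z : ker g => hclass f' (Ker (kerT z))).
  move=> c u v; rewrite /hclass -qpiL; congr qpi; apply: val_inj.
  by rewrite /= linearP.
have t0 (z : ker g) : z \in @im_in_ker k U V W f g -> hclass f' (Ker (kerT z)) = 0.
  move=> /asboolP fz; apply/qpi_eq0/asboolP.
  by apply: theta_im => //; apply/eqP/kerP.
exists (mklin (@lquot_lift_lin k _ _ (im_in_ker_submod f g) _ _ lin_t t0)) => z z' zz'.
rewrite [LHS](@lquot_liftE k _ _ (im_in_ker_submod f g) _ _ lin_t t0).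
by congr hclass; apply: val_inj; rewrite /= -zz'.
Qed.

Lemma homology_iso :
  (forall v', g' v' = 0 -> exists v, g v = 0 /\ theta v = v') ->
  (forall v, g v = 0 -> (exists u', f' u' = theta v) -> exists u, f u = v) ->
  exists2 Theta : {linear homology f g -> homology f' g'}, bijective Theta &
  forall z z', val z' = theta (val z) -> Theta (hclass f z) = hclass f' z'.
Proof.
move=> surj inj; have [Theta ThetaE] := homology_map; exists Theta => //.
have kerT (z : ker g) : g' (theta (val z)) == 0 by apply/eqP/theta_ker/eqP/kerP.
apply: inj_surj_bij => [x y|y].
  have [u ->] := hclassP x; have [v ->] := hclassP y.
  rewrite (ThetaE u (Ker (kerT u))) // (ThetaE v (Ker (kerT v))) //.
  move=> /hclass_eq /= [u' fu']; apply/hclass_eq/inj.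
    by rewrite linearB (eqP (kerP u)) (eqP (kerP v)) subrr.
  by exists u'; rewrite linearB.
have [v' ->] := hclassP y.
have [v [gv tv]] := surj _ (eqP (kerP v')).
by exists (hclass f (Ker (introT eqP gv))); apply: ThetaE.
Qed.
End HomologyMap.

Section Comparison.
Variables (k : fieldType) (C A : algType k) (M : bimod C A).
Implicit Types P : proj_resolution M.

Lemma pres_dd P n x : pres_d P n (pres_d P n.+1 x) = 0.
Proof. by apply/pres_exactS; exists x. Qed.
Lemma pres_augd P x : pres_aug P (pres_d P 0%N x) = 0.
Proof. by apply/pres_exact0; exists x. Qed.

(** The invariant says that t \o d takes its values in the image of the next differential of P', so
    that projectivity of P_(n+1) gives the next component. Exactness of P' restores it. *)
Lemma resolution_map_exists P P' : exists h : forall n, bihom (P n) (P' n), resolution_map h.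
Proof.
have [h0 h0P] := projective_lift (@pres_proj _ _ _ _ P 0)
  (fun p => pres_aug_surj P' (pres_aug P p)).
pose I n (t : bihom (P n) (P' n)) := forall p, exists z, pres_d P' n z = t (pres_d P n p).
pose R n (t : bihom (P n) (P' n)) (t' : bihom (P n.+1) (P' n.+1)) :=
  forall p, t (pres_d P n p) = pres_d P' n (t' p).
have [||h [h0E hR]] := @dependent_choice_from _ I R h0.
- by move=> p; apply/pres_exact0; rewrite h0P pres_augd.
- move=> n t It.
  have [t' t'P] := projective_lift (f := bicomp t (pres_d P n)) (@pres_proj _ _ _ _ P n.+1) It.
  exists t'; split=> p; last by rewrite t'P.
  by apply/pres_exactS; rewrite t'P bicompE pres_dd linear0.
by exists h; split => [p|n p]; rewrite ?h0E ?h0P // hR.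
Qed.

Lemma resolution_map_homotopy P P' (h h' : forall n, bihom (P n) (P' n)) :
  resolution_map h -> resolution_map h' ->
  exists s : forall n, bihom (P n) (P' n.+1),
    (forall p, h 0%N p - h' 0%N p = pres_d P' 0 (s 0%N p)) /\
    (forall n p, h n.+1 p - h' n.+1 p = pres_d P' n.+1 (s n.+1 p) + s n (pres_d P n p)).
Proof.
move=> [h0 hd] [h'0 h'd].
have [|s0 s0P] := projective_lift (d := pres_d P' 0) (f := h 0%N - h' 0%N) (@pres_proj _ _ _ _ P 0).
  by move=> p; apply/pres_exact0; rewrite bihomBE linearB h0 h'0 subrr.
(* [E] is the part of h - h' that t leaves to be corrected in degree n + 1. The next component of
   the homotopy has it as boundary, and the new error is again a cycle. *)
pose E n (t : bihom (P n) (P' n.+1)) : bihom (P n.+1) (P' n.+1) :=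
  h n.+1 - h' n.+1 - bicomp t (pres_d P n).
pose I n (t : bihom (P n) (P' n.+1)) := forall p, exists z, pres_d P' n.+1 z = E n t p.
pose R n (t : bihom (P n) (P' n.+1)) (t' : bihom (P n.+1) (P' n.+2)) :=
  forall p, pres_d P' n.+1 (t' p) = E n t p.
have [||s [s0E sR]] := @dependent_choice_from _ I R s0.
- move=> p; apply/pres_exactS.
  by rewrite !bihomBE !linearB -hd -h'd bicompE s0P bihomBE subrr.
- move=> n t It.
  have [t' t'P] := projective_lift (f := E n t) (@pres_proj _ _ _ _ P n.+1) It.
  exists t'; split => // p; apply/pres_exactS.
  rewrite !bihomBE !linearB -hd -h'd bicompE t'P /E !bihomBE bicompE pres_dd linear0.
  by rewrite subr0 subrr.
exists s; split => [p|n p]; first by rewrite s0E s0P.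
by rewrite sR !bihomBE bicompE subrK.
Qed.

Lemma resolution_map_id P : resolution_map (fun n => biid (P n)).
Proof. by []. Qed.

Lemma resolution_map_comp P1 P2 P3 (u : forall n, bihom (P1 n) (P2 n))
    (v : forall n, bihom (P2 n) (P3 n)) : resolution_map u -> resolution_map v ->
  resolution_map (fun n => bicomp (v n) (u n)).
Proof.
move=> [u0 ud] [v0 vd]; split=> [p|n p]; rewrite !bicompE ?v0 ?u0 //.
by rewrite ud vd.
Qed.

Variables (N : bimod C A) (r : nat).

Lemma Ext_map P P' (h : forall n, bihom (P n) (P' n)) : resolution_map h ->
  exists Theta : {linear Ext P' N r -> Ext P N r},
  forall (g' : cocycle (hom_complex P' N) r) (g : cocycle (hom_complex P N) r),
    (forall p, (val g : bihom (P r) N) p = (val g' : bihom (P' r) N) (h r p)) ->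
    Theta (cohom_class g') = cohom_class g.
Proof.
move=> [_ hd].
have thl : linear (fun g : hom_complex P' N r => precomp (h r) g : hom_complex P N r).
  exact: precomp_lin.
have [||Theta ThetaE] := @homology_map k _ _ _ _ _ _ (cdiff_in (hom_complex P' N) r)
    (cdiff (hom_complex P' N) r) (cdiff_in (hom_complex P N) r)
    (cdiff (hom_complex P N) r) (mklin thl).
- move=> v /(congr1 (fun f : bihom _ _ => fun p => f (h r.+1 p))) gv.
  apply: bihomE => p; have := congr1 (@^~ p) gv => /= gvp.
  by rewrite hd.
- move=> v _; case: (r) v thl => [|r'] v thl [u <-]; exists (precomp (h _) u) => //=.
    by apply: bihomE.
  by apply: bihomE => p /=; rewrite hd.
exists Theta => g' g gg'; apply: ThetaE; apply: bihomE => p.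
exact: gg'.
Qed.

Lemma cocycleE P (g : cocycle (hom_complex P N) r) p :
  (val g : bihom (P r) N) (pres_d P r p) = 0.
Proof. by have /(congr1 (fun f : bihom (P r.+1) N => f p)) := eqP (kerP g). Qed.

Lemma cocycle_pullback P P' (h : forall n, bihom (P n) (P' n))
    (g' : cocycle (hom_complex P' N) r) : resolution_map h ->
  exists g : cocycle (hom_complex P N) r,
    forall p, (val g : bihom (P r) N) p = (val g' : bihom (P' r) N) (h r p).
Proof.
move=> [_ hd]; pose f : hom_complex P N r := precomp (h r) (val g').
have cf : cdiff (hom_complex P N) r f == 0.
  by apply/eqP; apply: bihomE => p /=; rewrite hd cocycleE.
by exists (Ker cf).
Qed.

(** With h - h' = d s + s d, the term g' d s vanishes because g' is a cocycle, and g' s d is the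
    coboundary of g' s. In degree 0 only the first term occurs, and the two cocycles are equal. *)
Lemma cohom_class_homotopy P P' (h h' : forall n, bihom (P n) (P' n))
    (g' : cocycle (hom_complex P' N) r) (g1 g2 : cocycle (hom_complex P N) r) :
  resolution_map h -> resolution_map h' ->
  (forall p, (val g1 : bihom (P r) N) p = (val g' : bihom (P' r) N) (h r p)) ->
  (forall p, (val g2 : bihom (P r) N) p = (val g' : bihom (P' r) N) (h' r p)) ->
  cohom_class g1 = cohom_class g2.
Proof.
move=> hh hh' g1E g2E; have [s [s0 sS]] := resolution_map_homotopy hh hh'.
have g'd := cocycleE g'.
have E p : (val g1 : bihom (P r) N) p - (val g2 : bihom (P r) N) p =
    (val g' : bihom (P' r) N) (h r p - h' r p) by rewrite g1E g2E linearB.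
apply/hclass_eq.
case: (r) g' g1 g2 {g1E g2E} g'd E => [|r'] g' g1 g2 g'd E.
  by exists 0; rewrite linear0; apply: bihomE => p; rewrite bihomBE E s0 g'd.
exists (precomp (s r') (val g' : bihom (P' r'.+1) N)); apply: bihomE => p.
by rewrite bihomBE E sS linearD g'd add0r.
Qed.

(** One resolution is enough: [phi] at P' is theta followed by pullback along a chosen map P' -> P.
    Bijectivity and naturality both come from the homotopy invariance of pullback, hence its
    independence of the choice. *)
Lemma Ext_natural_iso P (V : lmodType k) (theta : {linear V -> Ext P N r}) :
  bijective theta ->
  exists phi : forall P : proj_resolution M, {linear V -> Ext P N r},
    (forall P, bijective (phi P)) /\ resolution_natural (fun P => phi P).
Proof.
move=> bij_theta.
pose h P' := sval (cid (resolution_map_exists P' P)).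
have hP P' : resolution_map (h P') := svalP (cid (resolution_map_exists P' P)).
pose Th P' := sval (cid (Ext_map (hP P'))).
have ThE P' (g' : cocycle (hom_complex P N) r) (g : cocycle (hom_complex P' N) r) :
    (forall p, (val g : bihom (P' r) N) p = (val g' : bihom (P r) N) (h P' r p)) ->
    Th P' (cohom_class g') = cohom_class g := svalP (cid (Ext_map (hP P'))) g' g.
have phi_lin P' : linear (fun v => Th P' (theta v)) by move=> c u v; rewrite !linearP.
exists (fun P' => mklin (phi_lin P')); split=> [P'|P1 P2 f [f0 fd] v g2 g1 g12 /= phi2].
  apply: bij_comp bij_theta.
  have [h' h'P] := resolution_map_exists P P'; have [Th' Th'E] := Ext_map h'P.
  exists Th' => x; have [g ->] := hclassP x.
    have [g1 g1E] := cocycle_pullback g (hP P').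
    have [g2 g2E] := cocycle_pullback g1 h'P.
    rewrite (ThE P' _ _ g1E) (Th'E _ _ g2E).
    apply: (cohom_class_homotopy (g' := g) (resolution_map_comp h'P (hP P'))
      (resolution_map_id P)) => p //.
    by rewrite g2E g1E.
  have [g1 g1E] := cocycle_pullback g h'P.
  have [g2 g2E] := cocycle_pullback g1 (hP P').
  rewrite (Th'E _ _ g1E) (ThE P' _ _ g2E).
  apply: (cohom_class_homotopy (g' := g) (resolution_map_comp (hP P') h'P)
    (resolution_map_id P')) => p //.
  by rewrite g2E g1E.
have [g thg] := hclassP (theta v); rewrite thg in phi2 *.
have [u1 u1E] := cocycle_pullback g (hP P1); rewrite (ThE P1 _ _ u1E).
have [u2 u2E] := cocycle_pullback g (hP P2); rewrite (ThE P2 _ _ u2E) in phi2.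
have fP : resolution_map f by [].
have [Tf TfE] := Ext_map fP; have [u3 u3E] := cocycle_pullback u2 fP.
rewrite -(TfE _ _ g12) -phi2 (TfE _ _ u3E).
(* The chosen map P1 -> P and the composite P1 -> P2 -> P both lift the identity of M, so they are
   homotopic. *)
have h2f := resolution_map_comp fP (hP P2).
by apply: (cohom_class_homotopy (g' := g) (hP P1) h2f) => p //; rewrite u3E u2E.
Qed.
End Comparison.

(** * One-sided modules and free bimodules *)

Section RightModule.
Variables (k : fieldType) (C A : algType k) (M : bimod C A).

Fact right_lact_linl (m : M) : linear (fun c : k^o => c *: m).
Proof. by move=> c u v; rewrite scalerDl scalerA. Qed.
Fact right_lact_linr (c : k^o) : linear (fun m : M => c *: m).
Proof. by move=> z u v; rewrite scalerDr !scalerA mulrC. Qed.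
Fact right_lactM (c c' : k^o) (m : M) : (c * c') *: m = c *: (c' *: m).
Proof. by rewrite scalerA. Qed.
Fact right_lract (c : k^o) (m : M) a : ract (c *: m) a = c *: ract m a.
Proof. exact: ractZl. Qed.
Definition right_of_bimod : bimod k^o A :=
  @Bimod k k^o A M (fun c m => c *: m) (@ract _ _ _ M)
    right_lact_linl right_lact_linr (@ract_linl _ _ _ M) (@ract_linr _ _ _ M)
    (@scale1r _ _) right_lactM (@ract1 _ _ _ M) (@ractM _ _ _ M) right_lract.
End RightModule.

Section OneSidedMaps.
Variables (k : fieldType) (C A : algType k) (M N : bimod C A) (f : bihom M N).

Definition right_of_bihom : bihom (right_of_bimod M) (right_of_bimod N) :=
  @mkbihom _ _ _ (right_of_bimod M) (right_of_bimod N) f (bihom_lin f) (lhomZ f) (bihom_r f).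
Definition left_of_bihom : bihom (left_of_bimod M) (left_of_bimod N) :=
  @mkbihom _ _ _ (left_of_bimod M) (left_of_bimod N) f (bihom_lin f) (bihom_l f)
    (fun m a => lhomZ f a m).
End OneSidedMaps.

Section TensorInduction.
Variables (k : fieldType) (C B A : algType k) (M : bimod C B) (N : bimod B A).

(** The projection onto the quotient by the subspace W vanishes on pure tensors, hence everywhere by
    [tensorP]. This turns the uniqueness of linear maps into an induction principle. *)
Lemma tensor_ind (W : tensor M N -> Prop) :
  W 0 -> (forall c u v, W u -> W v -> W (c *: u + v)) -> (forall m n, W (pure m n)) ->
  forall t, W t.
Proof.
move=> W0 WL Wp t; pose w : {pred tensor M N} := fun t => `[< W t >].
have subw : submod_closed w.
  split; first exact/asboolP.
  by move=> c u v /asboolP Wu /asboolP Wv; apply/asboolP/WL.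
suff: t \in w by move/asboolP.
apply/(qpi_eq0 subw).
have z_lin : linear (fun _ : tensor M N => 0 : lquot subw).
  by move=> c u v; rewrite scaler0 addr0.
move: t; apply: (tensorP (@qpiL _ _ _ subw) z_lin) => m n.
by apply/qpi_eq0/asboolP.
Qed.

Local Notation pur := (@pure k C B A M N).

Lemma pure0l n : pur (0 : M) n = 0.
Proof. exact: (linear0 (mklin (@pure_linl _ _ _ _ M N n))). Qed.
Lemma pure0r m : pur m (0 : N) = 0.
Proof. exact: (linear0 (mklin (@pure_linr _ _ _ _ M N m))). Qed.
Lemma pureZl c m n : pur (c *: m : M) n = c *: pur m n.
Proof. exact: (linearZ_LR (mklin (@pure_linl _ _ _ _ M N n))). Qed.
Lemma pureZr c m n : pur m (c *: n : N) = c *: pur m n.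
Proof. exact: (linearZ_LR (mklin (@pure_linr _ _ _ _ M N m))). Qed.
Lemma pureDl m m' n : pur (m + m' : M) n = pur m n + pur m' n.
Proof. exact: (linearD (mklin (@pure_linl _ _ _ _ M N n))). Qed.
Lemma pureDr m n n' : pur m (n + n' : N) = pur m n + pur m n'.
Proof. exact: (linearD (mklin (@pure_linr _ _ _ _ M N m))). Qed.
Lemma pureBr m n n' : pur m (n - n' : N) = pur m n - pur m n'.
Proof. exact: (linearB (mklin (@pure_linr _ _ _ _ M N m))). Qed.

Lemma tensor_lactE c m n : lact c (pur m n : tensor M N) = pur (lact c m) n.
Proof. exact: tlactE. Qed.
Lemma tensor_ractE a m n : ract (pur m n : tensor M N) a = pur m (ract n a).
Proof. exact: tractE. Qed.
End TensorInduction.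

Section TensorMapBihom.
Variables (k : fieldType) (C B A : algType k) (M : bimod C B) (N N' : bimod B A).
Variable f : bihom N N'.

Lemma tensor_mapE (m : M) n : tensor_map M f (pure m n) = pure m (f n).
Proof. exact: tensor_liftE. Qed.

Definition tensor_bihom : bihom (tensor M N) (tensor M N').
Proof.
apply: (@mkbihom _ _ _ (tensor M N) (tensor M N') (tensor_map M f)).
- exact: linearP.
- move=> c; apply: tensor_ind => [|z u v hu hv|m n].
  + by rewrite lactr0 !linear0 lactr0.
  + by rewrite lact_linr !linearP hu hv lact_linr.
  + by rewrite tensor_lactE !tensor_mapE tensor_lactE.
- move=> t a; move: t; apply: tensor_ind => [|z u v hu hv|m n].
  + by rewrite ract0l !linear0 ract0l.
  + by rewrite ract_linl !linearP hu hv ract_linl.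
  + by rewrite tensor_ractE !tensor_mapE tensor_ractE bihom_r.
Defined.
Lemma tensor_bihomE (m : M) n : tensor_bihom (pure m n) = pure m (f n).
Proof. exact: tensor_mapE. Qed.
End TensorMapBihom.

Section FreeBimod.
Variables (k : fieldType) (C A : algType k) (Z : bimod k^o A).

(* C (x)_k Z *)
Definition freeb : bimod C A := tensor (left_of_bimod (reg_bimod C)) Z.
Definition fpure (c : C) (z : Z) : freeb := pure (c : left_of_bimod (reg_bimod C)) z.

Lemma fpure_lact c c' z : lact c (fpure c' z) = fpure (c * c') z.
Proof. exact: tensor_lactE. Qed.
Lemma fpure_lact1 c z : fpure c z = lact c (fpure 1 z).
Proof. by rewrite fpure_lact mulr1. Qed.
Lemma fpure_ract c z a : ract (fpure c z) a = fpure c (ract z a).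
Proof. exact: tensor_ractE. Qed.
Lemma fpure_linr c : linear (fpure c).
Proof. exact: pure_linr. Qed.
Lemma fpure_linl z : linear (fpure^~ z).
Proof. exact: (@pure_linl _ _ _ _ (left_of_bimod (reg_bimod C)) Z z). Qed.

Lemma fpure0r c : fpure c 0 = 0.
Proof. exact: pure0r. Qed.

Lemma fpureZr a c z : fpure c (a *: z) = a *: fpure c z.
Proof. exact: pureZr. Qed.

Section Extension.
Variables (A' : algType k) (X : bimod C A') (h : Z -> X).
Hypothesis h_lin : linear h.

Fact freeb_ext_l z : linear (fun c : left_of_bimod (reg_bimod C) => lact (c : C) (h z)).
Proof. exact: lact_linl. Qed.
Fact freeb_ext_r (c : left_of_bimod (reg_bimod C)) : linear (fun z => lact (c : C) (h z)).
Proof. by move=> a u v; rewrite h_lin lact_linr. Qed.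
Fact freeb_ext_b (c : left_of_bimod (reg_bimod C)) (b : k^o) (z : Z) :
  lact (ract c b : C) (h z) = lact (c : C) (h (lact b z)).
Proof.
rewrite lact_scalar ract_scalar -[h (_ *: z)]/(mklin h_lin (b *: z)) linearZ_LR /= lactZr.
exact: lactZl.
Qed.
Definition freeb_ext : {linear freeb -> X} :=
  tensor_lift freeb_ext_l freeb_ext_r freeb_ext_b.
Lemma freeb_extE c z : freeb_ext (fpure c z) = lact c (h z).
Proof. exact: tensor_liftE. Qed.

Lemma freeb_ext_lact c t : freeb_ext (lact c t) = lact c (freeb_ext t).
Proof.
move: t; apply: tensor_ind => [|a u v hu hv|c' z]; first by rewrite lactr0 linear0 lactr0.
  by rewrite lact_linr !linearP hu hv lact_linr.
by rewrite -/(fpure c' z) fpure_lact !freeb_extE lactM.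
Qed.
End Extension.

Section BihomExtension.
Variables (X : bimod C A) (h : bihom Z (right_of_bimod X)).
Fact freeb_bihom_lin : linear (h : Z -> X). Proof. exact (bihom_lin h). Qed.
Fact freeb_bihom_ract t a :
  freeb_ext freeb_bihom_lin (ract t a) = ract (freeb_ext freeb_bihom_lin t) a.
Proof.
move: t; apply: tensor_ind => [|c u v hu hv|c z].
- by rewrite ract0l linear0 ract0l.
- by rewrite ract_linl !linearP hu hv ract_linl.
by rewrite -/(fpure c z) fpure_ract !freeb_extE bihom_r lract.
Qed.
Definition freeb_bihom : bihom freeb X :=
  @mkbihom _ _ _ freeb X (freeb_ext freeb_bihom_lin) (linearP _)
    (freeb_ext_lact freeb_bihom_lin) freeb_bihom_ract.
Lemma freeb_bihomE c z : freeb_bihom (fpure c z) = lact c (h z : X).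
Proof. exact: freeb_extE. Qed.
End BihomExtension.

Definition freeb_unit : bihom Z (right_of_bimod freeb).
Proof.
apply: (@mkbihom _ _ _ Z (right_of_bimod freeb) (fpure 1)); first exact: fpure_linr.
  by move=> c z; rewrite !lact_scalar; apply: pureZr.
by move=> z a; rewrite -fpure_ract.
Defined.

Lemma freeb_ind (W : freeb -> Prop) :
  W 0 -> (forall c u v, W u -> W v -> W (c *: u + v)) -> (forall c z, W (fpure c z)) ->
  forall t, W t.
Proof. exact: tensor_ind. Qed.
End FreeBimod.

(** * Projectivity of free bimodules and of regular modules *)

Section Projectivity.
Variable k : fieldType.

(** Bimodule maps out of C (x) Z are right A-module maps out of Z, so a lift on the elements 1 (x) z
    extends. *)
Lemma freeb_projective (C A : algType k) (Z : bimod k^o A) :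
  projective Z -> projective (freeb C Z).
Proof.
move=> projZ X Y g f g_surj.
have [h hP] := projZ _ _ (right_of_bihom g) (bicomp (right_of_bihom f) (freeb_unit C Z)) g_surj.
exists (freeb_bihom h) => p; move: p; apply: freeb_ind => [|c u v hu hv|c z].
- by rewrite !linear0.
- by rewrite !linearP hu hv.
have := hP z; rewrite freeb_bihomE bihom_l /= => ->.
by rewrite [in RHS]fpure_lact1 bihom_l.
Qed.

(** As a left C-module C (x) Z is free on the vector space Z, so a linear section of g lifts the
    generators. This is what lets the bar complex compute Tor. *)
Lemma left_freeb_projective (C A : algType k) (Z : bimod k^o A) :
  projective (left_of_bimod (freeb C Z)).
Proof.
move=> X Y g f g_surj; have [s sP] := linear_section g_surj.
have h_lin : linear (fun z => s (f (fpure 1 z))).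
  by move=> c u v; rewrite fpure_linr !linearP.
have @h : bihom (left_of_bimod (freeb C Z)) X.
  apply: (@mkbihom _ _ _ (left_of_bimod (freeb C Z)) X (freeb_ext h_lin)).
  - exact: linearP.
  - exact: freeb_ext_lact.
  - by move=> t a; rewrite !ract_scalar; apply: linearZ_LR.
exists h => p; move: p; apply: freeb_ind => [|c u v hu hv|c z].
- by rewrite !linear0.
- by rewrite !linearP hu hv.
rewrite -[h _]/(freeb_ext h_lin (fpure c z)) freeb_extE bihom_l sP -bihom_l.
by congr (f _); rewrite [RHS]fpure_lact1.
Qed.

Lemma reg_projective_right (A : algType k) : projective (right_of_bimod (reg_bimod A)).
Proof.
move=> X Y g f g_surj; have [x gx] := g_surj (f (1 : A)).
have @h : bihom (right_of_bimod (reg_bimod A)) X.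
  apply: (@mkbihom _ _ _ (right_of_bimod (reg_bimod A)) X (fun a : A => ract x a)).
  - exact: ract_linr.
  - by move=> c a; rewrite !lact_scalar; apply: ractZr.
  - by move=> a b; apply: ractM.
exists h => a; rewrite -[h a]/(ract x a) bihom_r gx -bihom_r.
by congr (f _); apply: mul1r.
Qed.

Lemma reg_projective_left (A : algType k) : projective (left_of_bimod (reg_bimod A)).
Proof.
move=> X Y g f g_surj; have [x gx] := g_surj (f (1 : A)).
have @h : bihom (left_of_bimod (reg_bimod A)) X.
  apply: (@mkbihom _ _ _ (left_of_bimod (reg_bimod A)) X (fun a : A => lact a x)).
  - exact: lact_linl.
  - by move=> c a; apply: lactM.
  - by move=> a c; rewrite !ract_scalar; apply: lactZl.
exists h => a; rewrite -[h a]/(lact a x) bihom_l gx -bihom_l.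
by congr (f _); apply: mulr1.
Qed.

Lemma zero_projective (C A : algType k) (Z : bimod C A) :
  (forall z : Z, z = 0) -> projective Z.
Proof.
move=> Z0 X Y g f _; exists 0 => z.
by rewrite [z]Z0 !linear0.
Qed.
End Projectivity.

Section HomBimod.
Variables (k : fieldType) (C B A : algType k) (M : bimod C B) (X : bimod k^o A).

Fact hom_lact_subproof (b : B) (h : lhom M X) : linear (fun m : M => h (ract m b)).
Proof. by move=> c u v; rewrite ract_linl lhomL. Qed.
Fact hom_ract_subproof (h : lhom M X) (a : A) : linear (fun m : M => ract (h m) a).
Proof. by move=> c u v; rewrite lhomL ract_linl. Qed.
Definition hom_lact b h : lhom M X := mklin (hom_lact_subproof b h).
Definition hom_ract h a : lhom M X := mklin (hom_ract_subproof h a).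

Definition hom_bimod : bimod B A.
Proof.
apply: (@Bimod k B A (lhom M X) hom_lact hom_ract).
- by move=> h c u v; apply: lhomP => m; rewrite lhomDE lhomZE /= ract_linr lhomL.
- by move=> b c u v; apply: lhomP => m.
- by move=> a c u v; apply: lhomP => m; rewrite [RHS]lhomDE lhomZE /= ract_linl.
- by move=> h c u v; apply: lhomP => m; rewrite [RHS]lhomDE lhomZE /= ract_linr.
- by move=> h; apply: lhomP => m; rewrite /= ract1.
- by move=> b b' h; apply: lhomP => m; rewrite /= ractM.
- by move=> h; apply: lhomP => m; rewrite /= ract1.
- by move=> h a a'; apply: lhomP => m; rewrite /= ractM.
- by move=> b h a; apply: lhomP.
Defined.
End HomBimod.

(* Hom_A(M (x)_B P, -) is Hom_{B-A}(P, Hom_k(M, -)). *)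
Lemma tensor_projective_right (k : fieldType) (C B A : algType k) (M : bimod C B)
    (P : bimod B A) : projective P -> projective (right_of_bimod (tensor M P)).
Proof.
move=> projP X Y g f g_surj; have [s sP] := linear_section g_surj.
have gl (h : lhom M X) : linear (fun m => g (h m)).
  by move=> c u v; rewrite !linearP.
have gl_lin : linear (fun h : hom_bimod M X => mklin (gl h) : hom_bimod M Y).
  by move=> c u v; apply: lhomP => m; rewrite [RHS]lhomDE lhomZE /= -linearP.
have @g' : bihom (hom_bimod M X) (hom_bimod M Y).
  apply: (mkbihom gl_lin) => [b h|h a]; apply: lhomP => m //=.
  by rewrite bihom_r.
have fl (p : P) : linear (fun m : M => f (pure m p : tensor M P)).
  by move=> c u v; rewrite pure_linl; apply: linearP.
have fl_lin : linear (fun p => mklin (fl p) : hom_bimod M Y).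
  by move=> c u v; apply: lhomP => m; rewrite [RHS]lhomDE lhomZE /= pure_linr; apply: linearP.
have @f' : bihom P (hom_bimod M Y).
  apply: (mkbihom fl_lin) => [b p|p a]; apply: lhomP => m /=; first by rewrite -pure_bal.
  by rewrite -[pure m (ract p a)]tensor_ractE bihom_r.
(* Composition with g is surjective from Hom_k(M, X) to Hom_k(M, Y) because g has a linear
   section. *)
have [|h hP] := projP _ _ g' f'.
  move=> y; have sl : linear (fun m => s ((y : lhom M Y) m)).
    by move=> c u v; rewrite lhomL linearP.
  by exists (mklin sl : lhom M X); apply: lhomP => m; rewrite /= sP.
have hE p m : g ((h p : lhom M X) m) = f (pure m p : tensor M P).
  by have /(congr1 (fun u : lhom M Y => u m)) := hP p.
have h1 p : linear (fun m => (h p : lhom M X) m) by exact: lhomL.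
have h2 m : linear (fun p => (h p : lhom M X) m).
  by move=> c u v; rewrite lhomL lhomDE lhomZE.
have h3 m b p : (h p : lhom M X) (ract m b) = (h (lact b p) : lhom M X) m.
  by rewrite bihom_l.
have @H : bihom (right_of_bimod (tensor M P)) X.
  apply: (@mkbihom _ _ _ (right_of_bimod (tensor M P)) X (tensor_lift h1 h2 h3)).
  - exact: linearP.
  - by move=> c t; rewrite !lact_scalar; apply: linearZ_LR.
  - move=> t a; move: t; apply: tensor_ind => [|c u v hu hv|m p].
    + by rewrite ract0l linear0 ract0l.
    + by rewrite ract_linl !linearP hu hv ract_linl.
    + by rewrite tensor_ractE !tensor_liftE bihom_r.
exists H => t; move: t; apply: tensor_ind => [|c u v hu hv|m p].
- by rewrite !linear0.
- by rewrite !linearP hu hv.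
by rewrite -[H _]/(tensor_lift h1 h2 h3 (pure m p)) tensor_liftE hE.
Qed.
(** * The total bar resolution *)

Record chain_complex (k : fieldType) (C A : algType k) := ChainComplex {
  cxobj :> nat -> bimod C A;
  cxd : forall n, bihom (cxobj n.+1) (cxobj n) }.

Section ConeStep.
Variables (k : fieldType) (C A : algType k) (Y Y' S S' : bimod C A).
Variables (dY : bihom Y' Y) (aug : bihom S' Y) (dS : bihom S' S).

Definition cone_of (Y S : bimod C A) : bimod k^o A := dsum (right_of_bimod Y) (right_of_bimod S).

(** The usual sign of the mapping cone is absorbed in dS: the augmentation anticommutes with the
    differentials ([abar_aug_d]), and this makes the map square to zero. *)
Definition cone_map : bihom (cone_of Y' S') (cone_of Y S) :=
  bicomp (dsum_inl _ _) (bicomp (right_of_bihom dY) (dsum_fst _ _)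
    + bicomp (right_of_bihom aug) (dsum_snd _ _))
  + bicomp (dsum_inr _ _) (bicomp (right_of_bihom dS) (dsum_snd _ _)).
Lemma cone_mapE y t : cone_map (y, t) = (dY y + aug t, dS t).
Proof. by congr pair; [apply: addr0 | apply: add0r]. Qed.

Definition bar_gen (c : C) (y : Y) (t : S) : freeb C (cone_of Y S) :=
  fpure c ((y, t) : cone_of Y S).
Lemma bar_gen_ind (W : freeb C (cone_of Y S) -> Prop) :
  W 0 -> (forall c u v, W u -> W v -> W (c *: u + v)) -> (forall c y t, W (bar_gen c y t)) ->
  forall t, W t.
Proof. by move=> W0 WL Wg; apply: freeb_ind => // c [y t]; apply: Wg. Qed.
Lemma bar_gen_lact c c' y t : lact c (bar_gen c' y t) = bar_gen (c * c') y t.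
Proof. exact: fpure_lact. Qed.
Lemma bar_gen0 c : bar_gen c 0 0 = 0.
Proof. exact: fpure0r. Qed.

Definition cone_fst : bihom (freeb C (cone_of Y S)) Y := freeb_bihom (dsum_fst _ _).
Lemma cone_fstE c y t : cone_fst (bar_gen c y t) = lact c y.
Proof. exact: freeb_bihomE. Qed.
End ConeStep.

Section BarDifferential.
Variables (k : fieldType) (C A : algType k) (Z : bimod k^o A) (Y : bimod C A).
Variable f : bihom (dsum (right_of_bimod Y) (right_of_bimod (freeb C Z))) Z.

(** The term c t is the face of the bar complex that multiplies the coefficient into the next
    factor. The other faces come from the differential f of the cone, with the opposite sign. *)
Definition bar_diff : bihom (freeb C (cone_of Y (freeb C Z))) (freeb C Z) :=
  freeb_bihom (dsum_snd _ _ - bicomp (freeb_unit C Z) f).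
Lemma bar_diffE c y t : bar_diff (bar_gen c y t) = lact c t - fpure c (f (y, t)).
Proof.
rewrite [LHS]freeb_bihomE bihomBE bicompE lactBr; congr (_ - _).
by rewrite [RHS]fpure_lact1.
Qed.
End BarDifferential.

Section AbstractBar.
Variables (k : fieldType) (C A : algType k) (Y S : nat -> bimod C A).
Variables (dY : forall n, bihom (Y n.+1) (Y n)) (dS : forall n, bihom (S n.+1) (S n)).
Variables (aug : forall n, bihom (S n.+1) (Y n)) (gen : forall n, C -> Y n -> S n -> S n.+1).
Hypothesis S0 : forall t : S 0%N, t = 0.
Hypothesis gen_ind : forall n (W : S n.+1 -> Prop),
  W 0 -> (forall c u v, W u -> W v -> W (c *: u + v)) -> (forall c y t, W (gen c y t)) ->
  forall t, W t.
Hypothesis gen0 : forall n c, gen c (0 : Y n) 0 = 0.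
Hypothesis augE : forall n c (y : Y n) t, aug n (gen c y t) = lact c y.
Hypothesis dSE : forall n c (y : Y n.+1) t,
  dS n.+1 (gen c y t) = lact c t - gen c (dY n y + aug n t) (dS n t).
Hypothesis dYY : forall n y, dY n (dY n.+1 y) = 0.

(** On a generator c (x) (y, t) the left side is c aug t - c (dY y + aug t) = - c dY y. *)
Lemma abar_aug_d n t : aug n (dS n.+1 t) = - dY n (aug n.+1 t).
Proof.
move: t; apply: gen_ind => [|c u v hu hv|c y t]; first by rewrite !linear0.
  by rewrite !linearP hu hv.
rewrite dSE linearB bihom_l !augE lactDr opprD addrCA subrr addr0.
by rewrite bihom_l.
Qed.

(** On a generator the two terms c (dS t) cancel. What remains is c (x) (dY aug t + aug dS t, dS dS
    t), which vanishes by anticommutation and by induction. *)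
Lemma abar_dd n t : dS n (dS n.+1 t) = 0.
Proof.
elim: n t => [|n IHn] t; first by rewrite [LHS]S0.
move: t; apply: gen_ind => [|c u v hu hv|c y t]; first by rewrite !linear0.
  by rewrite !linearP hu hv scaler0 addr0.
rewrite dSE linearB bihom_l dSE opprB addrCA subrr addr0 IHn.
by rewrite linearD dYY add0r abar_aug_d subrr gen0.
Qed.

(* The cone of aug is contractible by (y, t) |-> (0, 1 (x) (y, t)). *)
Lemma abar_exact n (y : Y n.+1) (t : S n.+1) :
  dY n y + aug n t = 0 -> dS n t = 0 -> exists z, dS n.+1 z = t.
Proof.
move=> yt dt; exists (gen 1 y t).
by rewrite dSE yt dt gen0 lact1 subr0.
Qed.

Variables (N : bimod C A) (augY : bihom (Y 0%N) N).
Hypothesis aug_surj : forall y, exists x, augY x = y.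
Hypothesis Y_exact0 : forall x, augY x = 0 <-> exists z, dY 0%N z = x.
Hypothesis Y_exactS : forall n x, dY n x = 0 -> exists z, dY n.+1 z = x.

Lemma abar_surj y : exists x, augY (aug 0 x) = y.
Proof.
have [x <-] := aug_surj y; exists (gen 1 x 0).
by rewrite augE lact1.
Qed.

Lemma abar_exact0 x : augY (aug 0 x) = 0 <-> exists z, dS 1 z = x.
Proof.
split=> [|[z <-]]; last first.
  by rewrite abar_aug_d linearN (Y_exact0 _).2 ?oppr0 //; exists (aug 1 z).
move=> /Y_exact0[y yx]; apply: (@abar_exact _ (- y)); last exact: S0.
by rewrite linearN yx addNr.
Qed.

(** By anticommutation aug sends a cycle x to a cycle of Y, hence to a boundary dY y. Then (-y, x)
    is a cycle of the cone, which [abar_exact] bounds. *)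
Lemma abar_exactS n x : dS n.+1 x = 0 <-> exists z, dS n.+2 z = x.
Proof.
split=> [dx|[z <-]]; last exact: abar_dd.
have /Y_exactS[y yx] : dY n (aug n.+1 x) = 0.
  by apply: oppr_inj; rewrite -abar_aug_d dx linear0 oppr0.
by apply: (@abar_exact _ (- y)); rewrite // linearN yx addNr.
Qed.
End AbstractBar.

Section BarConstruction.
Variables (k : fieldType) (C A : algType k) (Y : chain_complex C A).

(* The bar resolution T of Y has T_n = C (x) (Y_n (+) T_(n-1)); bar_shift n is T_(n-1). *)
Fixpoint bar_shift (n : nat) : bimod C A :=
  match n with
  | 0 => zero_bimod C A
  | n'.+1 => freeb C (cone_of (Y n') (bar_shift n'))
  end.
Definition cone n : bimod k^o A := cone_of (Y n) (bar_shift n).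

Definition bar_aug n : bihom (bar_shift n.+1) (Y n) := cone_fst (Y n) (bar_shift n).

Fixpoint bar_shift_d n : bihom (bar_shift n.+1) (bar_shift n) :=
  match n with
  | 0 => 0
  | n'.+1 => bar_diff (cone_map (cxd Y n') (bar_aug n') (bar_shift_d n'))
  end.

Definition bgen n : C -> Y n -> bar_shift n -> bar_shift n.+1 :=
  @bar_gen _ _ _ (Y n) (bar_shift n).
Lemma bar_shift0 (t : bar_shift 0) : t = 0.
Proof. exact: zero_lmod_eq. Qed.
Lemma bgen_ind n (W : bar_shift n.+1 -> Prop) :
  W 0 -> (forall c u v, W u -> W v -> W (c *: u + v)) -> (forall c y t, W (bgen c y t)) ->
  forall t, W t.
Proof. exact: bar_gen_ind. Qed.
Lemma bgen_lact n c c' (y : Y n) t : lact c (bgen c' y t) = bgen (c * c') y t.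
Proof. exact: bar_gen_lact. Qed.
Lemma bgen0 n c : bgen c (0 : Y n) 0 = 0.
Proof. exact: bar_gen0. Qed.
Lemma bar_augE n c (y : Y n) t : bar_aug n (bgen c y t) = lact c y.
Proof. exact: cone_fstE. Qed.
Lemma bar_shift_dE n c (y : Y n.+1) t :
  bar_shift_d n.+1 (bgen c y t) = lact c t - bgen c (cxd Y n y + bar_aug n t) (bar_shift_d n t).
Proof. by rewrite [LHS]bar_diffE cone_mapE. Qed.

Definition bar : chain_complex C A :=
  @ChainComplex _ _ _ (fun n => bar_shift n.+1) (fun n => bar_shift_d n.+1).

Variables (N : bimod C A) (aug : bihom (Y 0%N) N).
Hypothesis Ydd : forall n y, cxd Y n (cxd Y n.+1 y) = 0.
Hypothesis aug_surj : forall y, exists x, aug x = y.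
Hypothesis Y_exact0 : forall x, aug x = 0 <-> exists z, cxd Y 0%N z = x.
Hypothesis Y_exactS : forall n x, cxd Y n x = 0 -> exists z, cxd Y n.+1 z = x.

Definition bar_pres_aug : bihom (bar 0%N) N := bicomp aug (bar_aug 0).

Lemma bar_pres_aug_surj y : exists x, bar_pres_aug x = y.
Proof. exact: (abar_surj bar_augE aug_surj). Qed.

Lemma bar_exact0 x : bar_pres_aug x = 0 <-> exists z, cxd bar 0%N z = x.
Proof.
exact: (abar_exact0 (S := bar_shift) bar_shift0 bgen_ind bgen0 bar_augE bar_shift_dE Y_exact0).
Qed.

Lemma bar_exactS n x : cxd bar n x = 0 <-> exists z, cxd bar n.+1 z = x.
Proof.
exact: (abar_exactS (S := bar_shift) bar_shift0 bgen_ind bgen0 bar_augE bar_shift_dE Ydd Y_exactS).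
Qed.

Hypothesis Y_proj : forall n, projective (right_of_bimod (Y n)).

(** The functor C (x)_k - preserves projective right A-modules: this is [tensor_projective_right]
    with k as the middle algebra. *)
Lemma bar_shift_projective_right n : projective (right_of_bimod (bar_shift n)).
Proof.
elim: n => [|n IHn]; first by apply: zero_projective => z; apply: zero_lmod_eq.
by apply: tensor_projective_right; apply: dsum_projective.
Qed.

Lemma cone_projective n : projective (cone n).
Proof. by apply: dsum_projective => //; apply: bar_shift_projective_right. Qed.

Definition bar_resolution : proj_resolution N :=
  @ProjResolution _ _ _ N bar (cxd bar) bar_pres_aug
    (fun n => freeb_projective (@cone_projective n)) bar_pres_aug_surj bar_exact0 bar_exactS.

(** The resolution of the left module N to which the Tor-vanishing hypothesis is applied. *)
Definition left_bar_resolution : proj_resolution (left_of_bimod N) :=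
  @ProjResolution _ _ _ (left_of_bimod N) (fun n => left_of_bimod (bar n))
    (fun n => left_of_bihom (cxd bar n)) (left_of_bihom bar_pres_aug)
    (fun n => @left_freeb_projective _ _ _ (cone n)) bar_pres_aug_surj bar_exact0 bar_exactS.
End BarConstruction.

(** * Exactness of tensor products *)

Section TensorLeft.
Variables (k : fieldType) (C B A : algType k) (M : bimod C B) (N : bimod B A).

(* tensor M N and tensor M (left_of_bimod N) have the same generators and relations,
   but they are different presented spaces. *)
Fact to_left_bal (m : M) b n :
  pure (ract m b) (n : left_of_bimod N) = pure m (lact b n : left_of_bimod N).
Proof. exact: (pure_bal m b (n : left_of_bimod N)). Qed.
Definition to_left : {linear tensor M N -> tensor M (left_of_bimod N)} :=
  tensor_lift (fun n : N => pure_linl (M := M) (n : left_of_bimod N))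
    (fun m => pure_linr (N := left_of_bimod N) m) to_left_bal.
Lemma to_leftE m n : to_left (pure m n) = pure m (n : left_of_bimod N).
Proof. exact: tensor_liftE. Qed.

Fact of_left_bal (m : M) b (n : left_of_bimod N) :
  pure (ract m b) (n : N) = pure m (lact b n : N).
Proof. exact: (pure_bal m b (n : N)). Qed.
Definition of_left : {linear tensor M (left_of_bimod N) -> tensor M N} :=
  tensor_lift (fun n : left_of_bimod N => pure_linl (M := M) (n : N))
    (fun m => pure_linr (N := N) m) of_left_bal.
Lemma of_leftE m n : of_left (pure m n) = pure m (n : N).
Proof. exact: tensor_liftE. Qed.

Lemma to_leftK t : of_left (to_left t) = t.
Proof.
move: t; apply: tensor_ind => [|c u v hu hv|m n]; first by rewrite !linear0.
  by rewrite !linearP hu hv.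
by rewrite to_leftE of_leftE.
Qed.
Lemma of_leftK t : to_left (of_left t) = t.
Proof.
move: t; apply: tensor_ind => [|c u v hu hv|m n]; first by rewrite !linear0.
  by rewrite !linearP hu hv.
by rewrite of_leftE to_leftE.
Qed.
End TensorLeft.

Lemma to_left_map (k : fieldType) (C B A : algType k) (M : bimod C B) (N N' : bimod B A)
    (f : bihom N N') (t : tensor M N) :
  to_left M N' (tensor_bihom M f t) = tensor_map M (left_of_bihom f) (to_left M N t).
Proof.
move: t; apply: tensor_ind => [|c u v hu hv|m n]; first by rewrite !linear0.
  by rewrite !linearP hu hv.
by rewrite tensor_bihomE !to_leftE tensor_mapE.
Qed.

Section RightExact.
Variables (k : fieldType) (C B A : algType k) (M : bimod C B) (X Y Z : bimod B A).
Variables (d : bihom X Y) (e : bihom Y Z).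
Hypothesis e_surj : forall z, exists y, e y = z.
Hypothesis de : forall y, e y = 0 <-> exists x, d x = y.

Lemma tensor_bihom_surj t : exists u, tensor_bihom M e u = t.
Proof.
move: t; apply: tensor_ind => [|c _ _ [u <-] [v <-]|m z]; first by exists 0; rewrite linear0.
  by exists (c *: u + v); rewrite linearP.
by have [y <-] := e_surj z; exists (pure m y); rewrite tensor_bihomE.
Qed.

Lemma tensor_bihom_comp0 t : tensor_bihom M e (tensor_bihom M d t) = 0.
Proof.
move: t; apply: tensor_ind => [|c u v hu hv|m x]; first by rewrite !linear0.
  by rewrite !linearP hu hv scaler0 addr0.
by rewrite !tensor_bihomE (de _).2 ?pure0r //; exists x.
Qed.

(* m (x) z |-> m (x) y with e y = z is a well-defined inverse to the map induced by
   M (x) e on the cokernel of M (x) d. *)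
Lemma tensor_right_exact t : tensor_bihom M e t = 0 <-> exists u, tensor_bihom M d u = t.
Proof.
split=> [|[u <-]]; last exact: tensor_bihom_comp0.
pose W : {pred tensor M Y} := fun t => `[< exists u, tensor_bihom M d u = t >].
have subW : submod_closed W.
  split; first by apply/asboolP; exists 0; rewrite linear0.
  move=> c u v /asboolP[a <-] /asboolP[b <-]; apply/asboolP.
  by exists (c *: a + b); rewrite linearP.
have /choice[s sE] := e_surj.
have same (m : M) y y' : e y = e y' -> qpi subW (pure m y) = qpi subW (pure m y').
  move=> yy'; apply/qpi_eq/asboolP.
  have /de[x dx] : e (y - y') = 0 by rewrite linearB yy' subrr.
  by exists (pure m x); rewrite tensor_bihomE dx pureBr.
have fl z : linear (fun m : M => qpi subW (pure m (s z))).
  by move=> c u v; rewrite pure_linl; apply: qpiL.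
have fr (m : M) : linear (fun z => qpi subW (pure m (s z))).
  move=> c u v; rewrite -[RHS](qpiL subW) -pure_linr; apply: same.
  by rewrite linearP !sE.
have fb (m : M) b z : qpi subW (pure (ract m b) (s z)) = qpi subW (pure m (s (lact b z))).
  by rewrite pure_bal; apply: same; rewrite bihom_l !sE.
have E u : tensor_lift fl fr fb (tensor_bihom M e u) = qpi subW u.
  have l1 : linear (fun u => tensor_lift fl fr fb (tensor_bihom M e u)).
    by move=> c a b; rewrite !linearP.
  move: u; apply: (tensorP l1 (@qpiL _ _ _ subW)) => m y.
  by rewrite tensor_bihomE tensor_liftE; apply: same; rewrite sE.
move=> et; have := E t; rewrite et linear0 => /esym/qpi_eq0/asboolP.
exact.
Qed.
End RightExact.

(** * Vanishing of Tor for projective modules, and complexes that resolve a bimodule *)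

Section TorProjective.
Variables (k : fieldType) (C B : algType k) (M : bimod C B) (L : bimod B k^o).
Hypothesis projL : projective L.

Definition triv_obj n : bimod B k^o := if n is 0 then L else zero_bimod B k^o.
Fact triv_proj n : projective (triv_obj n).
Proof. by case: n => [|n] //=; apply: zero_projective => z; apply: zero_lmod_eq. Qed.
Fact triv_exact0 x : biid L x = 0 <-> exists z : triv_obj 1, (0 : bihom _ L) z = x.
Proof. by split=> [x0|[z <-]] //; exists 0; rewrite -[RHS]/(biid L x) x0. Qed.
Fact triv_exactS n (x : triv_obj n.+1) :
  (0 : bihom _ (triv_obj n)) x = 0 <->
  exists z : triv_obj n.+2, (0 : bihom _ (triv_obj n.+1)) z = x.
Proof. by split=> // _; exists 0; apply: zero_lmod_eq. Qed.
Definition triv_resolution : proj_resolution L :=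
  @ProjResolution _ _ _ L triv_obj (fun n => 0) (biid L) triv_proj
    (fun y => ex_intro _ y erefl) triv_exact0 triv_exactS.

(** The identity of R is homotopic to a map that factors through the resolution of L concentrated in
    degree 0. So the homotopy contracts R in positive degrees, and it survives tensoring with M. *)
Lemma tor_projective (R : proj_resolution L) n (t : tensor M (R n.+1)) :
  tensor_map M (pres_d R n) t = 0 -> exists u, tensor_map M (pres_d R n.+1) u = t.
Proof.
have [h hP] := resolution_map_exists R triv_resolution.
have [h' h'P] := resolution_map_exists triv_resolution R.
have [s [_ sS]] := resolution_map_homotopy (resolution_map_id R) (resolution_map_comp hP h'P).
have E p : p = pres_d R n.+1 (s n.+1 p) + s n (pres_d R n p).
  have h0 : h n.+1 p = 0 by apply: zero_lmod_eq.
  by rewrite -sS bicompE h0 linear0 subr0.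
have F (u : tensor M (R n.+1)) : u = tensor_map M (pres_d R n.+1) (tensor_map M (s n.+1) u)
    + tensor_map M (s n) (tensor_map M (pres_d R n) u).
  move: u; apply: tensor_ind => [|c u v hu hv|m p]; first by rewrite !linear0 addr0.
    by rewrite !linearP [LHS](congr2 (fun x y => c *: x + y) hu hv) scalerDr addrACA.
  by rewrite !tensor_mapE -pureDr -E.
by move=> dt; exists (tensor_map M (s n.+1) t); rewrite [RHS]F dt linear0 addr0.
Qed.
End TorProjective.

(** Projectivity is asked on the right only: this is what the bar construction requires of Y and
    what M (x)_B P provides when P is a projective bimodule. *)
Record resolves (k : fieldType) (C A : algType k) (Y : chain_complex C A) (N : bimod C A)
    (aug : bihom (Y 0%N) N) : Prop := Resolves {
  res_dd : forall n y, cxd Y n (cxd Y n.+1 y) = 0;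
  res_surj : forall y, exists x, aug x = y;
  res_exact0 : forall x, aug x = 0 <-> exists z, cxd Y 0%N z = x;
  res_exactS : forall n x, cxd Y n x = 0 -> exists z, cxd Y n.+1 z = x;
  res_proj : forall n, projective (right_of_bimod (Y n)) }.

Definition bar_of_resolves (k : fieldType) (C A : algType k) (Y : chain_complex C A)
    (N : bimod C A) (aug : bihom (Y 0%N) N) (res : resolves aug) : proj_resolution N :=
  bar_resolution (res_dd res) (res_surj res) (res_exact0 res) (res_exactS res) (res_proj res).

Lemma resolves_iso (k : fieldType) (C A : algType k) (Y : chain_complex C A) (N N' : bimod C A)
    (aug : bihom (Y 0%N) N) (e : bihom N N') :
  resolves aug -> (forall x, e x = 0 -> x = 0) -> (forall y, exists x, e x = y) ->
  resolves (bicomp e aug).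
Proof.
case=> dd surj ex0 exS proj e_inj e_surj; split=> // [y|x].
  by have [x <-] := e_surj y; have [z <-] := surj x; exists z.
rewrite bicompE -ex0; split=> [/e_inj//|->]; exact: linear0.
Qed.

Section TensorBar.
Variables (k : fieldType) (C B A : algType k) (M : bimod C B).

Definition tensor_complex (P : chain_complex B A) : chain_complex C A :=
  @ChainComplex _ _ _ (fun n => tensor M (P n)) (fun n => tensor_bihom M (cxd P n)).

Variables (Y : chain_complex B A) (N : bimod B A) (aug : bihom (Y 0%N) N).
Hypothesis res : resolves aug.
Hypothesis tor0 : forall (R : proj_resolution (left_of_bimod N)) n (t : tensor M (R n.+1)),
  tensor_map M (pres_d R n) t = 0 -> exists u, tensor_map M (pres_d R n.+1) u = t.

(** Degree 0 is right exactness. In positive degrees [tor0] is applied to the bar complex as a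
    resolution of the left module N; as [Tor] is defined on left modules, cycles pass through
    [to_left] and come back by [of_left]. *)
Lemma tensor_bar_resolves :
  @resolves _ _ _ (tensor_complex (bar Y)) (tensor M N) (tensor_bihom M (bar_pres_aug aug)).
Proof.
have [dd surj ex0 exS proj] := res.
split.
- move=> n; apply: tensor_bihom_comp0 => y; exact: (bar_exactS dd exS).
- by apply: tensor_bihom_surj; apply: bar_pres_aug_surj.
- apply: tensor_right_exact; first exact: bar_pres_aug_surj.
  exact: (bar_exact0 ex0).
- move=> n t dt; pose R := left_bar_resolution dd surj ex0 exS.
  have [|u uE] := tor0 (R := R) (n := n) (t := to_left M _ t).
    by rewrite -[LHS](to_left_map (cxd (bar Y) n)) dt linear0.
  exists (of_left M _ u); apply: (can_inj (@to_leftK _ _ _ _ M _)).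
  rewrite (to_left_map (cxd (bar Y) n.+1)) of_leftK.
  exact: uE.
- by move=> n; apply/tensor_projective_right/freeb_projective/cone_projective.
Qed.
End TensorBar.

(** * The Hochschild differential on generators *)

Section Components.
Variables (k : fieldType) (Q : quiver) (HQ : simply_laced Q) (D : qset k Q).
Local Notation L := (Lambda D).

Lemma bcast_lact (C A : algType k) (M N : bimod C A) (e : M = N) c m :
  bcast e (lact c m) = lact c (bcast e m).
Proof. by case: _ / e. Qed.
Lemma bcast_ract (C A : algType k) (M N : bimod C A) (e : M = N) m a :
  bcast e (ract m a) = ract (bcast e m) a.
Proof. by case: _ / e. Qed.
Lemma bcastK (C A : algType k) (M N : bimod C A) (e : M = N) m :
  bcast (esym e) (bcast e m) = m.
Proof. by case: _ / e. Qed.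
Lemma bcastKV (C A : algType k) (M N : bimod C A) (e : M = N) n :
  bcast e (bcast (esym e) n) = n.
Proof. by case: _ / e n. Qed.

Lemma qmul_diagl (z x : Q0 Q) (u : qblock D z z) (v : qblock D z x) :
  qmul u v = lact (alg_of_diag u) v.
Proof. by rewrite /qmul /qmul_of; case: eqP => // e; rewrite eq_axiomK. Qed.
Lemma alg_of_diag_inj x : injective (@alg_of_diag _ _ D x).
Proof.
move=> u v E; rewrite -(bcastK (qblock_diag D x) u) -(bcastK (qblock_diag D x) v).
by congr bcast.
Qed.
(** [qmul_of] tests z = y before y = x, so for z = x the product is coded as a left action. The two
    readings agree because the block is then the algebra itself. *)
Lemma qmul_diagr (z x : Q0 Q) (u : qblock D z x) (v : qblock D x x) :
  qmul u v = ract u (alg_of_diag v).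
Proof.
have [zx|zx] := pselect (z = x).
  subst z; rewrite qmul_diagl; apply: alg_of_diag_inj.
  by rewrite /alg_of_diag bcast_lact bcast_ract.
rewrite /qmul /qmul_of; case: eqP => // nzx.
by case: eqP => // e; rewrite eq_axiomK.
Qed.

Definition diag_comp (v : Q0 Q) (X : L) : qalg D v := alg_of_diag (X (v, v)).
Definition arrow_comp (a : Q1 Q) (X : L) : qmod D a :=
  bcast (qblock_arr D a HQ) (X (qtgt a, qsrc a)).

Lemma diag_comp_lin v : linear (diag_comp v).
Proof. by move=> c X X'; rewrite /diag_comp /alg_of_diag dprodDE dprodZE bcast_lin. Qed.
Lemma arrow_comp_lin a : linear (arrow_comp a).
Proof. by move=> c X X'; rewrite /arrow_comp dprodDE dprodZE bcast_lin. Qed.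

(* The part of the product of Lambda that only involves the products of the algebras
   and the bimodule structures. *)
Definition Lmul0 (f g : L) : L := fun p =>
  (qmul (f (p.1, p.1)) (g (p.1, p.2)) : qblock D p.1 p.2)
  + (if p.1 == p.2 then 0 else qmul (f (p.1, p.2)) (g (p.2, p.2)) : qblock D p.1 p.2).

Lemma diag_comp_mul v f g : diag_comp v (Lmul0 f g) = diag_comp v f * diag_comp v g.
Proof.
rewrite /diag_comp /Lmul0 /= eqxx addr0 qmul_diagl.
exact: (bcast_lact (qblock_diag D v)).
Qed.
(** The full product of Lambda may have further contributions to the component at a, namely products
    of two arrows through a third vertex. [Lmul0] leaves them out. *)
Lemma arrow_comp_mul a f g : arrow_comp a (Lmul0 f g) =
  lact (diag_comp (qtgt a) f) (arrow_comp a g) + ract (arrow_comp a f) (diag_comp (qsrc a) g).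
Proof.
have [noloop _] := HQ; have na : qtgt a <> qsrc a by move=> /esym/noloop.
rewrite /arrow_comp /Lmul0 /=; case: eqP => // _.
rewrite qmul_diagl qmul_diagr -bcast_lact -bcast_ract.
exact: (linearD (mklin (bcast_lin (qblock_arr D a HQ)))).
Qed.
End Components.

Section MergeSum.
Variables (k : fieldType) (C A : algType k) (T : Type) (mu : T -> T -> T) (e : T -> A).

(* phi (x_0 x_1, x_2, ...) - phi (x_0, x_1 x_2, ...) + ... +- phi (x_0, ..., x_(n-1)) x_n *)
Fixpoint merge_sum (V : bimod C A) (phi : seq T -> V) (X : seq T) {struct X} : V :=
  match X with
  | [::] => 0
  | x :: X' =>
    match X' with
    | [::] => ract (phi [::]) (e x)
    | x1 :: X'' => phi (mu x x1 :: X'') - merge_sum (fun Z => phi (x :: Z)) X'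
    end
  end.

Lemma merge_sum_cons (V : bimod C A) (phi : seq T -> V) x x1 X :
  merge_sum phi (x :: x1 :: X) = phi (mu x x1 :: X) - merge_sum (fun Z => phi (x :: Z)) (x1 :: X).
Proof. by []. Qed.

Lemma merge_sum0 (V : bimod C A) (phi : seq T -> V) X :
  (forall Z, phi Z = 0) -> merge_sum phi X = 0.
Proof.
elim: X phi => [|x [|x1 X] IH] phi E; [by [] | by rewrite /= E ract0l | ].
by rewrite merge_sum_cons E sub0r (IH (fun Z => phi (x :: Z))) ?oppr0.
Qed.
End MergeSum.

Section MergeSumMorphism.
Variables (k : fieldType) (A : algType k) (T : Type) (mu : T -> T -> T) (e : T -> A).

Lemma merge_sum_map (C C' : algType k) (V : bimod C A) (V' : bimod C' A) (f : V -> V')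
    (phi : seq T -> V) X :
  linear f -> (forall v a, f (ract v a) = ract (f v) a) ->
  f (merge_sum mu e phi X) = merge_sum mu e (fun Z => f (phi Z)) X.
Proof.
move=> f_lin f_r; have F0 := linear0 (mklin f_lin); have FB := linearB (mklin f_lin).
elim: X phi => [|x [|x1 X] IH] phi; [exact: F0 | exact: f_r | ].
by rewrite !merge_sum_cons [LHS]FB; congr (_ - _); apply: (IH (fun Z => phi (x :: Z))).
Qed.
End MergeSumMorphism.

Section BarGenerators.
Variables (k : fieldType) (C A : algType k) (T : Type) (mu : T -> T -> T).
Variables (cC : T -> C) (cA : T -> A).
Hypothesis cC_mul : forall x y, cC (mu x y) = cC x * cC y.
Variables (Y : chain_complex C A) (g : forall n, seq T -> Y n).

(** The first letter is read in C, and the rest is sent to both summands of the cone at once. On a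
    word of homogeneous letters at most one of the two will be nonzero. *)
Fixpoint shift_word n : seq T -> bar_shift Y n :=
  match n with
  | 0 => fun=> 0
  | n'.+1 => fun X => if X is x :: X' then bgen (cC x) (g n' X') (shift_word n' X') else 0
  end.

Lemma shift_wordS n x X :
  shift_word n.+1 (x :: X) = bgen (cC x) (g n X) (shift_word n X).
Proof. by []. Qed.

Definition bar_word (c : C) n (X : seq T) : bar Y n := bgen c (g n X) (shift_word n X).

Lemma bgen_lin n c : linear (fun u : Y n * bar_shift Y n => bgen c u.1 u.2).
Proof. by move=> a [u1 u2] [v1 v2]; exact (@fpure_linr k C A (cone Y n) c a (u1, u2) (v1, v2)). Qed.
Lemma bgen_ract n c (y : Y n) t a : ract (bgen c y t) a = bgen c (ract y a) (ract t a).
Proof. exact: fpure_ract. Qed.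

Lemma merge_sum_bgen n c (phi : seq T -> Y n) (psi : seq T -> bar_shift Y n) X :
  merge_sum mu cA (fun Z => bgen c (phi Z) (psi Z)) X =
  bgen c (merge_sum mu cA phi X) (merge_sum mu cA psi X).
Proof.
elim: X phi psi => [|x [|x1 X] IH] phi psi.
- by rewrite [RHS]bgen0.
- by rewrite [LHS]bgen_ract.
rewrite !merge_sum_cons (IH (fun Z => phi (x :: Z)) (fun Z => psi (x :: Z))).
exact: esym (linearB (mklin (bgen_lin c)) (_, _) (_, _)).
Qed.

Hypothesis g_nil : forall n, g n.+1 [::] = 0.
Hypothesis g_d : forall n x X,
  cxd Y n (g n.+1 (x :: X)) + lact (cC x) (g n X) = merge_sum mu cA (g n) (x :: X).

(** The action term of [bar_shift_dE] multiplies the two leading letters, which is the first term of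
    [merge_sum]. By [g_d] and induction the two components of the cone give the merge sum from the
    second letter on. *)
Lemma shift_word_d n x X :
  bar_shift_d Y n (shift_word n.+1 (x :: X)) = merge_sum mu cA (shift_word n) (x :: X).
Proof.
elim: n x X => [|n IHn] x X; first by rewrite [LHS]bar_shift0 [RHS]bar_shift0.
rewrite shift_wordS bar_shift_dE; case: X => [|x1 X].
  by rewrite g_nil !linear0 addr0 lactr0 bgen0 subrr [RHS]ract0l.
rewrite merge_sum_cons {1}shift_wordS bgen_lact -cC_mul -shift_wordS; congr (_ - _).
rewrite IHn shift_wordS bar_augE g_d -merge_sum_bgen.
by [].
Qed.

Lemma bar_word_d n c x X : cxd (bar Y) n (bar_word c n.+1 (x :: X)) =
  lact c (shift_word n.+1 (x :: X)) - merge_sum mu cA (bar_word c n) (x :: X).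
Proof.
by rewrite [LHS]bar_shift_dE shift_word_d shift_wordS bar_augE g_d -merge_sum_bgen.
Qed.
Lemma bar_word_d_nil n c : cxd (bar Y) n (bar_word c n.+1 [::]) = 0.
Proof. by rewrite [LHS]bar_shift_dE g_nil !linear0 addr0 lactr0 bgen0 subrr. Qed.
End BarGenerators.

Section TensorGenerators.
Variables (k : fieldType) (C B A : algType k) (M : bimod C B) (T : Type) (mu : T -> T -> T).
Variables (cC : T -> C) (cB : T -> B) (cA : T -> A) (cM : T -> M).
Hypothesis cB_mul : forall x y, cB (mu x y) = cB x * cB y.
Hypothesis cM_mul : forall x y, cM (mu x y) = lact (cC x) (cM y) + ract (cM x) (cB y).
Variables (Y : chain_complex B A) (g : forall n, seq T -> Y n).
Hypothesis g_nil : forall n, g n.+1 [::] = 0.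
Hypothesis g_d : forall n x X,
  cxd Y n (g n.+1 (x :: X)) + lact (cB x) (g n X) = merge_sum mu cA (g n) (x :: X).

Definition tensor_word n (X : seq T) : tensor_complex M (bar Y) n :=
  if X is x :: X' then pure (cM x) (bar_word cB g 1 n X') else 0.

Lemma tensor_wordS n x X :
  tensor_word n (x :: X) = pure (cM x) (bar_word cB g 1 n X).
Proof. by []. Qed.

(** This restores [g_d] for M (x) T(Y), so that it propagates along a path. Of the two terms of
    [cM_mul], the left action gives the action term and the right action, moved across the tensor
    product, gives the first face of T(Y). *)
Lemma tensor_word_d n x X :
  cxd (tensor_complex M (bar Y)) n (tensor_word n.+1 (x :: X)) + lact (cC x) (tensor_word n X)
  = merge_sum mu cA (tensor_word n) (x :: X).
Proof.
rewrite tensor_wordS [cxd _ _ _]tensor_bihomE; case: X => [|x1 X].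
  by rewrite bar_word_d_nil // pure0r add0r [LHS]lactr0 [RHS]ract0l.
rewrite (bar_word_d cB_mul g_nil g_d) lact1 pureBr merge_sum_cons !tensor_wordS.
rewrite [lact _ _]tensor_lactE cM_mul pureDl.
rewrite (_ : shift_word _ _ _ _ = lact (cB x1) (bar_word cB g 1 n X)); last first.
  by rewrite [RHS]bgen_lact mulr1.
rewrite -pure_bal [LHS]addrC addrA; congr (_ - _).
apply: (merge_sum_map _ _ (f := fun u : bar Y n => pure (cM x) u : tensor M (bar Y n))).
  exact: pure_linr.
by move=> v a; rewrite [RHS]tensor_ractE.
Qed.
End TensorGenerators.

Section RegularComplex.
Variables (k : fieldType) (A : algType k).

Definition reg_obj n : bimod A A := if n is 0 then reg_bimod A else zero_bimod A A.
Definition reg_complex : chain_complex A A := @ChainComplex _ _ _ reg_obj (fun n => 0).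

Lemma reg_resolves : @resolves _ _ _ reg_complex (reg_bimod A) (biid _).
Proof.
split=> //.
- by move=> y; exists y.
- move=> x; split=> [x0|[z <-]] //; exists 0; rewrite -[RHS]/(biid (reg_bimod A) x) x0 //.
- by move=> n x _; exists 0; apply: zero_lmod_eq.
- case=> [|n]; first exact: reg_projective_right.
  by apply: zero_projective => z; apply: zero_lmod_eq.
Qed.

Variables (T : Type) (mu : T -> T -> T) (cA : T -> A).
(** The factor A that remains to the right of all letters is the right coefficient. It is normalized
    to 1 on the empty word. *)
Definition reg_word n (X : seq T) : reg_complex n :=
  match n with
  | 0 => if X is [::] then (1 : A) else (0 : A)
  | _.+1 => 0
  end.
(** The base case of [g_d]: on a single letter a it says a 1 = 1 a. *)
Lemma reg_word_d n x X : cxd reg_complex n (reg_word n.+1 (x :: X)) + lact (cA x) (reg_word n X)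
  = merge_sum mu cA (reg_word n) (x :: X).
Proof.
case: n => [|n]; last exact: zero_lmod_eq.
rewrite [cxd _ _ _]linear0 add0r; case: X => [|x1 X].
  exact: (etrans (mulr1 _) (esym (mul1r _))).
rewrite [LHS]lactr0 merge_sum_cons (merge_sum0 _ _ _ (phi := fun Z => reg_word 0 (x :: Z))) //.
by rewrite subr0.
Qed.
End RegularComplex.

(** * Universal property of the generators *)

Section WordBasis.
Variables (k : fieldType) (Q : quiver) (D : qset k Q).
Local Notation L := (Lambda D).
Local Notation ends := (Q0 Q * Q0 Q)%type.

Definition letter : Type := {p : ends & qblock D p.1 p.2}.
Definition mkletter (p : ends) (v : qblock D p.1 p.2) : letter := existT _ p v.
Definition linj (h : letter) : L := @Linj k Q D (tag h) (tagged h).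
Definition linjs : seq letter -> seq L := map linj.
Definition word_ends : seq letter -> seq ends := map (fun h => tag h).

Lemma linj_in p v : linj (@mkletter p v) p = v.
Proof. exact: dfwith_in. Qed.
Lemma linj_out (h : letter) p : tag h != p -> linj h p = 0.
Proof. by move=> hp; rewrite /linj /Linj dfwith_out. Qed.
Lemma mkletterK (h : letter) p : tag h = p -> mkletter (linj h p) = h.
Proof. by case: h => q v /= <-; rewrite /mkletter -/(mkletter v) linj_in. Qed.

Definition word_multilinear (V : lmodType k) (E : seq letter -> V) : Prop :=
  forall hs1 (p : ends) hs2, linear (fun v : qblock D p.1 p.2 => E (hs1 ++ mkletter v :: hs2)).

(* Z is the free right A-module on the words with ends in W, taken multilinearly. *)
Record word_basis (A : algType k) (Z : bimod k^o A) (g : seq L -> Z) (W : pred (seq ends)) :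
    Prop := WordBasis {
  wb_supp : forall hs, ~~ W (word_ends hs) -> g (linjs hs) = 0;
  wb_uniq : forall (N : bimod k^o A) (f : bihom Z N),
    (forall hs, f (g (linjs hs)) = 0) -> forall z, f z = 0;
  wb_exist : forall (N : bimod k^o A) (E : seq letter -> N), word_multilinear E ->
    (forall hs, ~~ W (word_ends hs) -> E hs = 0) ->
    exists f : bihom Z N, forall hs, f (g (linjs hs)) = E hs }.

Definition cons_pred (d : ends) (W : pred (seq ends)) : pred (seq ends) :=
  fun e => if e is d' :: e' then (d' == d) && W e' else false.

Section Basic.
Variable A : algType k.

Lemma word_basis_zero (Z : bimod k^o A) (g : seq L -> Z) :
  (forall z : Z, z = 0) -> word_basis g pred0.
Proof.
move=> Z0; split=> [hs _|N f _ z|N E _ E0]; first exact: Z0.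
  by rewrite [z]Z0 linear0.
by exists 0 => hs; rewrite E0.
Qed.

Lemma word_basis_reg :
  @word_basis A (right_of_bimod (reg_bimod A)) (fun X => if X is [::] then (1 : A) else (0 : A))
    (fun e => e == [::]).
Proof.
split=> [[|h hs] //|N f f0 a|N E _ E0].
  by rewrite -[a]mul1r -[1 * a]/(ract (1 : right_of_bimod (reg_bimod A)) a) bihom_r
    (f0 [::]) ract0l.
have @f : bihom (right_of_bimod (reg_bimod A)) N.
  apply: (@mkbihom _ _ _ (right_of_bimod (reg_bimod A)) N (fun a : A => ract (E [::]) a)).
  - exact: ract_linr.
  - by move=> c a; rewrite !lact_scalar; apply: ractZr.
  - by move=> a b; apply: ractM.
exists f => -[|h hs]; first exact: ract1.
by rewrite E0 //; apply: ractr0.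
Qed.

(** Disjoint supports let one family of words serve both summands: on a word of W1 the component g2
    vanishes, so the value on the pair is the value on the first summand. *)
Lemma word_basis_dsum (Z1 Z2 : bimod k^o A) (g1 : seq L -> Z1) (g2 : seq L -> Z2)
    (W1 W2 : pred (seq ends)) :
  (forall e, W1 e -> ~~ W2 e) -> word_basis g1 W1 -> word_basis g2 W2 ->
  word_basis (Z := dsum Z1 Z2) (fun X => (g1 X, g2 X)) (fun e => W1 e || W2 e).
Proof.
move=> W12 [supp1 uniq1 ex1] [supp2 uniq2 ex2]; split.
- by move=> hs; rewrite negb_or => /andP[/supp1-> /supp2->].
- move=> N f f0 z; rewrite [z]dsum_split linearD.
  have -> : f (dsum_inl Z1 Z2 z.1) = 0.
    apply: (uniq1 N (bicomp f (dsum_inl Z1 Z2))) => hs; rewrite bicompE.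
    have [w1|/supp1->] := boolP (W1 (word_ends hs)); last by rewrite !linear0.
    by rewrite -[RHS](f0 hs) (supp2 _ (W12 _ w1)).
  rewrite add0r; apply: (uniq2 N (bicomp f (dsum_inr Z1 Z2))) => hs; rewrite bicompE.
  have [w2|/supp2->] := boolP (W2 (word_ends hs)); last by rewrite !linear0.
  rewrite -[RHS](f0 hs) (supp1 _) //.
  by apply/negP => /W12; rewrite w2.
move=> N E mE E0.
pose restr (W : pred (seq ends)) hs := if W (word_ends hs) then E hs else 0.
have mr W : word_multilinear (restr W).
  move=> hs1 p hs2 c u v; rewrite /restr /word_ends !map_cat /=.
  by case: ifP => _; [apply: mE | rewrite scaler0 addr0].
have sr W hs : ~~ W (word_ends hs) -> restr W hs = 0 by rewrite /restr => /negbTE->.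
have [f1 f1P] := ex1 N _ (mr W1) (sr W1).
have [f2 f2P] := ex2 N _ (mr W2) (sr W2).
exists (bicomp f1 (dsum_fst Z1 Z2) + bicomp f2 (dsum_snd Z1 Z2)) => hs.
rewrite bihomDE !bicompE f1P f2P /restr.
have [w1|nw1] := boolP (W1 _); first by rewrite (negbTE (W12 _ w1)) addr0.
have [//|nw2] := boolP (W2 _); first by rewrite add0r.
by rewrite addr0 E0 // negb_or nw1.
Qed.

Lemma word_basis_iso (Z Z' : bimod k^o A) (g : seq L -> Z) W (phi : bihom Z Z')
    (psi : bihom Z' Z) : cancel phi psi -> cancel psi phi -> word_basis g W ->
  word_basis (fun X => phi (g X)) W.
Proof.
move=> phiK psiK [supp uniq ex]; split=> [hs /supp->|N f f0 z|N E mE E0]; first exact: linear0.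
  by rewrite -[z]psiK -bicompE; apply: uniq.
have [f fP] := ex N E mE E0; exists (bicomp f psi) => hs.
by rewrite bicompE phiK.
Qed.
End Basic.

Section Tensor.
Variables (p : ends) (M : bimod (qalg D p.1) (qalg D p.2)) (eM : qblock D p.1 p.2 = M).
Variables (A : algType k) (Z : bimod k^o A) (g : seq L -> Z) (W : pred (seq ends)).
Hypothesis basisZ : word_basis g W.

Definition block_comp (X : L) : M := bcast eM (X p).
Definition block_letter (m : M) : letter := mkletter (bcast (esym eM) m).

Lemma block_letterK m : block_comp (linj (block_letter m)) = m.
Proof. by rewrite /block_comp linj_in bcastKV. Qed.
Lemma block_compK (h : letter) : tag h = p -> block_letter (block_comp (linj h)) = h.
Proof. by move=> hp; rewrite /block_letter bcastK mkletterK. Qed.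
Lemma block_comp_out (h : letter) : tag h != p -> block_comp (linj h) = 0.
Proof. by move=> hp; rewrite /block_comp linj_out //; apply: (linear0 (mklin (bcast_lin eM))). Qed.

Definition ktensor_word (X : seq L) : tensor (left_of_bimod M) Z :=
  if X is x :: X' then pure (block_comp x : left_of_bimod M) (g X') else 0.

(** Each value m of the first letter turns E into data on Z, hence into a map f m. Uniqueness over Z
    makes f m linear in m, so these maps glue on M (x)_k Z. *)
Lemma word_basis_tensor :
  word_basis (Z := right_of_bimod (tensor (left_of_bimod M) Z)) ktensor_word (cons_pred p W).
Proof.
have [supp uniq ex] := basisZ.
have blin (V : lmodType k) (E : seq letter -> V) hs : word_multilinear E ->
    linear (fun m => E (block_letter m :: hs)).
  move=> mE c u v; have := mE [::] p hs c (bcast (esym eM) u) (bcast (esym eM) v).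
  by rewrite /= -(bcast_lin (esym eM)).
split.
- case=> [|h hs] //=; rewrite negb_and => /orP[/block_comp_out->|/supp->].
    exact: (@pure0l _ _ _ _ (left_of_bimod M) Z).
  exact: (@pure0r _ _ _ _ (left_of_bimod M) Z).
- move=> N f f0; apply: tensor_ind => [|c u v hu hv|m z]; first exact: linear0.
    by rewrite linearP hu hv scaler0 addr0.
  have fm_lin : linear (fun z : Z => f (pure (m : left_of_bimod M) z)).
    by move=> c u v; rewrite pure_linr; apply: linearP.
  have @fm : bihom Z N.
    apply: (mkbihom fm_lin) => [c x|x a]; last first.
      by rewrite -[pure m (ract x a)]tensor_ractE bihom_r.
    by rewrite !lact_scalar pureZr; apply: linearZ_LR.
  apply: (uniq N fm) => hs; rewrite -[RHS](f0 (block_letter m :: hs)).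
  by rewrite /= block_letterK.
move=> N E mE E0.
have mEm (m : M) : word_multilinear (fun hs => E (block_letter m :: hs)).
  by move=> hs1 q hs2; apply: (mE (block_letter m :: hs1)).
have [|f fP] := choice (fun m : M => ex N _ (mEm m) _).
  by move=> m hs w; apply: E0; rewrite /= eqxx.
have f_lin z : linear (fun m : left_of_bimod M => f m z).
  move=> c m m'; apply/eqP; rewrite -subr_eq0; apply/eqP.
  apply: (uniq N (f (c *: m + m') - (c *: f m + f m'))) => hs.
  by rewrite bihomBE bihomDE bihomZE !fP blin ?subrr.
have f_linr (m : left_of_bimod M) : linear (f m) by exact: bihom_lin.
have f_bal (m : left_of_bimod M) (b : k^o) z : f (ract m b) z = f m (lact b z).
  rewrite lact_scalar ract_scalar linearZ_LR /=.
  exact: (linearZ_LR (mklin (f_lin z))).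
have @F : bihom (right_of_bimod (tensor (left_of_bimod M) Z)) N.
  apply: (@mkbihom _ _ _ (right_of_bimod (tensor (left_of_bimod M) Z)) N
    (tensor_lift f_lin f_linr f_bal)).
  - exact: linearP.
  - by move=> c t; rewrite !lact_scalar; apply: linearZ_LR.
  - move=> t a; move: t; apply: tensor_ind => [|c u v hu hv|m z].
    + by rewrite ract0l linear0 ract0l.
    + by rewrite ract_linl !linearP hu hv ract_linl.
    + by rewrite tensor_ractE !tensor_liftE bihom_r.
exists F => -[|h hs]; first by rewrite E0 //; apply: linear0.
rewrite -[F _]/(tensor_lift f_lin f_linr f_bal (pure _ _)) tensor_liftE fP.
have [hp|hp] := eqVneq (tag h) p; first by rewrite block_compK.
rewrite block_comp_out // [LHS](linear0 (mklin (blin _ E hs mE))) E0 //=.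
by rewrite (negbTE hp).
Qed.
End Tensor.

End WordBasis.

Section TensorFree.
Variables (k : fieldType) (C B A : algType k) (M : bimod C B) (Z : bimod k^o A).
Local Notation MZ := (right_of_bimod (tensor (left_of_bimod M) Z)).
Local Notation MBZ := (right_of_bimod (tensor M (freeb B Z))).
Local Notation pureMBZ := (@pure k C B A M (freeb B Z)).

(** The inverse is m (x) (b (x) z) |-> m b (x) z. The coefficient in B is absorbed by M, so M (x)_B
    - puts one letter of M in front of the words of Z. *)
Lemma tensor_free_iso : exists (phi : bihom MZ MBZ) (psi : bihom MBZ MZ),
  [/\ cancel phi psi, cancel psi phi & forall m z, phi (pure m z) = pureMBZ m (fpure 1 z)].
Proof.
have p1 z : linear (fun m : left_of_bimod M => pureMBZ m (fpure 1 z) : MBZ).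
  exact (@pure_linl k C B A M (freeb B Z) (fpure 1 z)).
have p2 (m : left_of_bimod M) : linear (fun z => pureMBZ m (fpure 1 z) : MBZ).
  by move=> c u v; rewrite fpure_linr pure_linr.
have p3 (m : left_of_bimod M) (b : k^o) z :
    pureMBZ (ract m b) (fpure 1 z) = pureMBZ m (fpure 1 (lact b z)) :> MBZ.
  by rewrite ract_scalar lact_scalar (@pureZl _ _ _ _ M) -pureZr fpureZr.
have @phi : bihom MZ MBZ.
  apply: (@mkbihom _ _ _ MZ MBZ (tensor_lift p1 p2 p3)).
  - exact: linearP.
  - by move=> c t; rewrite !lact_scalar; apply: linearZ_LR.
  - move=> t a; move: t; apply: tensor_ind => [|c u v hu hv|m z].
    + by rewrite ract0l linear0 ract0l.
    + by rewrite ract_linl !linearP hu hv ract_linl.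
    + by rewrite tensor_ractE !tensor_liftE [RHS]tensor_ractE fpure_ract.
pose pu : M -> Z -> MZ := @pure _ _ _ _ (left_of_bimod M) Z.
have i1 m z : linear (fun b : left_of_bimod (reg_bimod B) => pu (ract m (b : B)) z).
  by move=> c u v; rewrite ract_linr; apply: (@pure_linl _ _ _ _ (left_of_bimod M) Z).
have i2 m (b : left_of_bimod (reg_bimod B)) : linear (fun z => pu (ract m (b : B)) z).
  exact: pure_linr.
have i3 m (b : left_of_bimod (reg_bimod B)) (c : k^o) z :
    pu (ract m (ract b c : B)) z = pu (ract m (b : B)) (lact c z).
  rewrite lact_scalar ract_scalar [X in pu X]ractZr.
  by rewrite /pu (@pureZl _ _ _ _ (left_of_bimod M) Z) (@pureZr _ _ _ _ (left_of_bimod M) Z).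
pose G m : {linear freeb B Z -> MZ} := tensor_lift (i1 m) (i2 m) (i3 m).
have GE m b z : G m (fpure b z) = pu (ract m b) z by exact: tensor_liftE.
have q1 (t : freeb B Z) : linear (fun m => G m t).
  move=> c m m'; move: t; apply: freeb_ind => [|d u v hu hv|b z].
  - by rewrite !linear0 addr0.
  - by rewrite !linearP hu hv !scalerDr !scalerA addrACA.
  - by rewrite !GE ract_linl; apply: (@pure_linl _ _ _ _ (left_of_bimod M) Z).
have q2 m : linear (G m) by exact: linearP.
have q3 m b t : G (ract m b) t = G m (lact b t).
  move: t; apply: freeb_ind => [|d u v hu hv|b' z].
  - by rewrite lactr0 !linear0.
  - by rewrite lact_linr !linearP hu hv.
  - by rewrite fpure_lact !GE ractM.
have @psi : bihom MBZ MZ.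
  apply: (@mkbihom _ _ _ MBZ MZ (tensor_lift q1 q2 q3)).
  - exact: linearP.
  - by move=> c t; rewrite !lact_scalar; apply: linearZ_LR.
  - move=> t a; move: t; apply: tensor_ind => [|c u v hu hv|m t].
    + by rewrite ract0l linear0 ract0l.
    + by rewrite ract_linl !linearP hu hv ract_linl.
    rewrite tensor_ractE !tensor_liftE; move: t; apply: freeb_ind => [|c u v hu hv|b z].
    + by rewrite ract0l linear0 ract0l.
    + by rewrite ract_linl !linearP hu hv ract_linl.
    + by rewrite fpure_ract !GE [RHS]tensor_ractE.
have phiE m z : phi (pure m z) = pureMBZ m (fpure 1 z) by exact: tensor_liftE.
have psiE m t : psi (pure m t) = G m t by exact: tensor_liftE.
exists phi, psi; split => // t; move: t; apply: tensor_ind => [|c u v hu hv|m t].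
- by rewrite !linear0.
- by rewrite !linearP hu hv.
- by rewrite phiE psiE GE ract1.
- by rewrite !linear0.
- by rewrite !linearP hu hv.
rewrite psiE; move: t; apply: freeb_ind => [|c u v hu hv|b z].
- by rewrite !linear0 pure0r.
- by rewrite !linearP hu hv pure_linr.
by rewrite GE [LHS]phiE pure_bal fpure_lact mulr1.
Qed.
End TensorFree.

(** * The resolution along a path *)

Section MultilinearWords.
Variables (k : fieldType) (A : algType k) (T : lmodType k).

Definition seq_multilinear (V : lmodType k) (phi : seq T -> V) : Prop :=
  forall X1 X2, linear (fun v => phi (X1 ++ v :: X2)).

Lemma seq_multilinear0 (V : lmodType k) (phi : seq T -> V) X :
  seq_multilinear phi -> 0 \in X -> phi X = 0.
Proof.
move=> mphi /splitPr[X1 X2].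
exact: (linear0 (mklin (mphi X1 X2))).
Qed.

Section Bar.
Variables (C : algType k) (cC : T -> C) (Y : chain_complex C A) (g : forall n, seq T -> Y n).
Hypothesis cC_lin : linear cC.
Hypothesis g_lin : forall n, seq_multilinear (g n).

Lemma shift_word_multilinear n : seq_multilinear (shift_word cC g n).
Proof.
elim: n => [|n IHn] X1 X2 c u v; first exact: zero_lmod_eq.
case: X1 => [|x X1]; first by rewrite [LHS]/= cC_lin; apply: fpure_linl.
rewrite !cat_cons !shift_wordS g_lin IHn.
exact: (bgen_lin (cC x) c (_, _) (_, _)).
Qed.

Lemma bar_word_multilinear n c : seq_multilinear (bar_word cC g c n).
Proof.
move=> X1 X2 a u v; rewrite /bar_word g_lin shift_word_multilinear.
exact: (bgen_lin c a (_, _) (_, _)).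
Qed.
End Bar.

Lemma tensor_word_multilinear (C B : algType k) (M : bimod C B) (cB : T -> B) (cM : T -> M)
    (Y : chain_complex B A) (g : forall n, seq T -> Y n) n :
  linear cB -> linear cM -> (forall n, seq_multilinear (g n)) ->
  seq_multilinear (tensor_word cB cM g n).
Proof.
move=> cB_lin cM_lin g_lin [|x X1] X2 c u v.
  by rewrite !cat0s !tensor_wordS cM_lin; apply: pure_linl.
rewrite !cat_cons !tensor_wordS bar_word_multilinear //.
exact: pure_linr.
Qed.

Lemma reg_word_multilinear n : seq_multilinear (@reg_word k A T n).
Proof.
move=> X1 X2 c u v; case: n => [|n]; last exact: zero_lmod_eq.
by case: X1 => [|x X1]; rewrite /= scaler0 addr0.
Qed.
End MultilinearWords.

(** * The shapes of words, and the complex along a path with its generators *)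

Section WordPredicates.
Variable T : eqType.
Local Notation ends := (T * T)%type.

Fixpoint shift_pred (v : T) (W : nat -> pred (seq ends)) n : pred (seq ends) :=
  if n is n'.+1 then
    fun e => if e is d :: e' then (d == (v, v)) && (W n' e' || shift_pred v W n' e') else false
  else pred0.
Definition cone_pred v W n : pred (seq ends) := fun e => W n e || shift_pred v W n e.
Definition reg_pred n : pred (seq ends) := fun e => (n == 0%N) && (e == [::]).

(** Each letter at v stands for one bar factor and lowers the degree by one, until the word of W is
    reached. *)
Lemma cone_predP v W n e : cone_pred v W n e <->
  exists q n' e', [/\ n = (q + n')%N, e = nseq q (v, v) ++ e' & W n' e'].
Proof.
split.
  elim: n e => [|n IHn] e; first by rewrite /cone_pred orbF => We; exists 0%N, 0%N, e.
  case/orP=> [We|]; first by exists 0%N, n.+1, e.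
  by case: e => //= d e /andP[/eqP-> /IHn[q [n' [e' [-> -> We]]]]]; exists q.+1, n', e'.
case=> q [n' [e' [-> -> We]]]; elim: q => [|q IHq]; first by rewrite /cone_pred We.
apply/orP; right; rewrite /= eqxx.
exact: IHq.
Qed.
End WordPredicates.

Section PathComplex.
Variables (k : fieldType) (Q : quiver) (HQ : simply_laced Q) (D : qset k Q).
Local Notation L := (Lambda D).

(** The bar construction at the target is left out here: the terms are projective right modules, and
    a final [bar] makes them projective bimodules. *)
Fixpoint path_complex (x y : Q0 Q) (w : qpath x y) : chain_complex (qalg D y) (qalg D x) :=
  match w in qpath x' y' return chain_complex (qalg D y') (qalg D x') with
  | PathArr a => tensor_complex (qmod D a) (bar (reg_complex (qalg D (qsrc a))))
  | PathCons _ a w' => tensor_complex (qmod D a) (bar (path_complex w'))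
  end.

Fixpoint path_word (x y : Q0 Q) (w : qpath x y) : forall n, seq L -> path_complex w n :=
  match w in qpath x' y' return forall n, seq L -> path_complex w n with
  | PathArr a => tensor_word (@diag_comp _ _ D (qsrc a)) (arrow_comp HQ a)
      (@reg_word _ (qalg D (qsrc a)) L)
  | PathCons _ a w' => tensor_word (@diag_comp _ _ D (qsrc a)) (arrow_comp HQ a) (path_word w')
  end.

Lemma path_word_nil x y (w : qpath x y) n : path_word w n [::] = 0.
Proof. by case: w. Qed.

Lemma path_word_multilinear x y (w : qpath x y) n : seq_multilinear (path_word w n).
Proof.
elim: w n => [a|z a w IHw] n; apply: tensor_word_multilinear => //.
- exact: diag_comp_lin.
- exact: arrow_comp_lin.
- exact: reg_word_multilinear.
- exact: diag_comp_lin.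
- exact: arrow_comp_lin.
Qed.

Lemma path_word_d x y (w : qpath x y) n X0 X :
  cxd (path_complex w) n (path_word w n.+1 (X0 :: X)) + lact (diag_comp y X0) (path_word w n X)
  = merge_sum (@Lmul0 _ _ D) (@diag_comp _ _ D x) (path_word w n) (X0 :: X).
Proof.
elim: w n X0 X => [a|z a w IHw] n X0 X; apply: tensor_word_d => //.
- exact: diag_comp_mul.
- exact: arrow_comp_mul.
- exact: reg_word_d.
- exact: diag_comp_mul.
- exact: arrow_comp_mul.
- by move=> n'; apply: path_word_nil.
Qed.

Fixpoint path_pred (x y : Q0 Q) (w : qpath x y) (n : nat) : pred (seq (Q0 Q * Q0 Q)) :=
  match w with
  | PathArr a => cons_pred (qtgt a, qsrc a) (cone_pred (qsrc a) (@reg_pred _) n)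
  | PathCons _ a w' => cons_pred (qtgt a, qsrc a) (cone_pred (qsrc a) (path_pred w') n)
  end.

(** Words along a path begin with an arrow, and Q has no loops. This keeps the words of the two
    summands of the next cone apart. *)
Lemma path_pred_diag x y (w : qpath x y) n e : path_pred w n ((y, y) :: e) = false.
Proof.
by case: w => [a|z a w]; rewrite /= xpair_eqE eqxx /=; case: eqP => // /esym/(HQ.1 a).
Qed.

Section Steps.
Variables (A : algType k) (v : Q0 Q) (Y : chain_complex (qalg D v) A).
Variables (g : forall n, seq L -> Y n) (W : nat -> pred (seq (Q0 Q * Q0 Q))).
Hypothesis W_diag : forall n e, W n ((v, v) :: e) = false.
Hypothesis basisY : forall n, word_basis (Z := right_of_bimod (Y n)) (g n) (W n).

Lemma cone_word_basis_step n :
  word_basis (Z := right_of_bimod (bar_shift Y n)) (shift_word (@diag_comp _ _ D v) g n)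
    (shift_pred v W n) ->
  word_basis (Z := cone Y n) (fun X => (g n X, shift_word (@diag_comp _ _ D v) g n X))
    (cone_pred v W n).
Proof.
move=> basisS; apply: word_basis_dsum basisS => //.
move=> e We; case: n We => //= n; case: e => //= d e We.
by apply/negP => /andP[/eqP dv _]; rewrite dv W_diag in We.
Qed.

Lemma shift_word_basis n :
  word_basis (Z := right_of_bimod (bar_shift Y n)) (shift_word (@diag_comp _ _ D v) g n)
    (shift_pred v W n).
Proof.
elim: n => [|n /cone_word_basis_step IHn].
  by apply: word_basis_zero => z; apply: zero_lmod_eq.
exact: (@word_basis_tensor _ _ D (v, v) _ (qblock_diag D v) _ _ _ _ IHn).
Qed.

Lemma cone_word_basis n :
  word_basis (Z := cone Y n) (fun X => (g n X, shift_word (@diag_comp _ _ D v) g n X))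
    (cone_pred v W n).
Proof. exact/cone_word_basis_step/shift_word_basis. Qed.
End Steps.

Lemma eq_word_basis (A : algType k) (Z : bimod k^o A) (g g' : seq L -> Z) W :
  g =1 g' -> word_basis g W -> word_basis g' W.
Proof. by move=> /funext->. Qed.

Lemma tensor_word_basis (a : Q1 Q) (A : algType k) (Y : chain_complex (qalg D (qsrc a)) A)
    (g : forall n, seq L -> Y n) W :
  (forall n e, W n ((qsrc a, qsrc a) :: e) = false) ->
  (forall n, word_basis (Z := right_of_bimod (Y n)) (g n) (W n)) ->
  forall n, word_basis (Z := right_of_bimod (tensor_complex (qmod D a) (bar Y) n))
    (tensor_word (@diag_comp _ _ D (qsrc a)) (arrow_comp HQ a) g n)
    (cons_pred (qtgt a, qsrc a) (cone_pred (qsrc a) W n)).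
Proof.
move=> W_diag basisY n.
have [phi [psi [phiK psiK phiE]]] := tensor_free_iso (qmod D a) (cone Y n).
have := @word_basis_tensor _ _ D (qtgt a, qsrc a) _ (qblock_arr D a HQ) _ _ _ _
  (cone_word_basis W_diag basisY n).
move=> /(word_basis_iso phiK psiK); apply: eq_word_basis => -[|x X]; first exact: linear0.
exact: phiE.
Qed.

Lemma reg_word_basis (A : algType k) n :
  word_basis (D := D) (Z := right_of_bimod (reg_complex A n)) (@reg_word _ A L n) (@reg_pred _ n).
Proof.
case: n => [|n]; first exact: word_basis_reg.
by apply: word_basis_zero => z; apply: zero_lmod_eq.
Qed.

Lemma path_word_basis x y (w : qpath x y) n :
  word_basis (Z := right_of_bimod (path_complex w n)) (path_word w n) (path_pred w n).
Proof.
elim: w n => [a|z a w IHw] n; apply: tensor_word_basis => //.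
- by move=> n' e; rewrite /reg_pred andbF.
- by move=> n'; apply: reg_word_basis.
- by move=> n' e; apply: path_pred_diag.
Qed.

(** With leading coefficient 1 these elements generate the term as a bimodule. *)
Definition path_gen x y (w : qpath x y) n (X : seq L) : bar (path_complex w) n :=
  bar_word (@diag_comp _ _ D y) (path_word w) 1 n X.
Definition word_pred x y (w : qpath x y) n : pred (seq (Q0 Q * Q0 Q)) :=
  cone_pred y (path_pred w) n.

Lemma path_gen_multilinear x y (w : qpath x y) n : seq_multilinear (path_gen w n).
Proof.
apply: bar_word_multilinear; first exact: diag_comp_lin.
by move=> n'; apply: path_word_multilinear.
Qed.

Lemma path_gen_basis x y (w : qpath x y) n :
  word_basis (Z := cone (path_complex w) n)
    (fun X => (path_word w n X, shift_word (@diag_comp _ _ D y) (path_word w) n X))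
    (word_pred w n).
Proof.
apply: cone_word_basis => n' *; [exact: path_pred_diag | exact: path_word_basis].
Qed.

Lemma path_gen_supp x y (w : qpath x y) n hs : ~~ word_pred w n (word_ends hs) ->
  path_gen w n (@linjs _ _ D hs) = 0.
Proof.
move=> /(wb_supp (path_gen_basis w n)) E; rewrite /path_gen /bar_word.
have /= -> := congr1 fst E; have /= -> := congr1 snd E.
exact: bgen0.
Qed.

Lemma path_gen_uniq x y (w : qpath x y) n (N : bimod (qalg D y) (qalg D x))
    (f : bihom (bar (path_complex w) n) N) :
  (forall hs, f (path_gen w n (linjs hs)) = 0) -> f = 0.
Proof.
move=> f0; apply: bihomE; apply: bgen_ind => [|c u v hu hv|c u v]; first by rewrite !linear0.
  by rewrite !linearP hu hv.
rewrite -[c]mulr1 -bgen_lact bihom_l.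
pose f1 := bicomp (right_of_bihom f) (freeb_unit _ (cone (path_complex w) n)).
rewrite -[f _]/(f1 (u, v)) (wb_uniq (path_gen_basis w n) (f := f1)) ?lactr0 //.
Qed.

Lemma path_gen_exist x y (w : qpath x y) n (N : bimod (qalg D y) (qalg D x))
    (E : seq (letter D) -> N) : word_multilinear E ->
  (forall hs, ~~ word_pred w n (word_ends hs) -> E hs = 0) ->
  exists f : bihom (bar (path_complex w) n) N, forall hs, f (path_gen w n (linjs hs)) = E hs.
Proof.
move=> mE E0.
have [f fE] := wb_exist (path_gen_basis w n) (N := right_of_bimod N) mE E0.
exists (freeb_bihom f) => hs.
by rewrite [LHS]freeb_bihomE fE lact1.
Qed.

(** The right side is already the Hochschild coboundary of the function X |-> f ([path_gen] X), with
    [Lmul0] in place of the product of Lambda. *)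
Lemma path_gen_d x y (w : qpath x y) n X0 X (N : bimod (qalg D y) (qalg D x))
    (f : bihom (bar (path_complex w) n) N) :
  f (cxd (bar (path_complex w)) n (path_gen w n.+1 (X0 :: X))) =
  lact (diag_comp y X0) (f (path_gen w n X))
  - merge_sum (@Lmul0 _ _ D) (@diag_comp _ _ D x) (fun Z => f (path_gen w n Z)) (X0 :: X).
Proof.
rewrite [X in f X](bar_word_d (@diag_comp_mul _ _ D y) (fun n => path_word_nil w n.+1)
  (path_word_d w)) linearB lact1; congr (_ - _); last first.
  apply: (merge_sum_map _ _ (f := f)); [exact: bihom_lin | exact: bihom_r].
rewrite shift_wordS -bihom_l; congr (f _).
by rewrite [RHS]bgen_lact mulr1.
Qed.
End PathComplex.

(** * Trajectories *)

Section Trajectories.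
Variables (Q : quiver) (HQ : simply_laced Q).
Local Notation ends := (Q0 Q * Q0 Q)%type.

Definition ends_of (p : nat -> nat) (x y : Q0 Q) (w : qpath x y) : seq ends :=
  map (@letter_ends Q) (letters p w).

Lemma ends_of_arr p (a : Q1 Q) : ends_of p (PathArr a) =
  nseq (p 1%N) (qtgt a, qtgt a) ++ (qtgt a, qsrc a) :: nseq (p 0%N) (qsrc a, qsrc a).
Proof. by rewrite /ends_of map_cat /= !map_nseq. Qed.
Lemma ends_of_cons p x (a : Q1 Q) (w : qpath x (qsrc a)) : ends_of p (@PathCons Q x a w) =
  nseq (p (plength w).+1) (qtgt a, qtgt a) ++ (qtgt a, qsrc a) :: ends_of p w.
Proof. by rewrite /ends_of map_cat /= map_nseq. Qed.

Lemma eq_ends_of (p p' : nat -> nat) x y (w : qpath x y) :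
  (forall i, (i <= plength w)%N -> p i = p' i) -> ends_of p w = ends_of p' w.
Proof.
elim: w => [a|z a w IHw] E; first by rewrite !ends_of_arr !E.
by rewrite !ends_of_cons E // IHw // => i iw; apply: E; apply: leq_trans iw _.
Qed.

Lemma size_ends_of (p : nat -> nat) x y (w : qpath x y) :
  size (ends_of p w) = (plength w + \sum_(i < (plength w).+1) p i)%N.
Proof.
elim: w => [a|z a w IHw].
  by rewrite ends_of_arr size_cat /= !size_nseq !big_ord_recr big_ord0 /=; lia.
by rewrite ends_of_cons size_cat /= size_nseq IHw [in RHS]big_ord_recr /=; lia.
Qed.

(** Only the letters in the algebras count in the degree of the resolution, which is therefore the
    total waiting time. *)
Lemma word_pred_ends_of (p : nat -> nat) x y (w : qpath x y) :
  word_pred w (\sum_(i < (plength w).+1) p i) (ends_of p w).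
Proof.
elim: w => [a|z a w IHw]; apply/cone_predP.
  exists (p 1%N), (p 0%N), ((qtgt a, qsrc a) :: nseq (p 0%N) (qsrc a, qsrc a)).
  split; [by rewrite !big_ord_recr big_ord0 /=; lia | exact: ends_of_arr | ].
  rewrite /= eqxx; apply/cone_predP; exists (p 0%N), 0%N, [::].
  by rewrite addn0 cats0.
exists (p (plength w).+1), (\sum_(i < (plength w).+1) p i)%N,
  ((qtgt a, qsrc a) :: ends_of p w).
split; [by rewrite [LHS]big_ord_recr /= addnC | exact: ends_of_cons | ].
by rewrite /= eqxx.
Qed.

Lemma ends_of_word_pred x y (w : qpath x y) n e : word_pred w n e ->
  exists p, e = ends_of p w /\ n = (\sum_(i < (plength w).+1) p i)%N.
Proof.
elim: w n e => [a|z a w IHw] n e /cone_predP[q [n' [[|d e'] [-> ->]]]] //= /andP[/eqP-> We].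
  have /cone_predP[q' [n'' [e'' [-> -> /andP[/eqP-> /eqP->]]]]] := We.
  exists (fun i => if i == 0%N then q' else q).
  by rewrite ends_of_arr cats0 !big_ord_recr big_ord0 /= add0n addn0 addnC.
have [p [-> ->]] := IHw _ _ We.
have pE i : (i <= plength w)%N -> (if i == (plength w).+1 then q else p i) = p i.
  by move=> iw; rewrite ltn_eqF.
exists (fun i => if i == (plength w).+1 then q else p i); split.
  by rewrite ends_of_cons eqxx; congr (_ ++ _ :: _); apply: eq_ends_of => i /pE.
rewrite [in RHS]big_ord_recr /= eqxx addnC; congr (_ + _)%N.
by apply: eq_bigr => i _; rewrite pE // -ltnS.
Qed.

Definition arrows (e : seq ends) : nat := count (fun d => d.1 != d.2) e.
(* The waiting time at the vertex that is followed by j arrows of the word. *)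
Fixpoint wait (j : nat) (e : seq ends) : nat :=
  if e is d :: e' then ((d.1 == d.2) && (arrows e' == j) + wait j e')%N else 0%N.

Lemma arrows_nseq q (v : Q0 Q) e : arrows (nseq q (v, v) ++ e) = arrows e.
Proof. by elim: q => //= q <-; rewrite eqxx. Qed.
Lemma wait_nseq j q (v : Q0 Q) e :
  wait j (nseq q (v, v) ++ e) = (wait j e + (if arrows e == j then q else 0))%N.
Proof.
elim: q => [|q IHq] /=; first by case: ifP; rewrite addn0.
by rewrite IHq eqxx arrows_nseq /=; case: ifP; lia.
Qed.

Lemma arrows_ends_of (p : nat -> nat) x y (w : qpath x y) : arrows (ends_of p w) = plength w.
Proof.
have nl (a : Q1 Q) : (qtgt a != qsrc a) by apply/eqP => /esym/(HQ.1 a).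
elim: w => [a|z a w IHw].
  by rewrite ends_of_arr arrows_nseq /= nl -[nseq _ _]cats0 arrows_nseq.
by rewrite ends_of_cons arrows_nseq /= nl IHw.
Qed.

Lemma wait_large j e : (arrows e < j)%N -> wait j e = 0%N.
Proof.
elim: e => //= d e IHe H; rewrite IHe; last by move: H; case: (_ == _) => /=; lia.
by case: eqP => //= _; case: eqP => //= E; move: H; rewrite E; case: (_ == _) => /=; lia.
Qed.

(** The word determines the waiting times: since Q has no loops, an arrow is never mistaken for a
    vertex. Hence distinct trajectories have distinct words. *)
Lemma wait_ends_of (p : nat -> nat) x y (w : qpath x y) j :
  (j <= plength w)%N -> wait j (ends_of p w) = p j.
Proof.
have nl (a : Q1 Q) : (qtgt a == qsrc a) = false by apply/eqP => /esym/(HQ.1 a).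
elim: w => [a|z a w IHw] jw.
  rewrite ends_of_arr wait_nseq /= nl -[nseq (p 0%N) _]cats0 arrows_nseq wait_nseq /=.
  by case: j jw => [|[|]] //= _; rewrite ?addn0.
rewrite ends_of_cons wait_nseq /= nl arrows_ends_of.
move: jw; rewrite leq_eqVlt => /orP[/eqP->|jw].
  by rewrite /= add1n eqxx wait_large // arrows_ends_of.
by rewrite add1n (gtn_eqF jw) addn0 add0n IHw.
Qed.

Lemma arrows_cat e1 e2 : arrows (e1 ++ e2) = (arrows e1 + arrows e2)%N.
Proof. exact: count_cat. Qed.

Lemma wait_insert j e1 (v : Q0 Q) e2 :
  wait j (e1 ++ (v, v) :: e2) = (wait j (e1 ++ e2) + (j == arrows e2))%N.
Proof.
elim: e1 => [|d e1 IHe] /=; first by rewrite eqxx eq_sym addnC.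
by rewrite IHe !arrows_cat /= eqxx addnA.
Qed.

Variables (x y : Q0 Q) (w : qpath x y).

Definition traj_word n (t : traj w n) : seq ends := codom (traj_ends t).

Lemma size_traj_word n (t : traj w n) : size (traj_word t) = n.
Proof. by rewrite size_codom card_ord. Qed.

Lemma traj_wordE n (t : traj w n) : traj_word t = ends_of (fun j => waiting t (inord j)) w.
Proof.
set p := fun j => _; have sE : size (letters p w) = n.
  rewrite -(size_map (@letter_ends Q)) size_ends_of -[RHS](eqP (valP t)); congr addn.
  by apply: eq_bigr => i _; rewrite /p inord_val.
apply: (@eq_from_nth _ (y, y)) => [|i].
  by rewrite size_traj_word size_map.
rewrite size_traj_word => ilt.
rewrite (nth_map (inl y)) ?sE // /traj_word codomE (nth_map (Ordinal ilt)) ?size_enum_ord //.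
by rewrite /traj_ends nth_enum_ord.
Qed.

Lemma waiting_wait n (t : traj w n) i : waiting t i = wait i (traj_word t).
Proof. by rewrite traj_wordE wait_ends_of ?inord_val // -ltnS. Qed.

Lemma traj_word_inj n : injective (@traj_word n).
Proof.
move=> t t' E; apply: val_inj; apply/ffunP => i; apply: val_inj.
by rewrite -[LHS]/(waiting t i) -[RHS]/(waiting t' i) !waiting_wait E.
Qed.

Lemma arrows_traj_word n (t : traj w n) : arrows (traj_word t) = plength w.
Proof. by rewrite traj_wordE arrows_ends_of. Qed.

Lemma traj_word_pred r (t : traj w (r + plength w)) : word_pred w r (traj_word t).
Proof.
have rE : (\sum_(i < (plength w).+1) waiting t (inord i))%N = r.
  apply/eqP; rewrite -(eqn_add2r (plength w)) addnC -[X in _ == X](eqP (valP t)).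
  by rewrite eqn_add2l; apply/eqP/eq_bigr => i _; rewrite inord_val.
by have := word_pred_ends_of (fun j => waiting t (inord j)) w; rewrite traj_wordE rE.
Qed.

Lemma word_pred_traj r e : word_pred w r e ->
  exists t : traj w (r + plength w), e = traj_word t.
Proof.
move=> /ends_of_word_pred[p [-> ->]].
set n := (_ + _)%N; have pn (i : 'I_(plength w).+1) : (p i < n.+1)%N.
  by rewrite ltnS /n (bigD1 i) //= -!addnA leq_addr.
pose f : {ffun 'I_(plength w).+1 -> 'I_n.+1} := [ffun i => Ordinal (pn i)].
have ft : (plength w + \sum_i f i == n)%N.
  by rewrite addnC; apply/eqP; congr addn; apply: eq_bigr => i _; rewrite ffunE.
exists (exist _ f ft); rewrite traj_wordE; apply: eq_ends_of => i iw.
by rewrite /waiting /= ffunE /= inordK.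
Qed.

Lemma traj_succ_insert n (t : traj w n) (s : traj w n.+1) e1 v e2 :
  traj_word s = e1 ++ (v, v) :: e2 -> traj_word t = e1 ++ e2 -> traj_succ t s.
Proof.
(* Waiting times are numbered from the source, which is on the right of the word, so the time raised
   by the inserted vertex has index [arrows e2]. *)
move=> sE tE; have jlt : (arrows e2 < (plength w).+1)%N.
  by rewrite ltnS -(arrows_traj_word t) tE arrows_cat leq_addl.
apply/existsP; exists (Ordinal jlt); apply/forallP => i; apply/eqP.
by rewrite !waiting_wait sE tE wait_insert.
Qed.
End Trajectories.

(** * Comparison with the path complex *)

Section ListForms.
Variable T : Type.
Variable mu : T -> T -> T.

Definition merge_at (x0 : T) i (s : seq T) : seq T :=
  take i s ++ mu (nth x0 s i) (nth x0 s i.+1) :: drop i.+2 s.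

Lemma nth_codom_ord n (X : 'I_n -> T) x0 (i : 'I_n) : nth x0 (codom X) i = X i.
Proof. by rewrite codomE (nth_map i) ?size_enum_ord // nth_ord_enum. Qed.

Lemma size_codom_ord n (X : 'I_n -> T) : size (codom X) = n.
Proof. by rewrite size_codom card_ord. Qed.

Lemma codom_ordP n (X : 'I_n -> T) (s : seq T) x0 :
  size s = n -> (forall i : 'I_n, X i = nth x0 s i) -> codom X = s.
Proof.
move=> sn E; apply: (@eq_from_nth _ x0); first by rewrite size_codom_ord.
move=> i; rewrite size_codom_ord => ilt.
by rewrite -[i]/(val (Ordinal ilt)) nth_codom_ord E.
Qed.

Lemma codom_tail n (X : 'I_n.+1 -> T) : codom (fun j => X (lift ord0 j)) = behead (codom X).
Proof.
apply: (codom_ordP (x0 := X ord0)); first by rewrite size_behead size_codom_ord.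
by move=> i; rewrite nth_behead -[i.+1]/(val (lift ord0 i)) nth_codom_ord.
Qed.

Lemma codom_init n (X : 'I_n.+1 -> T) :
  codom (fun j => X (widen_ord (leqnSn n) j)) = take n (codom X).
Proof.
apply: (codom_ordP (x0 := X ord0)); first by rewrite size_take size_codom_ord ltnSn.
by move=> i; rewrite nth_take // -[val i]/(val (widen_ord (leqnSn n) i)) nth_codom_ord.
Qed.

Lemma size_merge_at n x0 i (s : seq T) : size s = n.+1 -> (i < n)%N -> size (merge_at x0 i s) = n.
Proof. by move=> sn iltn; rewrite size_cat size_take /= size_drop sn; case: ifP; lia. Qed.

Lemma merge_at_cat x0 s1 u v s2 :
  merge_at x0 (size s1) (s1 ++ u :: v :: s2) = s1 ++ mu u v :: s2.
Proof.
rewrite /merge_at take_size_cat // !nth_cat ltnn subnn ltnNge leqnSn /= subSnn /=.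
congr (_ ++ _ :: _); rewrite drop_cat ltnNge ltnW //= subSn // subSnn /=.
by rewrite drop0.
Qed.
End ListForms.

Section MergeSumBig.
Variables (k : fieldType) (C A : algType k) (T : Type) (mu : T -> T -> T) (e : T -> A).

Lemma merge_sum_big (V : bimod C A) (phi : seq T -> V) x0 n (s : seq T) : size s = n.+1 ->
  merge_sum mu e phi s = \sum_(i < n) (-1) ^+ i *: phi (merge_at mu x0 i s)
    + (-1) ^+ n *: ract (phi (take n s)) (e (nth x0 s n)).
Proof.
elim: n s phi => [|n IHn] [|x [|x1 s]] // phi.
  by rewrite big_ord0 add0r scale1r.
move=> [sn]; rewrite merge_sum_cons (IHn _ (fun Z => phi (x :: Z))) /= ?sn //.
rewrite big_ord_recl /= expr0 scale1r /merge_at /= drop0 opprD addrA.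
congr (_ + _ + _); last by rewrite exprS mulN1r scaleNr.
rewrite -sumrN; apply: eq_bigr => i _.
by rewrite /bump /= add1n exprS mulN1r scaleNr.
Qed.
End MergeSumBig.

(** * Products of homogeneous elements of Lambda and the coboundary in terms of lists *)

Section HomogeneousProducts.
Variables (k : fieldType) (Q : quiver) (D : qset k Q).
Local Notation L := (Lambda D).
Implicit Types h : letter D.

Lemma qmul0l z v u (b : qblock D v u) : qmul (0 : qblock D z v) b = 0.
Proof. exact: (linear0 (mklin (qmul_linl b))). Qed.
Lemma qmul0r z v u (a : qblock D z v) : qmul a (0 : qblock D v u) = 0.
Proof. exact: (linear0 (mklin (qmul_linr a))). Qed.

Lemma Lmul_linj_out h h' p : p != ((tag h).1, (tag h').2) -> Lmul (linj h) (linj h') p = 0.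
Proof.
move=> hp; apply: big1 => u _.
have [hE|hN] := eqVneq (tag h) (p.1, u); last by rewrite linj_out // qmul0l.
have [h'E|h'N] := eqVneq (tag h') (u, p.2); last by rewrite [linj h' _]linj_out // qmul0r.
by move: hp; rewrite hE h'E /= -surjective_pairing eqxx.
Qed.

Lemma Lmul_linj h h' : exists v : qblock D (tag h).1 (tag h').2,
  Lmul (linj h) (linj h') = linj (mkletter (p := ((tag h).1, (tag h').2)) v).
Proof.
exists (Lmul (linj h) (linj h') ((tag h).1, (tag h').2)).
apply: functional_extensionality_dep => p.
have [->|hp] := eqVneq p ((tag h).1, (tag h').2); first by rewrite linj_in.
by rewrite Lmul_linj_out // linj_out // eq_sym.
Qed.

Lemma Lmul_linj0 h h' : (tag h).2 != (tag h').1 -> Lmul (linj h) (linj h') = 0.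
Proof.
move=> hh'; apply: functional_extensionality_dep => p; apply: big1 => u _.
have [hE|hN] := eqVneq (tag h) (p.1, u); last by rewrite linj_out // qmul0l.
rewrite [linj h' _]linj_out ?qmul0r //.
by apply: contraNneq hh' => h'E; rewrite hE h'E.
Qed.

Lemma Lmul0_linj0 h h' : (tag h).2 != (tag h').1 -> Lmul0 (linj h) (linj h') = 0.
Proof.
move=> hh'; apply: functional_extensionality_dep => p.
have E u : qmul (linj h (p.1, u)) (linj h' (u, p.2)) = 0.
  have [hE|hN] := eqVneq (tag h) (p.1, u); last by rewrite linj_out // qmul0l.
  rewrite [linj h' _]linj_out ?qmul0r //.
  by apply: contraNneq hh' => h'E; rewrite hE h'E.
by rewrite /Lmul0 !E; case: ifP; rewrite addr0.
Qed.

Lemma Lmul0_arrows h h' : (tag h).1 != (tag h).2 -> (tag h').1 != (tag h').2 ->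
  Lmul0 (linj h) (linj h') = 0.
Proof.
move=> hN h'N; apply: functional_extensionality_dep => p; rewrite /Lmul0.
rewrite linj_out ?qmul0l ?add0r; last by apply: contraNneq hN => ->.
case: ifP => // _; rewrite [linj h' _]linj_out ?qmul0r //.
by apply: contraNneq h'N => ->.
Qed.

(** In the sum over the middle vertex u, a diagonal factor forces u to be p.1 or p.2. These are the
    two terms of [Lmul0], counted once when p.1 = p.2. *)
Lemma Lmul_Lmul0 h h' : (tag h).1 = (tag h).2 \/ (tag h').1 = (tag h').2 ->
  Lmul (linj h) (linj h') = Lmul0 (linj h) (linj h').
Proof.
move=> diag; apply: functional_extensionality_dep => p; rewrite /Lmul /Lmul0.
have E u : u != p.1 -> u != p.2 -> qmul (linj h (p.1, u)) (linj h' (u, p.2)) = 0.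
  move=> u1 u2; case: diag => diag.
    rewrite linj_out ?qmul0l //; apply: contraNneq u1 => hE.
    by rewrite hE /= in diag; rewrite diag.
  rewrite [linj h' _]linj_out ?qmul0r //; apply: contraNneq u2 => hE.
  by rewrite hE /= in diag; rewrite diag.
rewrite (bigD1 p.1) //=; congr (_ + _).
case: eqP => [p12|/eqP p12].
  by apply: big1 => u u1; rewrite E // -p12.
rewrite (bigD1 p.2) 1?eq_sym //= big1 ?addr0 // => u /andP[u1 u2].
by rewrite E.
Qed.

Lemma Lmul_Linjr (y x : Q0 Q) (X : L) (v : qblock D y x) :
  Lmul X (@Linj _ _ D (y, x) v) (y, x) = lact (diag_comp y X) v.
Proof.
rewrite /Lmul /= (bigD1 y) //= big1 ?addr0 => [|u uy].
  by rewrite -[@Linj _ _ D (y, x) v _]/(linj (mkletter (p := (y, x)) v) (y, x)) linj_in qmul_diagl.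
rewrite -[@Linj _ _ D (y, x) v _]/(linj (mkletter (p := (y, x)) v) (u, x)) linj_out ?qmul0r //.
by rewrite /= xpair_eqE eqxx andbT eq_sym.
Qed.

Lemma Lmul_Linjl (y x : Q0 Q) (X : L) (v : qblock D y x) :
  Lmul (@Linj _ _ D (y, x) v) X (y, x) = ract v (diag_comp x X).
Proof.
rewrite /Lmul /= (bigD1 x) //= big1 ?addr0 => [|u ux].
  by rewrite -[@Linj _ _ D (y, x) v _]/(linj (mkletter (p := (y, x)) v) (y, x)) linj_in qmul_diagr.
rewrite -[@Linj _ _ D (y, x) v _]/(linj (mkletter (p := (y, x)) v) (y, u)) linj_out ?qmul0l //.
by rewrite /= xpair_eqE eqxx eq_sym.
Qed.

Lemma codom_hmerge n (X : 'I_n.+1 -> L) (i : 'I_n) x0 :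
  codom (hmerge i X) = merge_at (@Lmul _ _ D) x0 i (codom X).
Proof.
apply: (codom_ordP (x0 := x0)); first by apply: size_merge_at; rewrite ?size_codom_ord.
have szT : size (take i (codom X)) = i.
  by rewrite size_takel // size_codom_ord ltnW // ltnS ltnW.
move=> j; rewrite /hmerge /merge_at nth_cat szT.
have [ji|ij] := ltnP j i.
  by rewrite nth_take // -[val j]/(val (widen_ord (leqnSn n) j)) nth_codom_ord.
case: eqP => [->|/eqP jni].
  rewrite subnn /= -[val i]/(val (widen_ord (leqnSn n) i)) nth_codom_ord.
  by rewrite -[(val i).+1]/(val (lift ord0 i)) nth_codom_ord.
have {jni}ij : (i < j)%N by rewrite ltn_neqAle ij andbT eq_sym.
rewrite -(subnSK ij) /= nth_drop addSn subnKC //.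
by rewrite -[(val j).+1]/(val (lift ord0 j)) nth_codom_ord.
Qed.

Lemma hochschild_sum n (I : Type) (r : seq I) (P : pred I) (F : I -> ('I_n -> L) -> L) X :
  hochschild (fun Y => \sum_(i <- r | P i) F i Y) X = \sum_(i <- r | P i) hochschild (F i) X.
Proof.
elim: r => [|i r IHr].
  have E Y : \sum_(i <- [::] | P i) F i Y = (0 : k) *: (0 : L) + 0.
    by rewrite big_nil scaler0 addr0.
  rewrite (hochschild_linear (F := fun=> 0) (G := fun=> 0) E) scale0r add0r big_nil.
  have Lr f : Lmul f (0 : L) = 0 := linear0 (mklin (Lmul_linr f)).
  have Ll f : Lmul (0 : L) f = 0 := linear0 (mklin (Lmul_linl f)).
  rewrite /hochschild Lr Ll.
  by rewrite scaler0 addr0 add0r big1 // => j _; rewrite scaler0.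
rewrite big_cons -IHr; case: ifP => Pi; last first.
  by congr hochschild; apply: funext => Y; rewrite big_cons Pi.
have E Y : \sum_(j <- i :: r | P j) F j Y = (1 : k) *: F i Y + \sum_(j <- r | P j) F j Y.
  by rewrite big_cons Pi scale1r.
by rewrite (hochschild_linear E) scale1r.
Qed.

Lemma hochschild_codom n (F : ('I_n -> L) -> L) (Phi : seq L -> L) (X : 'I_n.+1 -> L) x0 :
  (forall Y, F Y = Phi (codom Y)) ->
  hochschild F X = Lmul (X ord0) (Phi (behead (codom X)))
  + \sum_(i < n) (-1) ^+ i.+1 *: Phi (merge_at (@Lmul _ _ D) x0 i (codom X))
  + (-1) ^+ n.+1 *: Lmul (Phi (take n (codom X))) (X ord_max).
Proof.
move=> FE; rewrite /hochschild !FE codom_tail codom_init; congr (_ + _ + _).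
by apply: eq_bigr => i _; rewrite FE (codom_hmerge _ _ x0).
Qed.
End HomogeneousProducts.

(** * The isomorphism between the Hom complex and the complex along the path *)

Section PathCohomologyIso.
Variables (k : fieldType) (Q : quiver) (HQ : simply_laced Q) (D : qset k Q).
Variables (x y : Q0 Q) (w : qpath x y).
Local Notation L := (Lambda D).
Local Notation m := (plength w).
Local Notation N := (path_coef D x y).
Local Notation P r := (bar (path_complex D w) r).
Local Notation gen := (path_gen HQ w).

Lemma codom_update n (X : 'I_n -> L) (i : 'I_n) (v : L) :
  codom (dfwith (T := fun=> L : Type) X (i := i) v) =
  take i (codom X) ++ v :: drop i.+1 (codom X).
Proof.
have szT : size (take i (codom X)) = i by rewrite size_takel // size_codom_ord ltnW.
apply: (codom_ordP (x0 := v)).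
  by rewrite size_cat /= size_drop szT size_codom_ord; have := ltn_ord i; lia.
move=> j; rewrite ndfwithE nth_cat szT; have [ji|ij] := ltnP j i.
  by rewrite nth_take // nth_codom_ord -val_eqE gtn_eqF.
have [->|nij] := eqVneq i j; first by rewrite subnn.
have {nij}ij : (i < j)%N by rewrite ltn_neqAle ij andbT val_eqE.
by rewrite -(subnSK ij) /= nth_drop subnKC // nth_codom_ord.
Qed.

Section GenValue.
Variables (r : nat) (f : bihom (P r) N) (t : traj w (r + m)).

Definition gen_value (z : dprod (traj_factor D t)) : N := f (gen r (codom (traj_tuple z))).

Lemma traj_tuple_dfwith (z : dprod (traj_factor D t)) i (v : traj_factor D t i) :
  traj_tuple (dfwith z v) =
  dfwith (T := fun=> L : Type) (traj_tuple z) (i := i) (@Linj _ _ D (traj_ends t i) v).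
Proof.
apply: functional_extensionality_dep => j; rewrite /traj_tuple ndfwithE.
have [<-|nij] := eqVneq i j; first by rewrite dfwith_in.
by rewrite dfwith_out.
Qed.

Fact gen_value_multilin : multilinear gen_value.
Proof.
move=> z i c u v; rewrite /gen_value !traj_tuple_dfwith !codom_update Linj_lin.
by rewrite (path_gen_multilinear HQ w) linearP.
Qed.
End GenValue.

(** The isomorphism of complexes: see [gen_values_inj], [gen_values_surj] and [gen_values_d]. The
    degree is written r + m because r.+1 + m is then (r + m).+1 by computation. *)
Definition gen_values r (f : bihom (P r) N) : Kobj D w (r + m) :=
  fun t => ktensor_lift (@gen_value_multilin r f t).

Lemma gen_valuesE r f t z : gen_values (r := r) f t (kpure z) = f (gen r (codom (traj_tuple z))).
Proof. exact: ktensor_liftE. Qed.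

Lemma gen_values_lin r : linear (@gen_values r).
Proof.
move=> c f g; apply: functional_extensionality_dep => t; apply: lhomP.
apply: ktensorP => [||z]; try exact: linearP.
by rewrite dprodDE dprodZE lhomDE lhomZE !gen_valuesE bihomDE bihomZE.
Qed.

Definition slots n (t : traj w n) (s : seq L) : dprod (traj_factor D t) :=
  fun i => nth 0 s i (traj_ends t i).

Lemma kpure0 n (t : traj w n) (z : dprod (traj_factor D t)) i : z i = 0 -> kpure z = 0.
Proof.
move=> zi; have zE : z = dfwith z (0 : traj_factor D t i).
  apply: functional_extensionality_dep => j.
  by have [<-|nij] := eqVneq i j; [rewrite dfwith_in | rewrite dfwith_out].
rewrite zE; exact (linear0 (mklin (@kpure_multilin k n (traj_factor D t) z i))).
Qed.

Let d0 : letter D := mkletter (p := (y, y)) 0.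

Lemma nth_linjs (hs : seq (letter D)) i : (i < size hs)%N ->
  nth 0 (linjs hs) i = linj (nth d0 hs i).
Proof. exact: nth_map. Qed.
Lemma slots_out n (t : traj w n) hs : size hs = n -> traj_word t <> word_ends hs ->
  kpure (slots t (linjs hs)) = 0.
Proof.
move=> sn te; have [i ni] : exists i : 'I_n, tag (nth d0 hs i) != traj_ends t i.
  apply: contrapT => all_eq; apply: te; apply: (codom_ordP (x0 := (y, y))).
    by rewrite size_map.
  move=> i; rewrite (nth_map d0) ?sn //; apply/esym/eqP.
  by apply: contraPT all_eq => ni; apply; exists i.
by apply: (@kpure0 _ _ _ i); rewrite /slots nth_linjs ?sn // linj_out.
Qed.

Lemma slots_in n (t : traj w n) hs : traj_word t = word_ends hs ->
  codom (traj_tuple (slots t (linjs hs))) = linjs hs.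
Proof.
move=> te; have sn : size hs = n by rewrite -(size_traj_word t) te size_map.
apply: (codom_ordP (x0 := 0)); first by rewrite size_map.
move=> i; rewrite nth_linjs ?sn // /traj_tuple /slots nth_linjs ?sn //.
have ti : tag (nth d0 hs i) = traj_ends t i.
  by rewrite -(nth_map d0 (y, y) (fun h : letter D => tag h)) ?sn // -[map _ _]te nth_codom_ord.
by rewrite -[in RHS](mkletterK ti).
Qed.

Lemma gen_values_inj r (f : bihom (P r) N) : gen_values f = 0 -> f = 0.
Proof.
move=> f0; apply: (path_gen_uniq (HQ := HQ)) => hs.
have [Whs|/path_gen_supp->] := boolP (word_pred w r (word_ends hs)); last exact: linear0.
have [t te] := word_pred_traj Whs.
by rewrite -(slots_in (esym te)) -gen_valuesE f0.
Qed.

Lemma gen_values_surj r (F : Kobj D w (r + m)) : exists f, gen_values (r := r) f = F.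
Proof.
(* At most one trajectory contributes on a word of homogeneous letters, but the full sum is visibly
   multilinear. The test on the length is there because [slots] ignores the letters after the first
   r + m. *)
pose E hs : N :=
  if size hs == (r + m)%N then \sum_(t : traj w (r + m)) F t (kpure (slots t (linjs hs))) else 0.
have mE : word_multilinear E.
  move=> hs1 p hs2 c u v; rewrite /E !size_cat /=.
  case: eqP => [sn|_]; last by rewrite scaler0 addr0.
  rewrite scaler_sumr -big_split; apply: eq_bigr => t _ /=.
  have ilt : (size hs1 < r + m)%N by rewrite -sn addnS ltnS leq_addr.
  have [z0 slE] : exists z0 : dprod (traj_factor D t), forall a : qblock D p.1 p.2,
      slots t (linjs (hs1 ++ mkletter a :: hs2)) =
      dfwith z0 (linj (mkletter a) (traj_ends t (Ordinal ilt))).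
    exists (slots t (linjs (hs1 ++ mkletter (0 : qblock D p.1 p.2) :: hs2))) => a.
    apply: functional_extensionality_dep => j.
    have [<-|nij] := eqVneq (Ordinal ilt) j.
      by rewrite dfwith_in /slots /linjs map_cat nth_cat size_map /= ltnn subnn.
    rewrite dfwith_out // /slots /linjs !map_cat !nth_cat size_map /=.
    case: ltnP => // ij.
    have {}ij : (size hs1 < j)%N by rewrite ltn_neqAle ij andbT -val_eqE in nij *.
    by rewrite -(subnSK ij).
  have lin q : linear (fun a : qblock D p.1 p.2 => linj (mkletter a) q).
    by move=> d a b; rewrite [linj _]Linj_lin.
  by rewrite !slE lin kpure_multilin linearP.
have E0 hs : ~~ word_pred w r (word_ends hs) -> E hs = 0.
  move=> nW; rewrite /E; case: eqP => // sn; apply: big1 => t _.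
  rewrite slots_out ?linear0 // => te; move: nW; rewrite -te.
  by rewrite (traj_word_pred).
have [f fE] := path_gen_exist HQ mE E0; exists f.
apply: functional_extensionality_dep => t; apply: lhomP.
apply: ktensorP => [||z]; try exact: linearP.
pose hs := [seq mkletter (z i) | i <- enum 'I_(r + m)].
have hsE : linjs hs = codom (traj_tuple z) by rewrite codomE /linjs -map_comp.
have sn : size hs = (r + m)%N by rewrite size_map size_enum_ord.
have te : traj_word t = word_ends hs by rewrite /word_ends -map_comp /traj_word codomE.
rewrite gen_valuesE -hsE fE /E sn eqxx (bigD1 t) //= big1 ?addr0 => [|t' t't]; last first.
  rewrite slots_out ?linear0 // -te => E'.
  by case/eqP: t't; apply: (traj_word_inj HQ).
congr (F t (kpure _)); apply: functional_extensionality_dep => i.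
by rewrite /slots hsE nth_codom_ord /traj_tuple /Linj dfwith_in.
Qed.

Section Differential.
Variables (r : nat) (f : bihom (P r) N).
Local Notation n := (r + m)%N.

(** For R the trajectories that s succeeds, the coboundary of this function gives the component at s
    of the differential. Being defined on lists, it can be compared with [merge_sum]. *)
Definition fsum (R : pred (traj w n)) (s : seq L) : L :=
  \sum_(t | R t) extend0 (gen_values f t) (fun i => nth 0 s i).

Lemma extend0_slots (t : traj w n) (s : seq L) :
  extend0 (gen_values f t) (fun i => nth 0 s i) =
  @Linj _ _ D (y, x) (gen_values f t (kpure (slots t s))).
Proof. by []. Qed.

Lemma Linj0 p : @Linj _ _ D p 0 = 0.
Proof. exact: (linear0 (mklin (@Linj_lin _ _ D p))). Qed.

(** At most one trajectory has the given word, and both sides vanish if none has. The condition on R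
    says that this trajectory is among those summed over. *)
Lemma fsum_letters (R : pred (traj w n)) hs : size hs = n ->
  (forall t, traj_word t = word_ends hs -> R t) ->
  fsum R (linjs hs) = @Linj _ _ D (y, x) (f (gen r (linjs hs))).
Proof.
move=> sn HR.
have out t : traj_word t <> word_ends hs ->
    extend0 (gen_values f t) (fun i => nth 0 (linjs hs) i) = 0.
  by move=> te; rewrite extend0_slots slots_out // linear0 Linj0.
have [Whs|nW] := boolP (word_pred w r (word_ends hs)); last first.
  rewrite path_gen_supp // linear0 Linj0; apply: big1 => t _; apply: out => te.
  by move: nW; rewrite -te (traj_word_pred).
have [t te] := word_pred_traj Whs.
rewrite /fsum (bigD1 t) ?HR //= big1 ?addr0 => [|t' /andP[_ t't]]; last first.
  apply: out => te'; case/eqP: t't; apply: (traj_word_inj HQ).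
  by rewrite te' te.
by rewrite extend0_slots gen_valuesE (slots_in (esym te)).
Qed.

Lemma fsum0 (R : pred (traj w n)) (s : seq L) : size s = n -> 0 \in s -> fsum R s = 0.
Proof.
move=> sn s0; have ilt : (index (0%R : L) s < n)%N by rewrite -sn index_mem.
apply: big1 => t _; rewrite extend0_slots (@kpure0 _ _ _ (Ordinal ilt)) ?linear0 ?Linj0 //.
by rewrite /slots nth_index.
Qed.

Variables (s : traj w n.+1) (z : dprod (traj_factor D s)).
Let X := traj_tuple z.
Let hs : seq (letter D) := [seq mkletter (z i) | i <- enum 'I_n.+1].
Let R : pred (traj w n) := fun t => traj_succ t s.

Lemma codom_traj_letters : codom X = linjs hs.
Proof. by rewrite codomE /linjs /hs -map_comp. Qed.
Lemma size_traj_letters : size hs = n.+1.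
Proof. by rewrite /hs size_map size_enum_ord. Qed.
Lemma ends_traj_letters : traj_word s = word_ends hs.
Proof. by rewrite /word_ends /hs -map_comp /traj_word codomE. Qed.

(** All trajectories over w have m arrows in their words, so the letter d removed from s can only be
    a vertex. *)
Lemma traj_succ_remove (t : traj w n) (e1 e2 : seq (Q0 Q * Q0 Q)) d :
  traj_word s = e1 ++ d :: e2 -> traj_word t = e1 ++ e2 -> R t.
Proof.
move=> sE tE; have := etrans (arrows_traj_word HQ s) (esym (arrows_traj_word HQ t)).
rewrite sE tE.
rewrite !arrows_cat /= => ar; have {ar} : d.1 = d.2.
  by apply/eqP; move: ar; case: (d.1 == d.2) => //=; lia.
case: d sE => a b sE /= ab; subst b.
exact: (traj_succ_insert HQ sE tE).
Qed.

Lemma fsum_behead : fsum R (behead (codom X)) = @Linj _ _ D (y, x) (f (gen r (behead (codom X)))).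
Proof.
have -> : behead (codom X) = linjs (behead hs) by rewrite codom_traj_letters /linjs behead_map.
rewrite fsum_letters ?size_behead ?size_traj_letters // => t te.
have := ends_traj_letters; have := size_traj_letters; case: (hs) te => // h hs' te _ sE.
by apply: (@traj_succ_remove t [::] _ (tag h) sE).
Qed.

Lemma fsum_init : fsum R (take n (codom X)) = @Linj _ _ D (y, x) (f (gen r (take n (codom X)))).
Proof.
have szt : size (take n hs) = n by rewrite size_takel ?size_traj_letters.
have -> : take n (codom X) = linjs (take n hs) by rewrite codom_traj_letters /linjs map_take.
rewrite fsum_letters // => t te.
have := ends_traj_letters; rewrite -[hs](cat_take_drop n) /word_ends map_cat.
have : size (drop n hs) = 1%N by rewrite size_drop size_traj_letters subSnn.
case: (drop n hs) => // h [] // _ sE.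
by apply: (@traj_succ_remove t _ [::] (tag h) sE); rewrite cats0.
Qed.

(** Here alpha disappears. If the letters do not compose, both products are 0; if one of them is a
    vertex, the products agree and [fsum_letters] applies; for two arrows the products may differ,
    but both sides are 0. *)
Lemma fsum_merge (i : 'I_n) :
  fsum R (merge_at (@Lmul _ _ D) 0 i (codom X)) =
  @Linj _ _ D (y, x) (f (gen r (merge_at (@Lmul0 _ _ D) 0 i (codom X)))).
Proof.
have gen0 s' : 0 \in s' -> f (gen r s') = 0.
  by move=> s0; rewrite (seq_multilinear0 (path_gen_multilinear HQ w r)) ?linear0.
rewrite codom_traj_letters.
have [hs1 [h [h' [hs2 [hsE si]]]]] :
    exists hs1 h h' hs2, hs = hs1 ++ h :: h' :: hs2 /\ size hs1 = i.
  exists (take i hs), (nth d0 hs i), (nth d0 hs i.+1), (drop i.+2 hs).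
  have := ltn_ord i; have := size_traj_letters; set i' := nat_of_ord i => sh il.
  split; last by rewrite size_takel // sh ltnW // ltnS ltnW.
  rewrite -[LHS](cat_take_drop i') (drop_nth d0) ?sh 1?ltnW // (drop_nth d0) ?sh //.
have sz : size (hs1 ++ h :: hs2) = n.
  by have := size_traj_letters; rewrite hsE !size_cat /= !addnS => -[].
have := ends_traj_letters; rewrite hsE /linjs !map_cat /= -si.
rewrite -(size_map (@linj _ _ D) hs1) !merge_at_cat.
move=> sE; rewrite /word_ends map_cat /= -!/(word_ends _) in sE.
have [hh'|hh'] := eqVneq (tag h).2 (tag h').1; last first.
  rewrite Lmul_linj0 // Lmul0_linj0 // gen0 ?Linj0 ?fsum0 //.
  - by move: sz; rewrite !size_cat /= !size_map.
  - by rewrite mem_cat inE eqxx orbT.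
  - by rewrite mem_cat inE eqxx orbT.
have [v] := Lmul_linj h h'; set mh := mkletter _ => vE.
have K : (forall t, traj_word t = word_ends (hs1 ++ mh :: hs2)
    -> R t) -> fsum R (map (@linj _ _ D) hs1 ++ Lmul (linj h) (linj h') :: map (@linj _ _ D) hs2)
    = @Linj _ _ D (y, x) (f (gen r (map (@linj _ _ D) hs1 ++
      Lmul (linj h) (linj h') :: map (@linj _ _ D) hs2))).
  move=> HR; have := fsum_letters (hs := hs1 ++ mh :: hs2) _ HR.
  by rewrite /linjs !map_cat /= -vE; apply; move: sz; rewrite !size_cat.
have [dh|ndh] := eqVneq (tag h).1 (tag h).2.
  rewrite -Lmul_Lmul0; last by left.
  apply: K => t te; apply: (@traj_succ_remove t (word_ends hs1) _ (tag h) sE).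
  by rewrite te /word_ends map_cat /= dh hh' -surjective_pairing.
have [dh'|ndh'] := eqVneq (tag h').1 (tag h').2.
  rewrite -Lmul_Lmul0; last by right.
  apply: K => t te.
  apply: (@traj_succ_remove t (word_ends hs1 ++ [:: tag h]) (word_ends hs2) (tag h')).
    by rewrite -catA.
  by rewrite te /word_ends map_cat /= -catA /= -dh' -hh' -surjective_pairing.
(* Merging two arrows leaves too few arrows for a trajectory over w. *)
have nW (t : traj w n) : traj_word t <> word_ends (hs1 ++ mh :: hs2).
  move=> te; have := etrans (arrows_traj_word HQ s) (esym (arrows_traj_word HQ t)).
  rewrite sE te /word_ends map_cat !arrows_cat /= ndh ndh'.
  by case: (_ != _) => /=; lia.
rewrite K => [|t /nW //]; rewrite Lmul0_arrows // [in RHS]gen0; last first.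
  by rewrite mem_cat inE eqxx orbT.
have := @path_gen_supp _ _ HQ D _ _ w r (hs1 ++ mh :: hs2).
rewrite /linjs map_cat /= -vE => -> //.
  by rewrite linear0.
by apply/negP => /word_pred_traj[t te]; apply: (nW t).
Qed.

(** Both sides consist of the left action of the first factor, the inner merges and the right action
    of the last factor. [merge_sum] begins with sign + and is subtracted, which gives the signs
    (-1)^(i+1) of the coboundary. *)
Lemma gen_values_kpure_d : gen_values (precomp (cxd (bar (path_complex D w)) r) f) s (kpure z)
  = Kdiff_fun (gen_values f) s (kpure z).
Proof.
have sumE (I : Type) (l : seq I) (S : pred I) (G : I -> lhom (traj_tensor D s) N) u :
    (\sum_(i <- l | S i) G i) u = \sum_(i <- l | S i) G i u.
  by elim/big_rec2: _ => // i a b _ <-.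
rewrite [RHS]sumE (eq_bigr (fun t => hochschild (extend0 (gen_values f t)) X (y, x))); last first.
  by move=> t _; apply: ktensor_liftE.
rewrite -(dprod_sumE _ _ (fun t => hochschild (extend0 (gen_values f t)) X)) -hochschild_sum.
rewrite (hochschild_codom (Phi := fsum R) X 0) => [|Y]; last first.
  apply: eq_bigr => t _; congr extend0; apply: funext => i.
  by rewrite nth_codom_ord.
rewrite fsum_behead fsum_init (eq_bigr (fun i : 'I_n => @Linj _ _ D (y, x)
    ((-1) ^+ i.+1 *: f (gen r (merge_at (@Lmul0 _ _ D) 0 i (codom X)))))); last first.
  move=> i _; rewrite fsum_merge.
  exact: esym (linearZ_LR (mklin (@Linj_lin _ _ D (y, x))) _ _).
rewrite !dprodDE dprod_sumE dprodZE Lmul_Linjr Lmul_Linjl gen_valuesE -/X.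
have XE : codom X = X ord0 :: behead (codom X).
  have : size (codom X) = n.+1 by rewrite size_codom_ord.
  by have := nth_codom_ord X 0 ord0; case: (codom X) => //= a l ->.
rewrite -[LHS]/(f (cxd (bar (path_complex D w)) r (gen r.+1 (codom X)))).
rewrite {1}XE path_gen_d -XE -[RHS]addrA; congr (_ + _).
rewrite (merge_sum_big _ _ _ 0 (n := n)) ?size_codom_ord // opprD -sumrN.
congr (_ + _); last first.
  rewrite exprS mulN1r scaleNr; congr (- (_ *: ract _ (diag_comp x _))).
  exact: (nth_codom_ord X 0 ord_max).
apply: eq_bigr => i _; rewrite exprS mulN1r scaleNr.
rewrite -[@Linj _ _ D (y, x) _ _]/(linj (@mkletter _ _ D (y, x) _) (y, x)) linj_in.
by [].
Qed.
End Differential.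

Lemma gen_values_d r (f : bihom (P r) N) :
  gen_values (precomp (cxd (bar (path_complex D w)) r) f) = Kdiff_fun (gen_values f).
Proof.
apply: functional_extensionality_dep => s; apply: lhomP.
by apply: ktensorP => [||z]; try exact: linearP; apply: gen_values_kpure_d.
Qed.

Lemma plength_gt0 : (0 < m)%N.
Proof. by case: (w). Qed.

(** A trajectory over w lasts at least m, so there are no nonzero coboundaries in degree m, just as
    in degree 0 of the Hom complex. *)
Lemma Kobj_pred_eq0 (u : Kobj D w m.-1) : u = 0.
Proof.
apply: functional_extensionality_dep => t; have := valP t.
move: (\sum_i _)%N => S /eqP E; exfalso; have := plength_gt0; lia.
Qed.

Lemma path_cohom_Ext (aug : bihom (path_complex D w 0%N) (path_bimod D w)) (res : resolves aug) r :
  exists theta : {linear path_cohom D w (r + m) -> Ext (bar_of_resolves res) N r},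
  bijective theta.
Proof.
set B := bar_of_resolves res; pose psiL n : {linear bihom (P n) N -> Kobj D w (n + m)} :=
  mklin (@gen_values_lin n).
have dE n (v : bihom (P n) N) :
    psiL n.+1 (cdiff (hom_complex B N) n v) = cdiff (Kcomplex D w) (n + m) (psiL n v).
  exact: gen_values_d.
have psi0 n (v : bihom (P n) N) : psiL n v = 0 -> v = 0 by exact: gen_values_inj.
have [||||Theta Theta_bij _] := @homology_iso k _ _ _ _ _ _ (cdiff_in (hom_complex B N) r)
    (cdiff (hom_complex B N) r) (cdiff_in (Kcomplex D w) (r + m))
    (cdiff (Kcomplex D w) (r + m)) (psiL r).
- by move=> v dv; rewrite -dE dv linear0.
- move=> v _ [u <-]; case: (r) u => [|r'] u; first by exists 0; rewrite !linear0.
  by exists (psiL r' u); rewrite -dE.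
- move=> v' dv'; have [v vE] := gen_values_surj v'; exists v; split; last exact: vE.
  by apply: psi0; rewrite dE -[X in cdiff _ _ X]vE in dv' *.
- case: (r) => [|r'] v _ [u'].
    rewrite (_ : u' = 0) ?linear0 => [/esym/psi0->|]; last exact: Kobj_pred_eq0.
    by exists 0.
  have [u <-] := gen_values_surj u' => E; exists u.
  apply/eqP; rewrite -subr_eq0; apply/eqP/psi0; rewrite linearB dE.
  by apply/eqP; rewrite subr_eq0; apply/eqP.
(* [Theta] goes from Ext to the cohomology along w, so its inverse is the map wanted. *)
have [theta ThetaK thetaK] := Theta_bij.
have theta_lin : linear theta.
  by move=> c u v; rewrite -{1}[u]thetaK -{1}[v]thetaK -linearP ThetaK.
by exists (mklin theta_lin); exists Theta.
Qed.
End PathCohomologyIso.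

(** * The unit isomorphism of the tensor product, the resolution of M_w and the theorem *)

Section TensorUnit.
Variables (k : fieldType) (C B : algType k) (M : bimod C B).
Local Notation MB := (tensor M (reg_bimod B)).

Fact act_linl (b : reg_bimod B) : linear (fun m : M => ract m (b : B)).
Proof. exact: ract_linl. Qed.
Fact act_linr (m : M) : linear (fun b : reg_bimod B => ract m (b : B)).
Proof. exact: ract_linr. Qed.
Fact act_bal (m : M) b (b' : reg_bimod B) : ract (ract m b) (b' : B) = ract m (lact b b' : B).
Proof. exact: esym (ractM m b b'). Qed.
Definition act_map : {linear MB -> M} := tensor_lift act_linl act_linr act_bal.
Lemma act_mapE m b : act_map (pure m b) = ract m (b : B).
Proof. exact: tensor_liftE. Qed.

Definition act_bihom : bihom MB M.
Proof.
apply: (@mkbihom _ _ _ MB M act_map); first exact: linearP.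
- move=> c; apply: tensor_ind => [|z u v hu hv|m b].
  + by rewrite lactr0 linear0 lactr0.
  + by rewrite lact_linr !linearP hu hv lact_linr.
  + by rewrite tensor_lactE !act_mapE lract.
- move=> t a; move: t; apply: tensor_ind => [|c u v hu hv|m b].
  + by rewrite ract0l linear0 ract0l.
  + by rewrite ract_linl !linearP hu hv ract_linl.
  + by rewrite tensor_ractE !act_mapE -ractM.
Defined.

(** Every tensor u over B equals [act_map] u (x) 1. *)
Lemma act_bihom_inj t : act_bihom t = 0 -> t = 0.
Proof.
have E u : u = pure (act_map u) ((1 : B) : reg_bimod B) :> MB.
  move: u; apply: tensor_ind => [|c u v hu hv|m b].
  - by rewrite linear0 pure0l.
  - by rewrite linearP pure_linl -hu -hv.
  - by rewrite act_mapE pure_bal; congr pure; apply: esym (mulr1 _).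
by move=> t0; rewrite [t]E -[act_map t]/(act_bihom t) t0 pure0l.
Qed.
Lemma act_bihom_surj m : exists t, act_bihom t = m.
Proof. by exists (pure m ((1 : B) : reg_bimod B)); rewrite [LHS]act_mapE ract1. Qed.
End TensorUnit.

Lemma Tor_eq0_exact (k : fieldType) (C B A : algType k) (M : bimod C B) (N : bimod B A)
    (R : proj_resolution (left_of_bimod N)) n (t : tensor M (R n.+1)) :
  (forall c : Tor M R n.+1, c = 0) -> tensor_map M (pres_d R n) t = 0 ->
  exists u, tensor_map M (pres_d R n.+1) u = t.
Proof.
move=> tor0 dt; have kt : tor_d_out M R n.+1 t == 0 by apply/eqP.
have := tor0 (hclass (tor_d M R n.+1) (Ker kt : ker (tor_d_out M R n.+1))).
by move=> /qpi_eq0/asboolP.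
Qed.

Lemma path_resolves (k : fieldType) (Q : quiver) (D : qset k Q) (x y : Q0 Q) (w : qpath x y) :
  Tor_vanishing D w ->
  exists aug : bihom (path_complex D w 0%N) (path_bimod D w), resolves aug.
Proof.
elim: w => [a _|z a w IHw [tor0 /IHw[aug res]]].
  (* For a single arrow the resolved left module is the algebra at the source, whose projectivity
     replaces Tor-vanishing. The complex then resolves M_a (x) A, and [act_bihom] identifies this
     with M_a. *)
  have tor0 := @tor_projective _ _ _ (qmod D a) _ (@reg_projective_left _ (qalg D (qsrc a))).
  have res := tensor_bar_resolves (reg_resolves (qalg D (qsrc a))) tor0.
  by eexists; apply: (resolves_iso res (@act_bihom_inj _ _ _ _) (@act_bihom_surj _ _ _ _)).
eexists; apply: (tensor_bar_resolves res) => R n t.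
by apply: Tor_eq0_exact => c; apply: tor0.
Qed.

Theorem theorem5p11 (k : fieldType) (Q : quiver) (HQ : simply_laced Q)
    (D : qset k Q) (x y : Q0 Q) (w : qpath x y)
    (Hm : (2 <= plength w)%N) (HT : Tor_vanishing D w) (r : nat) :
  exists phi : forall P : proj_resolution (path_bimod D w),
      {linear path_cohom D w (plength w + r)%N -> Ext P (path_coef D x y) r},
    (forall P : proj_resolution (path_bimod D w), bijective (phi P)) /\
    resolution_natural (fun P => phi P).
Proof.
have [aug res] := path_resolves HT; rewrite addnC.
have [theta theta_bij] := path_cohom_Ext HQ res r.
exact: (Ext_natural_iso theta_bij).
Qed.
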